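(* There are polynomial-time search-to-decision and counting-to-decision reductions for isomorphism of groups from $\mathfrak{B}(p,2,N)$ given by Cayley tables. That is, there are algorithms running in time polynomial in $N$, with access to an oracle deciding isomorphism of pairs of groups of nilpotency class at most $2$ and exponent $p$ given by Cayley tables (queried only on groups of order polynomial in $N$), which (a) given the Cayley tables of $G,H\in\mathfrak{B}(p,2,N)$, output an isomorphism $G\to H$ whenever $G\cong H$; and (b) given the Cayley table of $G\in\mathfrak{B}(p,2,N)$, compute the order of the automorphism group of $G$ (equivalently, the number of isomorphisms between two isomorphic such groups).
   Context: For a prime $p$ and integer $N$, $\mathfrak{B}(p,2,N)$ denotes the set of finite $p$-groups of nilpotency class $2$, exponent $p$, and order $N$. Groups are given by their Cayley tables. *)

(* Defs.v *)
From mathcomp Require Import all_boot all_fingroup.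
From mathcomp Require Import all_solvable.

Set Implicit Arguments.
Unset Strict Implicit.
Unset Printing Implicit Defensive.

(** * Groups and Cayley tables *)

Definition class2_expp (p N : nat) (gT : finGroupType) : Prop :=
  [/\ prime p, (p.-group [set: gT])%g, nil_class [set: gT] = 2,
      exponent [set: gT] = p & #|[set: gT]| = N].

Definition class_le2_expp (p : nat) (gT : finGroupType) : Prop :=
  [/\ prime p, (p.-group [set: gT])%g, nil_class [set: gT] <= 2
    & exponent [set: gT] = p].

(* An arbitrary numbering of the elements: [nth 1 s i] has number [i]. *)
Definition numbering (gT : finGroupType) (s : seq gT) : Prop :=
  uniq s /\ s =i [set: gT].

(* Row-major: cell [i * #|gT| + j] is the number of the product of the elements
   numbered [i] and [j]. *)
Definition cayley (gT : finGroupType) (s : seq gT) : seq nat :=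
  [seq index (x * y)%g s | x <- s, y <- s].

(* The answers of an oracle on anything other than two Cayley tables of groups
   of class at most 2 and exponent p are unconstrained. *)
Definition iso_oracle (p : nat) (O : seq nat -> seq nat -> bool) : Prop :=
  forall (gT hT : finGroupType) (s : seq gT) (t : seq hT),
    class_le2_expp p gT -> class_le2_expp p hT ->
    numbering s -> numbering t ->
    O (cayley s) (cayley t) = ([set: gT] \isog [set: hT])%g.

Definition valid_query (p bound : nat) (q : seq nat * seq nat) : Prop :=
  exists (gT hT : finGroupType) (s : seq gT) (t : seq hT),
    [/\ class_le2_expp p gT /\ class_le2_expp p hT,
        numbering s /\ numbering t,
        q = (cayley s, cayley t)
      & #|[set: gT]| <= bound /\ #|[set: hT]| <= bound].

(** * Oracle programs

   A random-access machine presented as a structured language.  The memory is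
   a family of arrays of natural numbers, array [x] holding [m x i] at index
   [i].  Time is logarithmic cost: every number read, written, used as an index
   or used as an operand is charged its length in binary, so that running time
   is polynomially related to that of oracle Turing machines even though
   multiplication and division are primitive. *)

Inductive binop := Add | Sub | Mul | Div | Mod | Eq | Lt.

Definition op_eval (o : binop) (a b : nat) : nat :=
  match o with
  | Add => a + b
  | Sub => a - b
  | Mul => a * b
  | Div => a %/ b
  | Mod => a %% b
  | Eq => a == b
  | Lt => a < b
  end.

Inductive expr :=
  | Cst of nat
  | Get of nat & expr
  | Bin of binop & expr & expr.

Definition memory := nat -> nat -> nat.

Fixpoint eval (m : memory) (e : expr) : nat :=
  match e with
  | Cst n => n
  | Get x i => m x (eval m i)
  | Bin o a b => op_eval o (eval m a) (eval m b)
  end.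

Definition bits (n : nat) : nat := (trunc_log 2 n).+1.

Fixpoint ecost (m : memory) (e : expr) : nat :=
  match e with
  | Cst n => bits n
  | Get x i => ecost m i + bits (eval m i) + bits (eval m e)
  | Bin o a b => ecost m a + ecost m b + bits (eval m a) + bits (eval m b)
  end.

Definition update (m : memory) (x i v : nat) : memory :=
  fun y j => if (y == x) && (j == i) then v else m y j.

Definition load (inputs : seq (seq nat)) : memory :=
  fun x i => nth 0 (nth [::] inputs x) i.

(* [Query r x k y l] submits the first k ^ 2 cells of array [x] and the first
   l ^ 2 cells of array [y], and puts the answer in cell 0 of array [r]. *)
Inductive cmd :=
  | Skip
  | Assign of nat & expr & expr
  | Then of cmd & cmd
  | If of expr & cmd & cmd
  | While of expr & cmd
  | Query of nat & nat & expr & nat & expr.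

Definition table_at (m : memory) (x k : nat) : seq nat := mkseq (m x) (k ^ 2).

Definition table_cost (T : seq nat) : nat := \sum_(a <- T) bits a.

(* [exec O c m m' t qs]: started in memory [m], [c] halts in memory [m'] after
   time [t], having submitted to the oracle [O] exactly the queries [qs]. *)
Inductive exec (O : seq nat -> seq nat -> bool) :
  cmd -> memory -> memory -> nat -> seq (seq nat * seq nat) -> Prop :=
  | ExecSkip m : exec O Skip m m 1 [::]
  | ExecAssign m x i e :
      exec O (Assign x i e) m (update m x (eval m i) (eval m e))
        (ecost m i + ecost m e + bits (eval m i) + bits (eval m e)) [::]
  | ExecThen c d m m1 m2 t u qs rs :
      exec O c m m1 t qs -> exec O d m1 m2 u rs ->
      exec O (Then c d) m m2 (t + u) (qs ++ rs)
  | ExecIfTrue b c d m m1 t qs :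
      eval m b != 0 -> exec O c m m1 t qs ->
      exec O (If b c d) m m1 (ecost m b + t) qs
  | ExecIfFalse b c d m m1 t qs :
      eval m b = 0 -> exec O d m m1 t qs ->
      exec O (If b c d) m m1 (ecost m b + t) qs
  | ExecWhileTrue b c m m1 m2 t u qs rs :
      eval m b != 0 -> exec O c m m1 t qs -> exec O (While b c) m1 m2 u rs ->
      exec O (While b c) m m2 (ecost m b + t + u) (qs ++ rs)
  | ExecWhileFalse b c m :
      eval m b = 0 -> exec O (While b c) m m (ecost m b) [::]
  | ExecQuery r x k y l m :
      let A := table_at m x (eval m k) in
      let B := table_at m y (eval m l) in
      exec O (Query r x k y l) m (update m r 0 (O A B))
        (ecost m k + ecost m l + table_cost A + table_cost B + 1) [:: (A, B)].

(* Main.v *)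
(**
  Let G have order p^l, class 2 and exponent p, and let chi : G -> F_p[t]_{<k} be a homomorphism (a tuple of
  k additive functionals).  The oracle can compare pairs (G, chi) and (H, chi') although it only sees groups:
  extend G by F_p^d, by F_p^3 and by a space of polynomials, and let (q, x, y) be paired to
  (q_0 + q_1 t + q_2 u) (y(t) + t^d chi(x)) with u = t^8 + t^6 + t^5.  The resulting gadget has class at most
  2 and exponent p.  An isomorphism of gadgets preserves the subgroup q = 0, because the sizes of
  conjugacy classes recognise it, so it induces an isomorphism phi : G -> H and transports the pencil
  1, t, u acting by multiplication; this pencil is so rigid that chi' o phi = lambda chi for a scalar lambda,
  and lambda is removed by an automorphism inducing a power map on G modulo G'.  Hence gadgets are isomorphic
  iff some isomorphism phi : G -> H satisfies chi' o phi = chi.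

  Search: take for chi a coordinate system G/G' = F_p^n and pin its coordinates one after the other, each
  time trying the p^n functionals on H for the next coordinate.  In the end phi is known modulo G', and every
  lift of its values on generators extends to an isomorphism.  Counting: with G = H, the number of successful
  functionals at each stage is the length of an orbit in a stabiliser chain, so |Aut G| is the product of
  these numbers with |G'|^n.

  Running times are bounded once and for all for a structured language whose assignments are reduced
  modulo B = N^50, so that every program in it is automatically polynomial.
*)

From HB Require Import structures.
From mathcomp Require Import all_boot all_fingroup.
From mathcomp Require Import all_solvable.
From mathcomp Require Import all_algebra.
From mathcomp Require Import ring zify.
Require Import Defs.

Set Implicit Arguments.
Unset Strict Implicit.
Unset Printing Implicit Defensive.
Import GRing.Theory.

(** * Rigidity of a pencil of polynomials *)

(** The obstacle is that an isomorphism of gadgets may act by any invertible maps on the [q]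
    coordinate and on the polynomials; only compatibility with multiplication restricts it. With the
    pencil 1, t alone every projective change of t would survive. The third member excludes these:
    its degree, 8 against 1, prevents mixing it into the other two; comparing its homogenised form
    with the pencil prevents a denominator in t; its missing t^7 prevents translations of t; its
    neighbouring exponents 6 and 5 prevent dilations of t. That p is odd is used both for the
    translations, where 8 must be invertible, and for the exponent of the gadget. A scalar cannot be
    excluded: multiplying the y coordinate and the polynomials by it, with q fixed, is an
    isomorphism onto the gadget of the rescaled covector. A second constraint shapes the programs:
    queries have to be legitimate even when the two groups are not isomorphic, so every stage must
    leave a genuine covector behind whatever the answers were. Finally, |Aut G| is not polynomially
    bounded in N; only its length is, so it is assembled from small factors at the very end. *)

Section Rigidity.
Local Open Scope ring_scope.
Variable F : fieldType.

(* Any exponents sparse enough for [pencil_rigidity] would do. *)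
Definition octic : {poly F} := 'X^8 + 'X^6 + 'X^5.

Lemma size_octic : size octic = 9%N.
Proof.
rewrite /octic size_polyDl ?size_polyDl ?size_polyXn //.
Qed.

Definition pencil (a b c : F) : {poly F} := a%:P + b%:P * 'X + c%:P * octic.

Lemma pencil_coef a b c i :
  (pencil a b c)`_i = a *+ (i == 0%N) + b *+ (i == 1%N) + c *+ (i \in [:: 8; 6; 5])%N.
Proof.
rewrite /pencil /octic !coefD !coefCM !coefD !coefXn coefX coefC !inE.
by case: i => [|[|[|[|[|[|[|[|[|i]]]]]]]]] //=; rewrite ?(mulr0, mulr1, addr0, add0r).
Qed.

Lemma pencil_inj a b c a' b' c' :
  pencil a b c = pencil a' b' c' -> [/\ a = a', b = b' & c = c'].
Proof.
move=> E; split; [have := congr1 (fun q : {poly F} => q`_0) E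
  | have := congr1 (fun q : {poly F} => q`_1) E
  | have := congr1 (fun q : {poly F} => q`_8) E];
  by rewrite /= !pencil_coef /= ?mulr0n ?mulr1n ?addr0 ?add0r.
Qed.

Lemma size_pencil a b c : (size (pencil a b c) <= 9)%N.
Proof.
apply/leq_sizeP => j hj; rewrite pencil_coef !inE.
by move: hj; case: j => [|[|[|[|[|[|[|[|[|j]]]]]]]]] //=; rewrite !mulr0n !addr0.
Qed.

Lemma size_pencil9 a b c : c != 0 -> size (pencil a b c) = 9%N.
Proof.
move=> c0; apply/eqP; rewrite eqn_leq size_pencil ltnNge.
apply/negP => /leq_sizeP /(_ 8 (leqnn _)); rewrite pencil_coef /= !mulr0n !add0r mulr1n.
by move/eqP: c0.
Qed.

Lemma size_pencil2 a b : (size (pencil a b 0) <= 2)%N.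
Proof.
apply/leq_sizeP => j hj; rewrite pencil_coef !inE mul0rn addr0.
by move: hj; case: j => [|[|j]] //=; rewrite !mulr0n !addr0.
Qed.

Lemma size_expn_leq (q : {poly F}) d n : (size q <= d.+1)%N -> (size (q ^+ n)%R <= (n * d).+1)%N.
Proof.
move=> h; apply: leq_trans (size_poly_exp_leq _ _) _.
by rewrite ltnS mulnC leq_mul2l -subn1 leq_subLR add1n h orbT.
Qed.

Variables (m : nat) (rho theta : {poly F} -> {poly F}).
Hypothesis two_neq0 : (2%:R : F) != 0.
Hypothesis m_ge9 : (9 <= m)%N.
Hypothesis rhoD : {morph rho : f g / f + g}.
Hypothesis rhoZ : forall a, {morph rho : f / a%:P * f}.
Hypothesis theta_size : forall f : {poly F}, (size f <= m)%N -> (size (theta f) <= m)%N.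
Hypothesis theta_neq0 : forall f : {poly F}, (size f <= m)%N -> f != 0 -> theta f != 0.

(** [rho (L * M * g)] can be evaluated in two ways, whence [l * theta (M * g) = t * theta (L * g)]:
    trading a factor [M] for [L] inside [theta] trades [l] for [t] outside. Iteration trades [i]
    factors at once. *)
Lemma pencil_iterate (L M l t : {poly F}) :
  (size L <= 2)%N -> (size M <= 2)%N ->
  (forall f : {poly F}, (size f <= m)%N -> rho (L * f) = l * theta f) ->
  (forall f : {poly F}, (size f <= m)%N -> rho (M * f) = t * theta f) ->
  forall i (e : {poly F}), (size e + i <= m)%N -> l ^+ i * theta (M ^+ i * e) = t ^+ i * theta (L ^+ i * e).
Proof.
move=> sL sM hL hM; elim=> [|i IH] e he; first by rewrite !expr0 !mul1r.
have sz (Z : {poly F}) : (size Z <= 2)%N -> (size (Z ^+ i * e)%R < m)%N.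
  move=> sZ; have := size_expn_leq i sZ; have := size_polyMleq (Z ^+ i) e.
  by move: he; lia.
have step (g : {poly F}) : (size g < m)%N -> l * theta (M * g) = t * theta (L * g).
  move=> hg; rewrite -hL ?mulrA ?[L * M]mulrC -?mulrA ?hM //.
    by have := size_polyMleq L g; lia.
  by have := size_polyMleq M g; lia.
rewrite !exprS -!mulrA [l * _]mulrCA step ?sz //.
rewrite mulrCA; congr (_ * _).
have -> : L * (M ^+ i * e) = M ^+ i * (L * e) by ring.
rewrite IH; last by have := size_polyMleq L e; lia.
by congr (_ * theta _); ring.
Qed.

(** Additivity is assumed of [rho] only: [theta] will be defined through arbitrary choices of
    preimages, and its linearity comes out as a consequence. The size bound [m] works against
    [theta], because powers as high as [m.-1] produce degrees that values of [theta] are too small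
    to absorb. *)
Theorem pencil_rigidity (al be ga : {poly F}) :
  (exists a b c, al = pencil a b c) -> (exists a b c, be = pencil a b c) ->
  (exists a b c, ga = pencil a b c) ->
  (forall x y, x%:P * al + y%:P * be = 0 -> x = 0 /\ y = 0) ->
  (forall f : {poly F}, (size f <= m)%N -> rho f = al * theta f) ->
  (forall f : {poly F}, (size f <= m)%N -> rho ('X * f) = be * theta f) ->
  (forall f : {poly F}, (size f <= m)%N -> rho (octic * f) = ga * theta f) ->
  exists2 lam : F, lam != 0 & forall f : {poly F}, (size f <= m)%N -> theta f = lam%:P * f.
Proof.
move=> [a0 [a1 [a2 Eal]]] [b0 [b1 [b2 Ebe]]] [c0 [c1 [c2 Ega]]] indep hal hbe hga.
have h1 (f : {poly F}) : (size f <= m)%N -> rho (1 * f) = al * theta f by rewrite mul1r; apply: hal.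
have s1 : (size (1%R : {poly F}) <= 2)%N by rewrite size_poly1.
have sX : (size ('X : {poly F}) <= 2)%N by rewrite size_polyX.
have al0 : al != 0.
  apply/eqP => h; have [] := indep 1 0; first by rewrite h mulr0 mul0r addr0.
  by move/eqP; rewrite oner_eq0.
(* The degree is at most [2 * (m - 1)] on the left and at least [8 * (m - 1)] on the right. *)
have degree_clash (l t f g : {poly F}) : (size l <= 2)%N -> size t = 9%N ->
    f != 0 -> (size g <= m)%N -> l ^+ m.-1 * g = t ^+ m.-1 * f -> False.
  move=> sl st f0 sg E.
  have t0 : t != 0 by rewrite -size_poly_eq0 st.
  have := congr1 (fun q : {poly F} => size q) E; rewrite /= (size_mul (expf_neq0 m.-1 t0) f0).
  have := size_exp t m.-1; rewrite st /=.
  have := size_polyMleq (l ^+ m.-1) g; have := size_expn_leq m.-1 sl.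
  have := expf_neq0 m.-1 t0; rewrite -size_poly_gt0.
  move: (f0); rewrite -size_poly_gt0; move: m_ge9 sg;
  move: (size (l ^+ _ * g)%R) (size (l ^+ _)) (size (t ^+ _)) (size f) (size g) => A C D E1 G.
  case: (m) => [|k] /=; first by []; move=> *; lia.
have sz1 : (size (1%R : {poly F}) + m.-1 <= m)%N by rewrite size_poly1; move: m_ge9; lia.
have th1 : theta 1 != 0.
  by apply: theta_neq0; rewrite ?oner_eq0 // size_poly1; move: m_ge9; lia.
have szX : (size ('X ^+ m.-1 * 1 : {poly F})%R <= m)%N.
  by rewrite mulr1 size_polyXn; move: m_ge9; lia.
have iter1X := pencil_iterate s1 sX h1 hbe.
have a20 : a2 = 0.
  apply/eqP/negPn/negP => a20.
  (* The combination of 1 and ['X] for which the same combination [l] of [al] and [be] loses its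
     [octic] term. *)
  pose L : {poly F} := (- b2)%:P + a2%:P * 'X.
  pose l : {poly F} := (- b2)%:P * al + a2%:P * be.
  have EL : L = pencil (- b2) a2 0 by rewrite /pencil polyC0 mul0r addr0.
  have sL : (size L <= 2)%N by rewrite EL size_pencil2.
  have hL (f : {poly F}) : (size f <= m)%N -> rho (L * f) = l * theta f.
    move=> sf; rewrite /L mulrDl rhoD -mulrA !rhoZ hal // hbe // /l mulrDl; ring.
  have El : l = pencil (a2 * b0 - b2 * a0) (a2 * b1 - b2 * a1) 0.
    rewrite /l Eal Ebe /pencil !polyC0 !polyCB !polyCN !polyCM; ring.
  have sl : (size l <= 2)%N by rewrite El size_pencil2.
  have L0 : L ^+ m.-1 * 1 != 0.
    rewrite mulr1 expf_neq0 //; apply/eqP => h.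
    have := congr1 (fun q : {poly F} => q`_1) h.
    by rewrite /= EL pencil_coef coef0 /= mulr0n mulr1n mul0rn add0r addr0; move/eqP: a20.
  have sL' : (size (L ^+ m.-1 * 1)%R <= m)%N.
    by rewrite mulr1; have := size_expn_leq m.-1 sL; move: m_ge9; lia.
  apply: (degree_clash l al (theta (L ^+ m.-1 * 1)) (theta 1)) => //.
  - by rewrite Eal size_pencil9.
  - exact: theta_neq0.
  - by apply: theta_size; rewrite size_poly1; move: m_ge9; lia.
  have := pencil_iterate sL s1 hL h1 sz1.
  by rewrite !expr1n !mul1r => ->.
(* Now [al] has degree at most 1, so an [octic] term in [be] would make [be ^+ m.-1] too large. *)
have b20 : b2 = 0.
  apply/eqP/negPn/negP => b20.
  apply: (degree_clash al be (theta 1) (theta ('X ^+ m.-1 * 1))) => //.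
  - by rewrite Eal a20 size_pencil2.
  - by rewrite Ebe size_pencil9.
  - exact: theta_size.
  by rewrite iter1X // expr1n mul1r.
have {}Eal : al = a0%:P + a1%:P * 'X by rewrite Eal a20 /pencil polyC0 mul0r addr0.
have {}Ebe : be = b0%:P + b1%:P * 'X by rewrite Ebe b20 /pencil polyC0 mul0r addr0.
have iterX i : (i < m)%N -> al ^+ i * theta 'X^i = be ^+ i * theta 1.
  by move=> im; rewrite -[X in theta X]mulr1 iter1X ?expr1n ?mul1r // size_poly1 add1n.
(* Expanding [rho octic] over the monomials expresses [ga] by the homogenised [octic], the form b^8
   + a^2 b^6 + a^3 b^5 at [al] and [be]. *)
have E7 : al ^+ 7 * ga = be ^+ 8 + al ^+ 2 * be ^+ 6 + al ^+ 3 * be ^+ 5.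
  have su (f : {poly F}) : (size f <= 9)%N -> (size f <= m)%N by move/leq_trans; apply.
  have sXn i : (i < 9)%N -> (size ('X^i%R : {poly F}) <= m)%N by move=> h; apply: su; rewrite size_polyXn.
  have : ga * theta 1 = al * (theta 'X^8 + theta 'X^6 + theta 'X^5).
    rewrite -hga ?su ?size_poly1 // mulr1 !mulrDr -!hal ?sXn // -!rhoD; congr rho.
  move=> h.
  apply: (mulfI al0); apply: (mulIf th1).
  have -> : al * (al ^+ 7 * ga) * theta 1 = al ^+ 8 * (ga * theta 1) by ring.
  rewrite h.
  have -> : al ^+ 8 * (al * (theta 'X^8 + theta 'X^6 + theta 'X^5)) =
    al * (al ^+ 8 * theta 'X^8) + al ^+ 3 * (al ^+ 6 * theta 'X^6) + al ^+ 4 * (al ^+ 5 * theta 'X^5) by ring.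
  rewrite !iterX; [ring | | |]; by move: m_ge9; lia.
(* At a root of a nonconstant [al] the identity makes [be] vanish as well, and [al] and [be] would
   be proportional. *)
have a10 : a1 = 0.
  apply/eqP/negPn/negP => a10.
  pose r := - a0 / a1.
  have alr : al.[r] = 0 by rewrite Eal hornerD hornerM !hornerC hornerX mulrC /r divfK ?subrr.
  have : be.[r] ^+ 8 = 0.
    have := congr1 (fun q => horner q r) E7; rewrite /= !(hornerD, horner_exp, hornerM) alr.
    by rewrite ?expr0n /= !mul0r !addr0 => <-.
  move/eqP; rewrite expf_eq0 /= => /eqP; rewrite Ebe hornerD hornerM !hornerC hornerX => br.
  have [] := indep (- b1) a1; last by move=> _ /eqP; rewrite (negbTE a10).
  have eb : b0 = - (b1 * r) by apply/eqP; rewrite -subr_eq0 opprK br.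
  have E : a1%:P * b0%:P = b1%:P * a0%:P :> {poly F}.
    by rewrite -!polyCM eb /r; congr (_%:P); field.
  rewrite Eal Ebe polyCN !mulrDr E; ring.
have {}Eal : al = a0%:P by rewrite Eal a10 polyC0 mul0r addr0.
have a00 : a0 != 0 by move: al0; rewrite Eal polyC_eq0.
have b10 : b1 != 0.
  apply/eqP => b10; have [] := indep (- b0) a0.
    by rewrite Eal Ebe b10 polyC0 mul0r addr0 -!polyCM -polyCD mulNr mulrC addNr.
  by move=> _ /eqP; rewrite (negbTE a00).
have E8 : al ^+ 7 * ga = pencil (a0 ^+ 7 * c0) (a0 ^+ 7 * c1) (a0 ^+ 7 * c2).
  have -> : al ^+ 7 = (a0 ^+ 7)%:P by rewrite Eal rmorphXn.
  move: (a0 ^+ 7) => A; rewrite Ega /pencil !polyCM; ring.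
have E78 : pencil (a0 ^+ 7 * c0) (a0 ^+ 7 * c1) (a0 ^+ 7 * c2) =
    be ^+ 8 + (a0 ^+ 2)%:P * be ^+ 6 + (a0 ^+ 3)%:P * be ^+ 5.
  by rewrite -E8 E7 Eal !rmorphXn.
(* The left side has no term of degree 7, whereas [be ^+ 8] has the coefficient 8 b0 b1^7 there. *)
have b00 : b0 = 0.
  have := congr1 (fun q : {poly F} => q`_7) E78; rewrite /= pencil_coef /= !mulr0n !addr0.
  have sz5 n j : (n < j)%N -> (be ^+ n)`_j = 0.
    have sb : (size be <= 2)%N by rewrite Ebe -[_ + _]addr0 -(mul0r octic) -polyC0 size_pencil2.
    by move=> nj; apply: nth_default; apply: leq_trans (size_expn_leq n sb) _; rewrite muln1.
  rewrite coefD coefD coefCM coefCM (sz5 6) // (sz5 5) // !mulr0 !addr0 Ebe.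
  rewrite exprDn coef_sum (bigD1 (inord 7)) //= inordK //.
  rewrite big1 ?addr0 => [|i hi].
    rewrite coefMn exprMn -!rmorphXn /= mulrA -polyCM coefCM coefXn eqxx mulr1.
    move/esym/eqP; rewrite (_ : 'C(8, 7) = 2 * (2 * 2))%N // !mulrnA.
    rewrite (_ : 8 - 7 = 1)%N // expr1; move: (b1 ^+ 7) (expf_neq0 7 b10) => D hD.
    rewrite -[_ *+ 2]mulr_natr -[b0 * D *+ 2 *+ 2]mulr_natr -[b0 * D *+ 2]mulr_natr.
    by rewrite !mulf_eq0 !(negbTE two_neq0) !orbF (negbTE hD) orbF => /eqP.
  rewrite coefMn exprMn -!rmorphXn /= mulrA -polyCM coefCM coefXn.
  case: eqP => [e|]; last by rewrite mulr0 mul0rn.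
  by case/eqP: hi; apply: val_inj; rewrite /= inordK.
have {}Ebe : be = b1%:P * 'X by rewrite Ebe b00 polyC0 add0r.
(* The coefficients in degrees 6 and 5 are equal on the left, and their ratio on the right is b1 /
   a0. *)
have b1a0 : b1 = a0.
  have E9 i : (pencil (a0 ^+ 7 * c0) (a0 ^+ 7 * c1) (a0 ^+ 7 * c2))`_i =
     b1 ^+ 8 *+ (i == 8%N) + a0 ^+ 2 * b1 ^+ 6 *+ (i == 6%N) + a0 ^+ 3 * b1 ^+ 5 *+ (i == 5%N).
    have eX n : be ^+ n = (b1 ^+ n)%:P * 'X^n by rewrite Ebe exprMn -rmorphXn.
    rewrite E78 !eX coefD coefD [(a0 ^+ 2)%:P * _]mulrA [(a0 ^+ 3)%:P * _]mulrA -polyCM -polyCM.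
    rewrite !coefCM !coefXn.
    by rewrite !mulr_natr.
  have := E9 8; have := E9 6; have := E9 5; rewrite !pencil_coef /=.
  rewrite !mulr0n !mulr1n !addr0 !add0r => -> e1 e2.
  have e3 : b1 * b1 = a0 * b1.
    apply: (mulfI (expf_neq0 6 b10)); apply: (mulfI (expf_neq0 2 a00)).
    have -> : a0 ^+ 2 * (b1 ^+ 6 * (b1 * b1)) = a0 ^+ 2 * b1 ^+ 6 * b1 ^+ 2 by ring.
    by rewrite -e1; ring.
  by apply: (mulIf b10).
have thX i : (i < m)%N -> theta 'X^i = 'X^i * theta 1.
  move=> /iterX; rewrite Eal Ebe b1a0 exprMn -mulrA.
  by move/mulfI; apply; rewrite -rmorphXn polyC_eq0 expf_neq0.
(* The size bound on [theta 'X^(m-1)], which is ['X^(m-1) * theta 1], leaves room for a constant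
   only. *)
have th1C : (size (theta 1) <= 1)%N.
  have := theta_size szX; rewrite mulr1 thX; last by move: m_ge9; lia.
  rewrite mulrC size_mulXn //; move: m_ge9; lia.
pose lam := (theta 1)`_0.
have Eth1 : theta 1 = lam%:P by apply: size1_polyC.
exists lam; first by move: th1; rewrite Eth1 polyC_eq0.
move=> f sf; apply: (mulfI al0); rewrite -hal //.
have rho0 : rho 0 = 0.
  by have /eqP := rhoD 0 0; rewrite addr0 -subr_eq subrr eq_sym => /eqP.
have rhoS I (r : seq I) G : rho (\sum_(i <- r) G i) = \sum_(i <- r) rho (G i).
  by apply: (big_morph rho).
rewrite -{1}[f]coefK poly_def rhoS.
rewrite [in RHS](_ : f = \sum_(i < size f) f`_i *: 'X^i); last by rewrite -poly_def coefK.
rewrite mulr_sumr mulr_sumr; apply: eq_bigr => i _.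
rewrite -mul_polyC rhoZ hal; last by rewrite size_polyXn; apply: leq_trans (ltn_ord i) sf.
rewrite thX; last by apply: leq_trans (ltn_ord i) sf.
by rewrite Eth1; ring.
Qed.

End Rigidity.

(** * Groups extended by a bilinear pairing *)

Open Scope group_scope.

Section Extension.
Variables (gT : finGroupType) (Y Q R : finZmodType).

(** Additivity on the right is joint in the two arguments: each [f a] is a homomorphism on the
    direct product of [gT] and [Y], so it kills the commutators of [gT]. *)
Record pairing := Pairing {
  pair_fun :> Q -> gT -> Y -> R;
  pairDl : forall a b x y, pair_fun (a + b)%R x y = (pair_fun a x y + pair_fun b x y)%R;
  pairDr : forall a x x' y y',
    pair_fun a (x * x') (y + y')%R = (pair_fun a x y + pair_fun a x' y')%R }.

Variable f : pairing.

Lemma pair0l x y : f 0%R x y = 0%R.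
Proof. by apply: (addrI (f 0%R x y)); rewrite -pairDl !addr0. Qed.

Lemma pair0r a : f a 1 0%R = 0%R.
Proof. by apply: (addrI (f a 1 0%R)); rewrite -pairDr mulg1 !addr0. Qed.

Lemma pairNl a x y : f (- a)%R x y = (- f a x y)%R.
Proof. by apply: (addrI (f a x y)); rewrite -pairDl !subrr pair0l. Qed.

Lemma pair_comm a x y : f a [~ x, y] 0%R = 0%R.
Proof.
apply: (addrI (f a (y * x) 0%R)); rewrite -pairDr addr0 -commgC.
by rewrite -[X in f a _ X = _](addr0 0%R) -[X in _ = (f a _ X + _)%R](addr0 0%R) !pairDr addr0 addrC.
Qed.

(** The pairing does not enter the carrier; it is a parameter so that every pairing can carry its
    own group structure. *)
Definition ext of pairing := (gT * Y * Q * R)%type.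
HB.instance Definition _ := Finite.on (ext f).
Local Notation E := (ext f).

Definition gpart (w : E) : gT := w.1.1.1.
Definition ypart (w : E) : Y := w.1.1.2.
Definition qpart (w : E) : Q := w.1.2.
Definition rpart (w : E) : R := w.2.

(** The central extension of the product of [gT], [Y] and [Q] by [R] with [f] as cocycle;
    biadditivity implies the cocycle identity. *)
Definition ext_mul (v w : E) : E :=
  (gpart v * gpart w, (ypart v + ypart w)%R, (qpart v + qpart w)%R,
   (rpart v + rpart w + f (qpart v) (gpart w) (ypart w))%R).
Definition ext_one : E := (1, 0%R, 0%R, 0%R).
Definition ext_inv (w : E) : E :=
  ((gpart w)^-1, (- ypart w)%R, (- qpart w)%R,
   (- rpart w + f (qpart w) (gpart w) (ypart w))%R).

Lemma ext_mulA : associative ext_mul.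
Proof.
move=> [[[x y] q] r] [[[x' y'] q'] r'] [[[x'' y''] q''] r''].
rewrite /ext_mul /gpart /ypart /qpart /rpart /= mulgA !addrA pairDl pairDr.
congr (_, _); rewrite -!addrA; congr (_ + (_ + _))%R.
by rewrite [(f q' _ _ + (_ + _))%R]addrC -!addrA addrCA.
Qed.

Lemma ext_mul1 : left_id ext_one ext_mul.
Proof.
by move=> [[[x y] q] r]; rewrite /ext_mul /= mul1g !add0r pair0l addr0.
Qed.

Lemma ext_mulV : left_inverse ext_one ext_inv ext_mul.
Proof.
move=> [[[x y] q] r]; rewrite /ext_mul /gpart /ypart /qpart /rpart /= mulVg !addNr pairNl.
by rewrite addrAC addrK addNr.
Qed.

End Extension.

HB.instance Definition _ gT Y Q R (f : pairing gT Y Q R) :=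
  Finite_isGroup.Build (ext f) (@ext_mulA gT Y Q R f) (@ext_mul1 gT Y Q R f) (@ext_mulV gT Y Q R f).

Section ExtensionTheory.
Variables (gT : finGroupType) (Y Q R : finZmodType) (f : pairing gT Y Q R).
Implicit Types v w : ext f.

Lemma ext_eq v w : gpart v = gpart w -> ypart v = ypart w -> qpart v = qpart w ->
  rpart v = rpart w -> v = w.
Proof.
by case: v w => [[[x y] q] r] [[[x' y'] q'] r']; rewrite /gpart /ypart /qpart /rpart /= => -> -> -> ->.
Qed.

Lemma gpartM v w : gpart (v * w) = gpart v * gpart w. Proof. by []. Qed.
Lemma ypartM v w : ypart (v * w) = (ypart v + ypart w)%R. Proof. by []. Qed.
Lemma qpartM v w : qpart (v * w) = (qpart v + qpart w)%R. Proof. by []. Qed.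
Lemma rpartM v w : rpart (v * w) = (rpart v + rpart w + f (qpart v) (gpart w) (ypart w))%R.
Proof. by []. Qed.

Definition mke x y q r : ext f := (x, y, q, r).

Lemma mkeM x y q r x' y' q' r' : mke x y q r * mke x' y' q' r' =
  mke (x * x') (y + y')%R (q + q')%R (r + r' + f q x' y')%R.
Proof. by []. Qed.

Lemma ext_comm v w :
  [~ v, w] = mke [~ gpart v, gpart w] 0%R 0%R
     (f (qpart v) (gpart w) (ypart w) - f (qpart w) (gpart v) (ypart v))%R.
Proof.
apply: (mulgI (w * v)); rewrite -commgC; apply: ext_eq.
- by rewrite !gpartM /mke /= -commgC.
- by rewrite !ypartM addr0 addrC.
- by rewrite !qpartM addr0 addrC.
rewrite !rpartM [gpart (mke _ _ _ _)]/= [ypart (mke _ _ _ _)]/= pair_comm addr0.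
rewrite [RHS]addrC addrA [RHS]addrAC /mke /rpart /= subrK [RHS]addrC.
by congr (_ + _)%R; rewrite addrC.
Qed.

(** The binomial coefficient counts the pairs of factors in which a [q] meets a later [(x, y)]. *)
Lemma ext_expn w n : w ^+ n = mke (gpart w ^+ n) (ypart w *+ n)%R (qpart w *+ n)%R
   (rpart w *+ n + f (qpart w) (gpart w) (ypart w) *+ 'C(n, 2))%R.
Proof.
elim: n => [|n IH]; first by rewrite !expg0 !mulr0n addr0.
rewrite expgSr IH; apply: ext_eq; rewrite ?gpartM ?ypartM ?qpartM ?rpartM.
- by rewrite /mke /gpart /= expgSr.
- by rewrite /mke /ypart /= mulrSr.
- by rewrite /mke /qpart /= mulrSr.
have -> : f (qpart (mke (gpart w ^+ n) (ypart w *+ n) (qpart w *+ n)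
    (rpart w *+ n + f (qpart w) (gpart w) (ypart w) *+ 'C(n, 2)))%R) (gpart w) (ypart w)
    = (f (qpart w) (gpart w) (ypart w) *+ n)%R.
  rewrite /mke /qpart /=; elim: n {IH} => [|n IH]; first by rewrite !mulr0n pair0l.
  by rewrite !mulrSr pairDl IH.
by rewrite /mke /rpart /= binS bin1 mulrnDr mulrSr -!addrA; congr (_ + _)%R; rewrite addrCA.
Qed.

Hypotheses (p : nat) (p_odd : odd p) (gT_p : class_le2_expp p gT).
Hypotheses (Yp : forall y : Y, (y *+ p = 0)%R) (Qp : forall y : Q, (y *+ p = 0)%R)
  (Rp : forall y : R, (y *+ p = 0)%R).

(** For odd [p] the number ['C(p, 2)] is divisible by [p], so [p]-th powers vanish by [ext_expn].
    Commutators are central because [f] kills those of [gT]. *)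
Lemma ext_class_le2 : class_le2_expp p (ext f).
Proof.
case: gT_p => p_pr _ nil2 exp_p.
have expw w : w ^+ p = 1.
  have p2 : 2 < p by move: (prime_gt1 p_pr) p_odd; case: (p) => [|[|[|]]].
  rewrite ext_expn Yp Qp Rp add0r.
  have /dvdnP[k ->] : p %| 'C(p, 2) by apply: prime_dvd_bin.
  by rewrite mulrnA Rp -exp_p expg_exponent ?inE.
have expE : exponent [set: ext f] = p.
  have dv : exponent [set: ext f] %| p by apply/exponentP => w _.
  case/primeP: (p_pr) => _ /(_ _ dv) /orP[/eqP e1|/eqP //].
  suff : exponent [set: gT] %| 1 by rewrite exp_p dvdn1; move: (prime_gt1 p_pr) => /[swap] /eqP ->.
  apply/exponentP => x _; rewrite expg1.
  have : mke x 0%R 0%R 0%R = 1 :> ext f by rewrite -[LHS]expg1 -e1 expg_exponent ?inE.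
  by move/(congr1 (@gpart _ _ _ _ f)).
split=> //; first by rewrite -pnat_exponent expE pnat_id.
rewrite nil_class2 gen_subG; apply/subsetP => _ /imset2P[v w _ _ ->].
rewrite ext_comm; apply/centerP; split=> [|u _]; first by rewrite inE.
have zc : [~ gpart v, gpart w] \in 'Z([set: gT]).
  by move: nil2; rewrite nil_class2 => /subsetP; apply; apply: mem_commg; rewrite inE.
apply: ext_eq.
- by rewrite !gpartM; case/centerP: zc => _; apply; rewrite inE.
- by rewrite !ypartM addrC.
- by rewrite !qpartM addrC.
by rewrite !rpartM pair0l pair_comm !addr0 addrC.
Qed.
End ExtensionTheory.

(** * Gadget groups *)

Lemma Fp_additive_scale (p : nat) (V W : lmodType 'F_p) (h : V -> W) :
  (forall u v, h (u + v) = h u + h v)%R -> forall a v, h (a *: v)%R = (a *: h v)%R.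
Proof.
move=> hD a v.
have hn n : h (v *+ n)%R = (h v *+ n)%R.
  elim: n => [|n IH]; last by rewrite !mulrS hD IH.
  by apply: (addrI (h 0%R)); rewrite !mulr0n -hD !addr0.
by rewrite -[a in LHS]natr_Zp -[a in RHS]natr_Zp !scaler_nat hn.
Qed.

Lemma rV_char_p (p d : nat) : prime p -> forall v : 'rV['F_p]_d, (v *+ p = 0)%R.
Proof. by move=> p_pr v; rewrite -scaler_nat pchar_Fp_0 ?scale0r. Qed.

Record covector (gT : finGroupType) (p k : nat) := Covector {
  cov_fun :> gT -> {poly 'F_p};
  covM : forall x y, cov_fun (x * y) = (cov_fun x + cov_fun y)%R;
  size_cov : forall x, size (cov_fun x) <= k }.

Section Gadget.
Variables (gT : finGroupType) (p d k : nat) (c : covector gT p k).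
Notation F := 'F_p.

(* [x] contributes above degree [d], so that [y] and [c x] can be read off separately. *)
Definition marker (x : gT) (y : 'rV[F]_d) : {poly F} := (rVpoly y + 'X^d * c x)%R.

Lemma markerM x x' y y' : marker (x * x') (y + y')%R = (marker x y + marker x' y')%R.
Proof. by rewrite /marker linearD covM mulrDr addrACA. Qed.

Lemma size_marker x y : size (marker x y) <= d + k.
Proof.
rewrite /marker (leq_trans (size_polyD _ _)) // geq_max (leq_trans (size_poly _ _)) ?leq_addr //=.
have [->|c0] := eqVneq (c x) 0%R; first by rewrite mulr0 size_poly0.
by rewrite mulrC size_mulXn // leq_add2l size_cov.
Qed.

Definition pencilv (q : 'rV[F]_3) : {poly F} := pencil (q 0 0)%R (q 0 1)%R (q 0 (2%:R))%R.

Lemma pencilvD q q' : pencilv (q + q')%R = (pencilv q + pencilv q')%R.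
Proof. by rewrite /pencilv /pencil !mxE !polyCD; ring. Qed.

Lemma pencilvZ a q : pencilv (a *: q)%R = (a%:P * pencilv q)%R.
Proof. by rewrite /pencilv /pencil !mxE !polyCM; ring. Qed.

Lemma pencilv_inj : injective pencilv.
Proof.
move=> q q' /pencil_inj[h0 h1 h2]; apply/rowP => i.
by case: i => [[|[|[|i]]]] hi //; [have -> : Ordinal hi = 0%R | have -> : Ordinal hi = 1%R
 | have -> : Ordinal hi = 2%:R%R]; rewrite ?h0 ?h1 ?h2 //; apply: val_inj.
Qed.

Lemma pencilv0 : pencilv 0%R = 0%R.
Proof. by rewrite /pencilv /pencil !mxE !polyC0 !mul0r !addr0. Qed.

Lemma pencilv_eq0 q : (pencilv q == 0%R) = (q == 0%R).
Proof. by rewrite -pencilv0 (inj_eq pencilv_inj). Qed.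

Lemma size_pencilv q : size (pencilv q) <= 9.
Proof. exact: size_pencil. Qed.

(** The 8 additional coefficients make room for multiplication by [octic]. *)
Definition gad_fun (q : 'rV[F]_3) (x : gT) (y : 'rV[F]_d) : 'rV[F]_(d + k + 8) :=
  poly_rV (pencilv q * marker x y)%R.

Lemma gad_funDl a b x y : gad_fun (a + b)%R x y = (gad_fun a x y + gad_fun b x y)%R.
Proof. by rewrite /gad_fun pencilvD mulrDl linearD. Qed.

Lemma gad_funDr a x x' y y' :
  gad_fun a (x * x') (y + y')%R = (gad_fun a x y + gad_fun a x' y')%R.
Proof. by rewrite /gad_fun markerM mulrDr linearD. Qed.

Definition gad_pairing := Pairing gad_funDl gad_funDr.
Local Notation gadget := (ext gad_pairing).

Lemma gad_fun0l x y : gad_fun 0%R x y = 0%R. Proof. exact: (pair0l gad_pairing). Qed.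
Lemma rVpoly_gad q x y : rVpoly (gad_fun q x y) = (pencilv q * marker x y)%R.
Proof.
rewrite /gad_fun poly_rV_K // (leq_trans (size_polyMleq _ _)) //.
by move: (size_pencilv q) (size_marker x y); move: (size _) (size _) => s t; lia.
Qed.

Lemma gad_eq0 q x y : gad_fun q x y = 0%R -> q != 0%R -> marker x y = 0%R.
Proof.
move=> h q0; have := rVpoly_gad q x y; rewrite h linear0 => /esym/eqP.
by rewrite mulf_eq0 pencilv_eq0 (negbTE q0) /= => /eqP.
Qed.

Lemma card_gadget : prime p -> #|[set: gadget]| = (#|[set: gT]| * p ^ (d + 3 + (d + k + 8)))%N.
Proof.
move=> p_pr; rewrite !cardsT /ext !card_prod !card_mx !card_Fp //.
rewrite !mul1n (expnD p (d + 3)) (expnD p d 3).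
by move: (p ^ 3)%N (p ^ (d + k + 8))%N => a b; rewrite !mulnA.
Qed.

Lemma gadget_class_le2 : class_le2_expp p gT -> odd p -> class_le2_expp p gadget.
Proof.
by move=> g2 po; have [p_pr _ _ _] := g2; apply: ext_class_le2 => //; apply: rV_char_p.
Qed.

Hypothesis p_pr : prime p.

(** If [q = 0], the commutator of [w] with [v] depends only on [[~ gpart w, gpart v]] and
    [qpart v]. *)
Lemma small_class (w : gadget) : qpart w = 0%R -> #|w ^: [set: gadget]| <= (#|gT| * p ^ 3)%N.
Proof.
move=> q0.
pose h (a : gT * 'rV[F]_3) : gadget :=
  (w * mke gad_pairing a.1 0%R 0%R (- gad_fun a.2 (gpart w) (ypart w))%R).
have sub : w ^: [set: gadget] \subset h @: [set: gT * 'rV[F]_3].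
  apply/subsetP => _ /imsetP[v _ ->]; rewrite conjg_mulR ext_comm q0 pair0l sub0r.
  by apply/imsetP; exists ([~ gpart w, gpart v], qpart v); rewrite ?inE.
apply: leq_trans (subset_leq_card sub) _; apply: leq_trans (leq_imset_card _ _) _.
by rewrite cardsT card_prod card_mx card_Fp.
Qed.

(** Conjugation by [(1, y, 0, 0)] moves the [R] part by the product of [pencilv q] with the
    polynomial of [y], and there are no zero divisors. *)
Lemma big_class (w : gadget) : qpart w != 0%R -> (p ^ d)%N <= #|w ^: [set: gadget]|.
Proof.
move=> q0.
pose h (y : 'rV[F]_d) : gadget := w ^ mke gad_pairing 1 y 0%R 0%R.
have h_inj : injective h.
  move=> y y'; rewrite /h !conjg_mulR !ext_comm !pair0l !subr0 => /mulgI.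
  move/(congr1 (@rpart _ _ _ _ gad_pairing)); rewrite /rpart /= /gpart /ypart /= => e.
  have : gad_fun (qpart w) 1 (y - y')%R = 0%R.
    rewrite -[1](mulg1 1) -{2}[1]invg1 gad_funDr e -gad_funDr mulgV subrr.
    exact: (pair0r gad_pairing).
  move/gad_eq0 => /(_ q0); rewrite /marker.
  have -> : c 1 = 0%R by apply: (addrI (c 1)); rewrite -covM mulg1 addr0.
  rewrite mulr0 addr0 => e2; apply/eqP; rewrite -subr_eq0; apply/eqP.
  by rewrite -[LHS]rVpolyK e2 linear0.
have <- : #|h @: [set: 'rV[F]_d]| = (p ^ d)%N.
  by rewrite card_imset // cardsT card_mx card_Fp // mul1n.
by apply: subset_leq_card; apply/subsetP => _ /imsetP[y _ ->]; rewrite memJ_class ?inE.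
Qed.

End Gadget.

Notation gadget d c := (ext (gad_pairing d c)).

Lemma marker_full (gT : finGroupType) p d k (c : covector gT p k) :
  (forall P : {poly 'F_p}, size P <= k -> exists x, c x = P) ->
  forall P : {poly 'F_p}, size P <= d + k -> exists x, exists y : 'rV_d, marker c x y = P.
Proof.
move=> c_full P sP; have [x hx] : exists x, c x = drop_poly d P.
  by apply: c_full; rewrite size_drop_poly leq_subLR.
exists x, (poly_rV (take_poly d P)); rewrite /marker poly_rV_K ?size_take_poly // hx.
by rewrite mulrC poly_take_drop.
Qed.

Lemma take_marker (gT : finGroupType) p d k (c : covector gT p k) x (y : 'rV_d) :
  take_poly d (marker c x y) = rVpoly y.
Proof. by rewrite /marker mulrC take_polyDMXn // size_poly. Qed.

Lemma drop_marker (gT : finGroupType) p d k (c : covector gT p k) x (y : 'rV_d) :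
  drop_poly d (marker c x y) = c x.
Proof. by rewrite /marker mulrC drop_polyDMXn // size_poly. Qed.

(** * The maps induced by an isomorphism of gadgets *)

Section Iso.
Variables (gT hT : finGroupType) (p d k : nat).
Variables (c : covector gT p k) (e : covector hT p k).
Hypotheses (p_pr : prime p) (d_big : (#|gT| * p ^ 3 < p ^ d)%N).
Variables (f : gadget d c -> gadget d e) (g : gadget d e -> gadget d c).
Hypotheses (fM : {morph f : x y / x * y}) (fK : cancel f g) (gK : cancel g f).

Lemma iso_f1 : f 1 = 1.
Proof. by apply: (mulgI (f 1)); rewrite -fM !mulg1. Qed.

Lemma iso_fV x : f x^-1 = (f x)^-1.
Proof. by apply: (mulgI (f x)); rewrite -fM !mulgV iso_f1. Qed.

Lemma iso_comm x y : f [~ x, y] = [~ f x, f y].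
Proof. by rewrite /commg /conjg !fM !iso_fV. Qed.

Lemma iso_qpart0 w : qpart w = 0%R -> qpart (f w) = 0%R.
Proof.
move=> q0; apply/eqP/negPn/negP => /(big_class p_pr).
rewrite leqNgt => /negP; apply; apply: leq_ltn_trans d_big.
apply: leq_trans (small_class p_pr q0).
suff /subset_leq_card/leq_trans : f w ^: [set: gadget d e] \subset f @: (w ^: [set: gadget d c]).
  by apply; apply: leq_imset_card.
apply/subsetP => _ /imsetP[v _ ->]; apply/imsetP; exists (w ^ g v).
  by rewrite memJ_class ?inE.
by rewrite /conjg !fM iso_fV gK.
Qed.

Definition emb (x : gT) : gadget d c := mke _ x 0%R 0%R 0%R.

Lemma embM : {morph emb : x y / x * y}.
Proof. by move=> x y; rewrite mkeM pair0l !addr0. Qed.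

Let fembM : {in [set: gT] &, {morph (f \o emb) : x y / x * y}}.
Proof. by move=> x y _ _ /=; rewrite embM fM. Qed.
Let femb_morphism := Morphism fembM.

Definition der_only : {set gadget d e} :=
  [set w | [&& gpart w \in [set: hT]^`(1), ypart w == 0%R, qpart w == 0%R & rpart w == 0%R]].

Lemma der_onlyP w : reflect [/\ gpart w \in [set: hT]^`(1), ypart w = 0%R, qpart w = 0%R & rpart w = 0%R]
   (w \in der_only).
Proof.
rewrite inE; apply: (iffP and4P) => [[h /eqP h1 /eqP h2 /eqP h3]|[h /eqP h1 /eqP h2 /eqP h3]];
  by split.
Qed.

Lemma group_set_der_only : group_set der_only.
Proof.
apply/group_setP; split; first by apply/der_onlyP; rewrite group1.
move=> v w /der_onlyP[vg vy vq vr] /der_onlyP[wg wy wq wr]; apply/der_onlyP.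
by rewrite gpartM ypartM qpartM rpartM vy wy vq wq vr wr pair0l !addr0; split=> //; apply: groupM.
Qed.
Canonical der_only_group := Group group_set_der_only.

(** The image is generated by commutators of elements with [q = 0], and such commutators have no
    [y], [q] or [r] part. *)
Lemma iso_emb_der x : x \in [set: gT]^`(1) -> f (emb x) \in der_only.
Proof.
move=> hx.
have := mem_morphim femb_morphism (in_setT x) hx.
rewrite /= morphim_der // => /(subsetP _); apply.
rewrite gen_subG; apply/subsetP => _ /imset2P[v w /morphimP[a _ _ ->] /morphimP[b _ _ ->] ->].
rewrite ext_comm /= !iso_qpart0 // !gad_fun0l subrr.
by apply/der_onlyP; split=> //; apply: mem_commg; rewrite inE.
Qed.

(** Only the relevant part of each image is kept, since [f] may move these elements in other
    coordinates too. Because [f] preserves [q = 0], the part that is kept is still additive. *)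
Definition rho0 r := rpart (f (mke _ 1 0%R 0%R r)).
Definition sg q := qpart (f (mke _ 1 0%R q 0%R)).

Lemma rho0D r r' : rho0 (r + r')%R = (rho0 r + rho0 r')%R.
Proof.
rewrite /rho0 -[in RHS](addr0 (_ + _)%R).
have -> : mke _ 1 0%R 0%R (r + r')%R = mke _ 1 0%R 0%R r * mke _ 1 0%R 0%R r' :> gadget d c.
  by rewrite mkeM pair0l mulg1 !addr0.
by rewrite fM rpartM iso_qpart0 // pair0l.
Qed.

Lemma sgD q q' : sg (q + q')%R = (sg q + sg q')%R.
Proof.
rewrite /sg -qpartM -fM.
have -> : mke (gad_pairing d c) 1 0%R q 0%R * mke _ 1 0%R q' 0%R =
    mke _ 1 0%R (q + q')%R 0%R.
  by rewrite mkeM pair0r mulg1 !addr0.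
by [].
Qed.

Lemma sg_commutes q x y q' :
  [~ mke (gad_pairing d c) 1 0%R q 0%R, mke (gad_pairing d c) x y 0%R q'] = mke _ 1 0%R 0%R (gad_fun c q x y).
Proof. by rewrite ext_comm /= /gpart /ypart /qpart /= comm1g gad_fun0l subr0. Qed.

Definition imarker x y := marker e (gpart (f (mke _ x y 0%R 0%R))) (ypart (f (mke _ x y 0%R 0%R))).

(** Apply [f] to the commutator of [(1, 0, q, 0)] and [(x, y, 0, 0)]: the image of the second still
    has [q = 0], so a single term of [ext_comm] remains. This is the relation that feeds
    [pencil_rigidity]. *)
Lemma rho0_sg q x y : rVpoly (rho0 (gad_fun c q x y)) = (pencilv (sg q) * imarker x y)%R.
Proof.
have := congr1 (fun w => rpart (f w)) (sg_commutes q x y 0%R); rewrite /= iso_comm ext_comm.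
rewrite [qpart (f (mke _ x y _ _))]iso_qpart0 // pair0l subr0 /rho0 /= => <-.
exact: rVpoly_gad.
Qed.

(** Division by [octic] writes each element of [R] as a sum of two values of the pairing, one for
    the pencil member 1 and one for [octic]. So [R] consists of products of commutators, and [f]
    maps commutators to commutators. Remainders have up to 8 coefficients, whence [8 <= d]. *)
Lemma iso_center_der :
  8 <= d -> (forall P : {poly 'F_p}, size P <= k -> exists x, c x = P) ->
  forall w, gpart w \in [set: gT]^`(1) -> ypart w = 0%R -> qpart w = 0%R ->
  gpart (f w) \in [set: hT]^`(1) /\ ypart (f w) = 0%R.
Proof.
move=> d8 c_full.
have comm q x y : gpart (f (mke _ 1 0%R 0%R (gad_fun c q x y))) \in [set: hT]^`(1) /\
    ypart (f (mke _ 1 0%R 0%R (gad_fun c q x y))) = 0%R.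
  rewrite -(sg_commutes q x y 0%R) iso_comm ext_comm /=; split=> //.
  by apply: mem_commg; rewrite inE.
have center r : gpart (f (mke _ 1 0%R 0%R r)) \in [set: hT]^`(1) /\
    ypart (f (mke _ 1 0%R 0%R r)) = 0%R.
  pose P := rVpoly r; have sP : size P <= d + k + 8 by apply: size_poly.
  have [x1 [y1 h1]] : exists x, exists y : 'rV_d, marker c x y = (P %% octic _)%R.
    apply: marker_full => //; rewrite -ltnS (leq_trans (ltn_modpN0 _ _)) ?size_octic //.
      by rewrite -size_poly_eq0 size_octic.
    by rewrite ltnS (leq_trans d8) ?leq_addr.
  have [x2 [y2 h2]] : exists x, exists y : 'rV_d, marker c x y = (P %/ octic _)%R.
    by apply: marker_full => //; rewrite size_divp -?size_poly_eq0 size_octic // leq_subLR addnC.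
  have -> : r = (gad_fun c (delta_mx 0%R 0%R) x1 y1 + gad_fun c (delta_mx 0%R 2%:R) x2 y2)%R.
    rewrite /gad_fun h1 h2 -linearD -[LHS]rVpolyK /=; congr poly_rV.
    rewrite [LHS](divp_eq P (octic _)) /pencilv /pencil !mxE /=.
    by rewrite !polyC0 !polyC1 !mul0r !addr0 !add0r !mul1r addrC mulrC.
  have -> (r1 r2 : 'rV['F_p]_(d + k + 8)) : mke _ 1 0%R 0%R (r1 + r2)%R = mke _ 1 0%R 0%R r1 * mke _ 1 0%R 0%R r2 :> gadget d c.
    by rewrite mkeM pair0l mulg1 !addr0.
  rewrite fM gpartM ypartM; have [g1 ->] := comm (delta_mx 0%R 0%R) x1 y1.
  by have [g2 ->] := comm (delta_mx 0%R 2%:R%R) x2 y2; rewrite addr0 groupM.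
move=> w gw yw qw; have -> : w = emb (gpart w) * mke _ 1 0%R 0%R (rpart w).
  by apply: ext_eq; rewrite mkeM pair0l /= ?mulg1 ?addr0 ?add0r.
rewrite fM gpartM ypartM; have [g1 ->] := center (rpart w).
by have /der_onlyP[g2 -> _ _] := iso_emb_der gw; rewrite addr0 groupM.
Qed.

End Iso.

(** * Recovering a group isomorphism from an isomorphism of gadgets *)

Section Recover.
Variables (gT hT : finGroupType) (p d k : nat).
Variables (c : covector gT p k) (e : covector hT p k).
Hypotheses (p_pr : prime p) (p_odd : odd p) (d_ge9 : 9 <= d)
  (d_big : (#|gT| * p ^ 3 < p ^ d)%N) (same_card : #|gT| = #|hT|).
Variables (f : gadget d c -> gadget d e) (g : gadget d e -> gadget d c).
Hypotheses (fM : {morph f : x y / x * y}) (fK : cancel f g) (gK : cancel g f).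

Let e_big : (#|hT| * p ^ 3 < p ^ d)%N. Proof. by rewrite -same_card. Qed.
Let gM : {morph g : x y / x * y}.
Proof. by move=> x y; apply: (can_inj fK); rewrite fM !gK. Qed.

Hypothesis c_full : forall P : {poly 'F_p}, size P <= k -> exists x, c x = P.

(** An arbitrary preimage under [marker]. That the choice does not influence [theta] is known only
    once [theta] has been identified. *)
Let pre (P : {poly 'F_p}) : gT * 'rV['F_p]_d :=
  odflt (1, 0%R) [pick w | marker c w.1 w.2 == P].
Let xpre P := (pre P).1.
Let ypre P := (pre P).2.

Let marker_pre (P : {poly 'F_p}) : size P <= d + k -> marker c (xpre P) (ypre P) = P.
Proof.
move=> /(marker_full c_full)[x [y hxy]].
rewrite /xpre /ypre /pre; case: pickP => [w /eqP //|/(_ (x, y))/=]; by rewrite hxy eqxx.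
Qed.

Let rho (P : {poly 'F_p}) : {poly 'F_p} := rVpoly (rho0 f (poly_rV P)).
Let theta P := imarker f (xpre P) (ypre P).

Let rhoD : {morph rho : P Q / (P + Q)%R}.
Proof. by move=> P Q; rewrite /rho linearD (rho0D p_pr d_big fM gK) linearD. Qed.

Let rhoZ a : {morph rho : P / (a%:P * P)%R}.
Proof.
by move=> P; rewrite !mul_polyC; apply: (Fp_additive_scale (h := rho)); apply: rhoD.
Qed.

Let sgZ a q : sg f (a *: q)%R = (a *: sg f q)%R.
Proof. by apply: (Fp_additive_scale (h := sg f)); apply: (sgD fM). Qed.

Lemma sg_eq0 q : sg f q = 0%R -> q = 0%R.
Proof. by move/(iso_qpart0 p_pr e_big gM fK); rewrite fK. Qed.

(** If [imarker] vanished, [f w] would commute with some [v] having [q != 0]. Then [w] would commute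
    with [g v], which has [q != 0] too, and multiplication by a nonzero pencil member is
    injective. *)
Lemma imarker_neq0 x y : marker c x y != 0%R -> imarker f x y != 0%R.
Proof.
move=> m0; apply/negP => /eqP im0.
pose w := mke (gad_pairing d c) x y 0%R 0%R.
pose v := mke (gad_pairing d e) 1 0%R (const_mx 1%R) 0%R.
have q0 : qpart (f w) = 0%R by apply: (iso_qpart0 p_pr d_big fM gK).
have : [~ v, f w] = 1.
  rewrite ext_comm /= q0 gad_fun0l comm1g subr0 /gad_fun.
  by rewrite -[marker _ _ _]/(imarker f x y) im0 mulr0 linear0.
move/(congr1 g); rewrite (iso_comm gM) fK (iso_f1 gM) ext_comm.
move/(congr1 (@rpart _ _ _ _ _)); rewrite /rpart /= gad_fun0l subr0.
move=> h; have [q'0|q'n] := eqVneq (qpart (g v)) 0%R; last first.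
  by have /eqP := gad_eq0 h q'n; rewrite (negbTE m0).
have := iso_qpart0 p_pr d_big fM gK q'0; rewrite gK => /rowP /(_ 0%R)/eqP.
by rewrite !mxE oner_eq0.
Qed.

Let imarker_size x y : size (imarker f x y) <= d + k.
Proof. exact: size_marker. Qed.

Let rho_sg q x y : rho (pencilv q * marker c x y)%R = (pencilv (sg f q) * imarker f x y)%R.
Proof. by rewrite /rho -(rho0_sg p_pr d_big fM gK). Qed.

Lemma imarker_scalar : exists2 lam : 'F_p, lam != 0%R &
  forall x y, imarker f x y = (lam%:P * marker c x y)%R.
Proof.
pose b (i : 'I_3) : 'rV['F_p]_3 := delta_mx 0%R i.
have pb : [/\ pencilv (b 0%R) = 1%R, pencilv (b 1%R) = 'X%R & pencilv (b 2%:R%R) = octic 'F_p].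
  rewrite /pencilv /b !mxE /=; split; rewrite /pencil /=; rewrite ?polyC0 ?polyC1 ?mul0r ?mul1r ?addr0 ?add0r //.
case: pb => p0 p1 p2.
have [lam lam0 hlam] : exists2 lam : 'F_p, lam != 0%R &
    forall P : {poly 'F_p}, size P <= d + k -> theta P = (lam%:P * P)%R.
  apply: (@pencil_rigidity _ (d + k) rho theta _ _ rhoD rhoZ _ _ (pencilv (sg f (b 0%R)))
     (pencilv (sg f (b 1%R))) (pencilv (sg f (b 2%:R%R)))) => //.
  - rewrite -(dvdn_pcharf (pchar_Fp p_pr)); apply/negP => /dvdn_leq -/(_ isT).
    by move: (prime_gt1 p_pr) p_odd; case: (p) => [|[|[|]]].
  - by rewrite (leq_trans d_ge9) ?leq_addr.
  - by move=> P _; apply: imarker_size.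
  - by move=> P sP P0; apply: imarker_neq0; rewrite marker_pre.
  - by do 3!eexists; reflexivity.
  - by do 3!eexists; reflexivity.
  - by do 3!eexists; reflexivity.
  - move=> x y; rewrite -!pencilvZ -pencilvD -!sgZ -(sgD fM) => /eqP.
    rewrite pencilv_eq0 => /eqP /sg_eq0 /rowP h.
    by split; [have := h 0%R | have := h 1%R]; rewrite !mxE /= !(mulr0, mulr1, addr0, add0r).
  - by move=> P sP; rewrite -rho_sg marker_pre // p0 mul1r.
  - by move=> P sP; rewrite -rho_sg marker_pre // p1.
  - by move=> P sP; rewrite -rho_sg marker_pre // p2.
(* So far the scalar is known for the chosen preimages. Values of [rho] depend on the marker alone,
   and comparing them transfers the result to [(x, y)] itself. *)
exists lam => // x y; rewrite -hlam ?size_marker //.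
have s0 : pencilv (sg f (b 0%R)) != 0%R.
  rewrite pencilv_eq0; apply/eqP => /sg_eq0 h; have /eqP := oner_neq0 {poly 'F_p}; apply.
  by rewrite -p0 h pencilv0.
by apply: (mulfI s0); rewrite -!rho_sg marker_pre ?size_marker.
Qed.

(** The marker of the image of [emb x] is [lam] times that of [(x, 0)]: its coefficients from degree
    [d] on give [e (phi x)], the lower ones show that no [y] part arises. If [phi x = 1], the image
    lies in [R]; going back by [g] puts [x] into the derived subgroup, and then [iso_emb_der]
    removes the [R] part as well. *)
Theorem gadget_recover : exists lam : 'F_p, exists phi : gT -> hT,
  [/\ lam != 0%R, {morph phi : x y / x * y}, injective phi
    & forall x, e (phi x) = (lam%:P * c x)%R].
Proof.
have [lam lam0 hlam] := imarker_scalar.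
pose phi x := gpart (f (emb _ _ x)).
have phiM : {morph phi : x y / x * y} by move=> x y; rewrite /phi embM fM gpartM.
have hm x : marker e (phi x) (ypart (f (emb _ _ x))) = ((lam *: c x)%R * 'X^d + 0)%R.
  rewrite -[LHS]/(imarker f x 0%R) hlam /marker linear0 add0r addr0 -mul_polyC.
  by rewrite -mulrA [('X^d * _)%R]mulrC.
have ephi x : e (phi x) = (lam%:P * c x)%R.
  by rewrite -(drop_marker _ _ (ypart (f (emb _ _ x)))) hm addrC drop_polyDMXn ?size_poly0 // mul_polyC.
have yphi x : ypart (f (emb _ _ x)) = 0%R.
  rewrite -[LHS]rVpolyK -(take_marker e (phi x)) hm addrC take_polyDMXn ?size_poly0 //.
  by rewrite linear0.
exists lam, phi; split=> //.
have e_full (P : {poly 'F_p}) : size P <= k -> exists y, e y = P.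
  move=> sP; have [|x hx] := @c_full (lam^-1%:P * P)%R.
    by rewrite mul_polyC (leq_trans (size_scale_leq _ _)).
  by exists (phi x); rewrite ephi hx mulrA -polyCM mulfV // mul1r.
have triv x : phi x = 1 -> x = 1.
  move=> px; pose w := f (emb _ _ x).
  have qw : qpart w = 0%R by apply: (iso_qpart0 p_pr d_big fM gK).
  have [] := iso_center_der p_pr e_big gM fK (ltnW d_ge9) e_full (w := w).
  - by rewrite -[gpart w]/(phi x) px group1.
  - exact: yphi.
  - exact: qw.
  rewrite fK => /(iso_emb_der p_pr d_big fM gK) /der_onlyP[_ _ _ rw] _.
  have : w = 1 by apply: ext_eq => //; apply: yphi.
  by rewrite -(iso_f1 fM) => /(can_inj fK) /(congr1 (@gpart _ _ _ _ _)).
have phi1 : phi 1 = 1 by apply: (mulgI (phi 1)); rewrite -phiM !mulg1.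
have phiV x : phi x^-1 = (phi x)^-1 by apply: (mulgI (phi x)); rewrite -phiM !mulgV phi1.
move=> x y pxy; apply/eqP; rewrite eq_mulgV1; apply/eqP; apply: triv.
by rewrite phiM phiV pxy mulgV.
Qed.

End Recover.

(** * Isomorphisms of gadgets *)

Section Scaling.
Variables (gT : finGroupType) (p n : nat).
Hypothesis gT_p : class_le2_expp p gT.
Notation G' := ([set: gT]^`(1)).

Lemma der_central z x : z \in G' -> commute z x.
Proof.
case: gT_p => _ _ + _; rewrite nil_class2 => /subsetP h /h /centerP[_]; apply; exact: in_setT.
Qed.

Lemma comm_in_der (x y : gT) : [~ x, y] \in G'.
Proof. by apply: mem_commg; rewrite inE. Qed.

Lemma comm_mulr_der (x y z : gT) : z \in G' -> [~ x * z, y] = [~ x, y].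
Proof.
move=> hz; rewrite commMgR.
have e w : [~ z, w] = 1 by apply/eqP/commgP/der_central.
have -> : [~ x, y, z] = 1 by apply/eqP/commgP/commute_sym/der_central.
by rewrite e !mulg1.
Qed.

Lemma comm_expn2 (x y : gT) i j : [~ x ^+ i, y ^+ j] = [~ x, y] ^+ (i * j).
Proof. by apply: commXXg; apply: commute_sym; apply: der_central (comm_in_der _ _). Qed.

Lemma expg_p1 (x : gT) : x ^+ p = 1.
Proof. by case: gT_p => _ _ _ <-; apply: expg_exponent; rewrite inE. Qed.

Definition der_graph := [set w : gT * gT | (w.1 \in G') && (w.2 == w.1 ^+ (n * n))].

Lemma group_set_der_graph : group_set der_graph.
Proof.
apply/group_setP; split; first by rewrite inE group1 /= expg1n eqxx.
move=> [a b] [a' b']; rewrite !inE /= => /andP[h /eqP ->] /andP[h' /eqP ->].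
by rewrite groupM //= expgMn //; apply: der_central.
Qed.
Canonical der_graph_group := Group group_set_der_graph.

(* Graphs of partial endomorphisms inducing the [n]-th power map modulo [G'] and its [n ^ 2]-th power map
   on [G'].  A maximal one is total, since otherwise it can be enlarged by a pair [(x, x ^+ n)]. *)
Definition scaling_graph (K : {group gT * gT}) :=
  [&& der_graph \subset K, [forall (w | w \in K), (w.1 ^+ n)^-1 * w.2 \in G'] &
      [forall (w | w \in K), (w.1 == 1) ==> (w.2 == 1)]].

Lemma expg_pair (w : gT * gT) i : w ^+ i = (w.1 ^+ i, w.2 ^+ i).
Proof. by elim: i => [//|i IH]; rewrite !expgS IH. Qed.

(** The pair [(x, x ^+ n)] normalises [K], since its commutators with [K] lie in [der_graph]. The
    enlarged group is still the graph of a map: a relation [a * x ^+ i = 1] with [i] prime to [p]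
    would make [x] a first coordinate in [K] already, and for [p] dividing [i] nothing new is
    identified. *)
Lemma scaling_graph_total (K : {group gT * gT}) x :
  maxgroup K scaling_graph -> exists y, (x, y) \in K.
Proof.
move=> /maxgroupP[/and3P[DK /forall_inP Kn /forall_inP K1] Kmax].
have [/existsP[y hy]|/existsPn nx] := boolP [exists y, (x, y) \in K]; first by exists y.
pose t : gT * gT := (x, x ^+ n).
have p_pr : prime p by case: gT_p.
have tN : t \in 'N(K).
  rewrite inE; apply/subsetP => _ /imsetP[[a b] hab ->].
  rewrite conjg_mulR groupM // (subsetP DK) // inE.
  have -> : [~ (a, b), t] = ([~ a, x], [~ b, x ^+ n]) by [].
  rewrite comm_in_der /=.
  have -> : b = a ^+ n * ((a ^+ n)^-1 * b) by rewrite mulKVg.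
  by rewrite comm_mulr_der ?comm_expn2 // (Kn (a, b)).
have KL : K \subset K <*> <[t]> by apply: joing_subl.
suff PL : scaling_graph (K <*> <[t]>)%G.
  have : t \in K by rewrite -(Kmax _ PL KL) mem_gen // inE cycle_id orbT.
  by move/negP: (nx (x ^+ n)).
have memL w : w \in K <*> <[t]> -> exists a b i, (a, b) \in K /\ w = (a * x ^+ i, b * x ^+ (n * i)).
  rewrite norm_joinEr ?cycle_subG // => /mulsgP[[a b] v hab /cycleP[i ->] ->].
  by exists a, b, i; split=> //; rewrite expg_pair /= -expgM.
apply/and3P; split.
- exact: subset_trans DK KL.
- apply/forall_inP => _ /memL[a [b [i [hab ->]]]] /=.
  have := Kn _ hab => /= hz.
  have cc (u v : gT) : commute u [~ u, v].
    by apply: commute_sym; apply: der_central (comm_in_der _ _).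
  rewrite expMg_Rmul; try by apply: commute_sym; apply: der_central (comm_in_der _ _).
  rewrite -expgM [(i * n)%N]mulnC.
  have -> : b = a ^+ n * ((a ^+ n)^-1 * b) by rewrite mulKVg.
  move: ((a ^+ n)^-1 * b) hz => z hz.
  have -> : a ^+ n * z * x ^+ (n * i) = a ^+ n * x ^+ (n * i) * z.
    by rewrite -!mulgA; congr (_ * _); exact: der_central.
  rewrite invMg -mulgA mulKg groupM // groupV groupX //; exact: comm_in_der.
apply/forall_inP => _ /memL[a [b [i [hab ->]]]] /=; apply/implyP => /eqP ax.
have [pi|npi] := boolP (p %| i).
  have xi j : x ^+ (j * i) = 1.
    by have /dvdnP[q ->] := pi; rewrite mulnA mulnC expgM expg_p1 expg1n.
  have xi1 := xi 1%N; rewrite mul1n in xi1.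
  by have := K1 _ hab; rewrite xi mulg1 /= => /implyP; apply; rewrite -ax xi1 mulg1.
have cop : coprime p i by rewrite prime_coprime.
have i0 : 0 < i by rewrite lt0n; apply: contraNneq npi => ->; rewrite dvdn0.
case: (egcdnP p i0) => km kn e _.
have ekm : (km * i = kn * p + 1)%N by rewrite e gcdnC; move/eqP: cop => ->.
(* Since [a = x ^- i] and [km * i] is 1 modulo [p], the inverse of [(a, b) ^+ km] has first
   coordinate [x]. *)
case/negP: (nx ((b ^+ km)^-1)).
suff -> : (x, (b ^+ km)^-1) = ((a, b) ^+ km)^-1 by rewrite groupV groupX.
rewrite expg_pair /=; congr (_, _).
have -> : a = x ^- i by apply/eqP; rewrite eq_mulgV1 invgK ax.
by rewrite expgVn invgK -expgM mulnC ekm expgD mulnC expgM expg_p1 expg1n mul1g.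
Qed.

(** For a graded Lie ring of class 2 this would be the dilation by [n] in degree 1 and [n ^ 2] in
    degree 2; the maximal graph replaces the choice of a grading. It serves with [n] the inverse of
    the scalar that rigidity leaves undetermined. *)
Lemma scaling_endo : exists delta : gT -> gT,
  [/\ {morph delta : x y / x * y},
      forall x, (x ^+ n)^-1 * delta x \in G' &
      forall z, z \in G' -> delta z = z ^+ (n * n)].
Proof.
have [K Kmax] : {K : {group gT * gT} | maxgroup K scaling_graph}.
  apply: ex_maxgroup; exists der_graph_group; apply/and3P; split=> //.
    apply/forall_inP => w; rewrite inE => /andP[h /eqP ->].
    by rewrite groupM ?groupV ?groupX.
  by apply/forall_inP => w; rewrite inE => /andP[h /eqP ->]; apply/implyP => /eqP ->; rewrite expg1n.
have tot x := scaling_graph_total x Kmax.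
case/maxgroupP: Kmax => /and3P[/subsetP DK /forall_inP Kn /forall_inP K1] _.
pose delta x := odflt 1 [pick y | (x, y) \in K].
have dK x : (x, delta x) \in K.
  by rewrite /delta; case: pickP => [y //|h]; have [y] := tot x; rewrite h.
have uniqK x y y' : (x, y) \in K -> (x, y') \in K -> y = y'.
  move=> h h'; have h2 : (1, y^-1 * y') \in K.
    have -> : (1, y^-1 * y') = (x, y)^-1 * (x, y') by congr (_, _); rewrite /= mulVg.
    by rewrite groupM ?groupV.
  have /= := implyP (K1 _ h2) (eqxx _); rewrite -eq_invg_mul invgK => /eqP.
  exact.
exists delta; split.
- by move=> x y; apply: (uniqK (x * y)) => //; rewrite -[(x * y, _)]/((x, delta x) * (y, delta y)) groupM.
- by move=> x; apply: (Kn (x, delta x)).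
by move=> z hz; apply: (uniqK z) => //; apply: DK; rewrite inE /= hz eqxx.
Qed.

End Scaling.

Lemma class2_odd p N (gT : finGroupType) : class2_expp p N gT -> odd p.
Proof.
move=> [p_pr _ nil2 exp_p _]; have [p2|//] := even_prime p_pr.
have : exponent [set: gT] %| 2 by rewrite exp_p p2.
move/exponent2_abelem/abelem_abelian; rewrite -nil_class1 nil2 //.
Qed.

Lemma class2_prime p N (gT : finGroupType) : class2_expp p N gT -> prime p.
Proof. by case. Qed.

Lemma class2_le2 p N (gT : finGroupType) : class2_expp p N gT -> class_le2_expp p gT.
Proof. by move=> [? ? nil2 ? _]; split=> //; rewrite nil2. Qed.

Lemma cov1 (gT : finGroupType) p k (c : covector gT p k) : c 1 = 0%R.
Proof. by apply: (addrI (c 1)); rewrite -covM mulg1 addr0. Qed.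

Lemma covV (gT : finGroupType) p k (c : covector gT p k) x : c x^-1 = (- c x)%R.
Proof. by apply: (addrI (c x)); rewrite -covM mulgV cov1 subrr. Qed.

Lemma covX (gT : finGroupType) p k (c : covector gT p k) x n : c (x ^+ n) = (c x *+ n)%R.
Proof. by elim: n => [|n IH]; rewrite ?cov1 // expgS covM IH mulrS. Qed.

Lemma cov_der (gT : finGroupType) p k (c : covector gT p k) z : z \in [set: gT]^`(1) -> c z = 0%R.
Proof.
have Kg : group_set [set z | c z == 0%R].
  apply/group_setP; split=> [|x y]; rewrite !inE ?cov1 // covM => /eqP -> /eqP ->.
  by rewrite addr0.
suff /subsetP/[apply] : [set: gT]^`(1) \subset Group Kg by rewrite inE => /eqP.
rewrite gen_subG; apply/subsetP => _ /imset2P[x y _ _ ->].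
by rewrite inE /commg /conjg !covM !covV addrCA addKr addNr.
Qed.

Lemma inj_hom_isog (gT hT : finGroupType) (phi : gT -> hT) : {morph phi : x y / x * y} ->
  injective phi -> #|gT| = #|hT| ->
  exists f : {morphism [set: gT] >-> hT}, isom [set: gT] [set: hT] f /\ (forall x, f x = phi x).
Proof.
move=> phiM phi_inj same.
pose f := @Morphism _ _ [set: gT] phi (fun x y _ _ => phiM x y).
exists f; split=> //; apply/isomP; split; first by apply/injmP => x y _ _; apply: phi_inj.
apply/eqP; rewrite eqEcard subsetT /= card_injm ?cardsT ?same //.
by apply/injmP => x y _ _; apply: phi_inj.
Qed.

Lemma isog_bij (gT hT : finGroupType) : [set: gT] \isog [set: hT] ->
  exists f : gT -> hT, exists g : hT -> gT,
  [/\ {morph f : x y / x * y}, cancel f g & cancel g f].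
Proof.
move=> iso; have same : #|hT| <= #|gT| by rewrite -!cardsT (card_isog iso).
case/isogP: iso => f /injmP f_inj _.
have [|g fK gK] := inj_card_bij (f := f) _ same; first by move=> x y; apply: f_inj; rewrite inE.
by exists f, g; split=> // x y; rewrite morphM ?inE.
Qed.

(** From left to right, the recovered map is composed with the scaling endomorphism for [lam^-1],
    which multiplies [c] by [lam^-1] because [c] kills the derived subgroup. From right to left,
    [phi] acts on the group part and all other coordinates stay. *)
Theorem gadget_isogP p N d k (gT hT : finGroupType) (c : covector gT p k) (e : covector hT p k) :
  class2_expp p N gT -> class2_expp p N hT -> 9 <= d -> (N * p ^ 3 < p ^ d)%N ->
  (forall P : {poly 'F_p}, size P <= k -> exists x, c x = P) ->
  reflect (exists phi : gT -> hT, [/\ {morph phi : x y / x * y}, injective phi &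
             forall x, e (phi x) = c x])
    ([set: gadget d c] \isog [set: gadget d e]).
Proof.
move=> gG hG d9 dN c_full.
have [p_pr _ _ _ cardG] := gG; have [_ _ _ _ cardH] := hG.
rewrite -cardG cardsT in dN; have same : #|gT| = #|hT| by rewrite -!cardsT cardG cardH.
apply: (iffP idP) => [/isog_bij[f [g [fM fK gK]]] | [phi [phiM phi_inj ec]]].
  have [lam [phi [lam0 phiM phi_inj ephi]]] :=
    gadget_recover p_pr (class2_odd gG) d9 dN same fM fK gK c_full.
  pose n : nat := lam^-1%R.
  have [delta [dM dn dder]] := scaling_endo n (class2_le2 gG).
  have cdelta x : c (delta x) = (lam^-1%:P * c x)%R.
    have -> : delta x = x ^+ n * ((x ^+ n)^-1 * delta x) by rewrite mulKVg.
    rewrite covM (cov_der _ (dn x)) addr0 covX -mulr_natr mulrC -polyC_natr.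
    by congr (_%:P * _)%R; rewrite natr_Zp.
  have d1 : delta 1 = 1 by apply: (mulgI (delta 1)); rewrite -dM !mulg1.
  have dV x : delta x^-1 = (delta x)^-1 by apply: (mulgI (delta x)); rewrite -dM !mulgV d1.
  have n_cop : coprime p n.
    rewrite prime_coprime // (dvdn_pcharf (pchar_Fp p_pr)) natr_Zp invr_eq0.
    exact: lam0.
  have cancel_n x m : coprime p m -> x ^+ m = 1 -> x = 1 :> gT.
    move=> cop xm; have ox : #[x] %| p by rewrite order_dvdn (expg_p1 (class2_le2 gG)).
    apply/eqP; rewrite -order_eq1 -dvdn1 -(eqnP cop) dvdn_gcd ox order_dvdn xm eqxx //.
  (* [delta x = 1] puts [x ^+ n], hence [x], into the derived subgroup, where [delta] is a power map
     with exponent prime to [p]. *)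
  have dtriv x : delta x = 1 -> x = 1.
    move=> dx; have hn : x ^+ n \in [set: gT]^`(1).
      by have := dn x; rewrite dx mulg1 groupV.
    have hx : x \in [set: gT]^`(1).
      have i0 : 0 < n by move: n_cop; case: (n) => //; rewrite /coprime gcdn0 => /eqP p1; move: (prime_gt1 p_pr); rewrite p1.
      case: (egcdnP p i0) => km kn ek _.
      have {}ek : (km * n = kn * p + 1)%N by rewrite ek gcdnC (eqnP n_cop).
      have := groupX km hn; rewrite -expgM mulnC ek expgD mulnC expgM.
      by rewrite (expg_p1 (class2_le2 gG)) expg1n mul1g.
    by apply: (cancel_n x (n * n)%N); rewrite ?coprimeMr ?n_cop // -dder.
  have d_inj : injective delta.
    move=> x y dxy; apply/eqP; rewrite eq_mulgV1; apply/eqP; apply: dtriv.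
    by rewrite dM dV dxy mulgV.
  exists (phi \o delta); split.
  - by move=> x y /=; rewrite dM phiM.
  - exact: inj_comp.
  - by move=> x /=; rewrite ephi cdelta mulrA -polyCM mulfV // mul1r.
pose F (w : gadget d c) : gadget d e := mke _ (phi (gpart w)) (ypart w) (qpart w) (rpart w).
have FM : {morph F : v w / v * w}.
  move=> v w; rewrite /F mkeM gpartM phiM; congr mke.
  by rewrite rpartM /= /gad_fun /marker ec.
have F_inj : injective F.
  by move=> v w [] hg hy hq hr; apply: ext_eq => //; apply: phi_inj.
have [|h [hi _]] := inj_hom_isog FM F_inj; last by apply: isom_isog hi; rewrite subxx.
by rewrite -!cardsT !card_gadget // !cardsT same.
Qed.

(** * A clamped register language *)

Close Scope group_scope.

(** With [X.+1] in place of [X] the bound does not degenerate at 0, and the class is closed under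
    sums, products and composition. *)
Definition pbound (f : nat -> nat) := exists c d, forall X, f X <= c * X.+1 ^ d.

Lemma pb_const n : pbound (fun=> n).
Proof. by exists n, 0 => X; rewrite expn0 muln1. Qed.

Lemma pb_id : pbound id.
Proof. by exists 1, 1 => X; rewrite expn1 mul1n. Qed.

Lemma pb_le f g : (forall X, f X <= g X) -> pbound g -> pbound f.
Proof. by move=> fg [c [d h]]; exists c, d => X; apply: leq_trans (fg X) (h X). Qed.

Lemma pb_add f g : pbound f -> pbound g -> pbound (fun X => f X + g X).
Proof.
move=> [c [d h]] [c' [d' h']]; exists (c + c'), (d + d') => X.
rewrite mulnDl; apply: leq_add; [apply: leq_trans (h X) _|apply: leq_trans (h' X) _];
  by rewrite leq_mul2l leq_pexp2l ?leq_addr ?leq_addl ?orbT.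
Qed.

Lemma pb_mul f g : pbound f -> pbound g -> pbound (fun X => f X * g X).
Proof.
move=> [c [d h]] [c' [d' h']]; exists (c * c'), (d + d') => X.
by rewrite expnD mulnACA leq_mul.
Qed.

Lemma pb_comp f g : pbound f -> pbound g -> pbound (fun X => f (g X)).
Proof.
move=> [c [d h]] [c' [d' h']]; exists (c * (c' + 1) ^ d), (d' * d) => X.
apply: leq_trans (h _) _; rewrite -mulnA leq_mul2l expnM -expnMn; apply/orP; right.
case: (posnP d) => [->|d0]; first by rewrite !expn0.
by rewrite leq_exp2r // mulnDl mul1n -addn1 leq_add // expn_gt0.
Qed.

Lemma bits_le n : bits n <= n.+1.
Proof.
rewrite ltnS; have [->|n0] := posnP n; first by rewrite trunc_log0.
by rewrite (leq_trans _ (trunc_logP (ltnSn 1) n0)) // ltnW // ltn_expl.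
Qed.

(* [RVar] is a de Bruijn index into the values of the enclosing [PFor] and [RSum] counters. *)
Inductive rex :=
  | RCst of nat
  | RVar of nat
  | RGet of nat & rex
  | RBin of binop & rex & rex
  | RSum of rex & rex.

Fixpoint reval (m : memory) (r : seq nat) (e : rex) : nat :=
  match e with
  | RCst n => n
  | RVar v => nth 0 r v
  | RGet x i => m x (reval m r i)
  | RBin o a b => op_eval o (reval m r a) (reval m r b)
  | RSum n b => \sum_(j < reval m r n) reval m (val j :: r) b
  end.

(* Programs use the arrays below [usr]; the others hold the temporaries of compiled code. *)
Definition usr := 50.
Definition tmp := 50.
Definition vr := 51.
Definition lim := 52.
Definition acc := 53.
Definition bnd := 54.

Fixpoint wfe (d : nat) (e : rex) : bool :=
  match e with
  | RCst _ => true
  | RVar v => v < d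
  | RGet x i => (x < usr) && wfe d i
  | RBin _ a b => wfe d a && wfe d b
  | RSum n b => wfe d n && wfe d.+1 b
  end.

Definition same_user (m m' : memory) := forall x, x < usr -> m x =1 m' x.
Definition bounded (m : memory) (B : nat) := forall x i, x < usr -> m x i <= B.

Lemma reval_ext e m m' r : wfe (size r) e -> same_user m m' -> reval m r e = reval m' r e.
Proof.
elim: e r => [n|v|x i IH|o a IHa b IHb|n IHn b IHb] r //= w mm'.
- by case/andP: w => xu wi; rewrite IH // mm'.
- by case/andP: w => wa wb; rewrite IHa // IHb.
- case/andP: w => wn wb; rewrite IHn //; apply: eq_bigr => j _.
  by apply: IHb.
Qed.

(** Bounds the value when memory and counters are bounded by [X]. The counter of a sum may exceed
    [X], so its body is bounded at [X + vb n X]. *)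
Fixpoint vb (e : rex) (X : nat) : nat :=
  match e with
  | RCst n => n
  | RVar v => X
  | RGet x i => X
  | RBin o a b => (vb a X).+1 * (vb b X).+1
  | RSum n b => vb n X * vb b (X + vb n X)
  end.

Lemma pb_vb e : pbound (vb e).
Proof.
elim: e => [n|v|x i IH|o a IHa b IHb|n IHn b IHb] /=.
- exact: pb_const.
- exact: pb_id.
- exact: pb_id.
- apply: (@pb_le _ (fun X => (vb a X + 1) * (vb b X + 1))) => [X|]; first by rewrite !addn1.
  by apply: pb_mul; apply: pb_add => //; apply: pb_const.
- by apply: pb_mul => //; apply: (pb_comp IHb); apply: pb_add => //; apply: pb_id.
Qed.

(** The successors let one product dominate every operation, including sums and the value 1 of a
    comparison. *)
Lemma op_eval_le o a b : op_eval o a b <= a.+1 * b.+1.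
Proof.
have h : a <= a.+1 * b.+1 by apply: leq_trans (leqnSn a) (leq_pmulr _ _).
case: o => /=.
- by rewrite mulnS mulSn; lia.
- exact: leq_trans (leq_subr _ _) h.
- by apply: leq_mul.
- exact: leq_trans (leq_div _ _) h.
- exact: leq_trans (leq_mod _ _) h.
- by case: (_ == _).
- by case: (_ < _).
Qed.

Lemma nth_le_all X r v : all (leq^~ X) r -> nth 0 r v <= X.
Proof.
move=> /all_nthP h; have [vr_|vr_] := ltnP v (size r); first exact: h.
by rewrite nth_default.
Qed.

Lemma reval_le e m r X : wfe (size r) e -> bounded m X -> all (leq^~ X) r ->
  reval m r e <= vb e X.
Proof.
elim: e r X => [n|v|x i IH|o a IHa b IHb|n IHn b IHb] r X //= w mX rX.
- exact: nth_le_all.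
- by case/andP: w => xu _; apply: mX.
- case/andP: w => wa wb; apply: leq_trans (op_eval_le _ _ _) _.
  by rewrite leq_mul // ltnS ?IHa ?IHb.
- case/andP: w => wn wb; have hn := IHn _ _ wn mX rX.
  apply: (@leq_trans (\sum_(j < reval m r n) vb b (X + vb n X))).
    apply: leq_sum => j _; apply: IHb => //.
      by move=> x i xu; apply: leq_trans (mX _ _ xu) (leq_addr _ _).
    apply/andP; split.
      by apply: leq_trans (ltnW (ltn_ord j)) (leq_trans hn (leq_addl _ _)).
    by apply: sub_all rX => y /leq_trans; apply; apply: leq_addr.
  by rewrite sum_nat_const card_ord leq_mul2r hn orbT.
Qed.

Definition tmp_reg (k : nat) : expr := Get tmp (Cst k).
Definition loop_var (d : nat) : expr := Get vr (Cst d).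
Definition loop_lim (d : nat) : expr := Get lim (Cst d).
Definition loop_acc (d : nat) : expr := Get acc (Cst d).

(** [d] counts the enclosing loops and [k] is the first free temporary, which receives the value.
    The outermost counter sits in register 0 of [vr], so the de Bruijn index [v] becomes
    [d - v.+1]. *)
Fixpoint comp (d k : nat) (e : rex) : cmd :=
  match e with
  | RCst n => Assign tmp (Cst k) (Cst n)
  | RVar v => Assign tmp (Cst k) (loop_var (d - v.+1))
  | RGet x i => Then (comp d k i) (Assign tmp (Cst k) (Get x (tmp_reg k)))
  | RBin o a b => Then (comp d k a) (Then (comp d k.+1 b)
      (Assign tmp (Cst k) (Bin o (tmp_reg k) (tmp_reg k.+1))))
  | RSum n b => Then (comp d k n) (Then (Assign lim (Cst d) (tmp_reg k))
      (Then (Assign acc (Cst d) (Cst 0)) (Then (Assign vr (Cst d) (Cst 0))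
      (Then (While (Bin Lt (loop_var d) (loop_lim d))
         (Then (comp d.+1 k b) (Then (Assign acc (Cst d) (Bin Add (loop_acc d) (tmp_reg k)))
            (Assign vr (Cst d) (Bin Add (loop_var d) (Cst 1))))))
      (Assign tmp (Cst k) (loop_acc d))))))
  end.

(** Code compiled at [d] and [k] may use loop registers from [d] on and temporaries from [k] on;
    whatever lies below belongs to the code around it. *)
Record keeps (d k : nat) (M M' : memory) : Prop := Keeps {
  keep_user : same_user M' M;
  keep_bnd : M' bnd 0 = M bnd 0;
  keep_tmp : forall j, j < k -> M' tmp j = M tmp j;
  keep_reg : forall x v, x \in [:: vr; lim; acc] -> v < d -> M' x v = M x v }.

Lemma keeps_trans d k M1 M2 M3 : keeps d k M1 M2 -> keeps d k M2 M3 -> keeps d k M1 M3.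
Proof.
move=> [a b c e] [a' b' c' e']; split.
- by move=> x xu i; rewrite a' ?a.
- by rewrite b' b.
- by move=> j jk; rewrite c' ?c.
- by move=> x v h h'; rewrite e' ?e.
Qed.

Lemma keeps_weak d d' k k' M M' : d <= d' -> k <= k' -> keeps d' k' M M' -> keeps d k M M'.
Proof.
move=> dd kk [a b c e]; split=> //.
- by move=> j jk; apply: c; apply: leq_trans kk.
- by move=> x v h h'; apply: e => //; apply: leq_trans dd.
Qed.

Lemma keeps_tmp d k M i v : k <= i -> keeps d k M (update M tmp i v).
Proof.
move=> ki; split=> //=.
- by move=> x xu j; rewrite /update; case: eqP xu => [->|].
- by move=> j jk; rewrite /update eqxx /=; case: eqP jk ki => [->|//]; lia.
- by move=> x y; rewrite !inE /update => /or3P[] /eqP ->.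
Qed.

Lemma keeps_reg d k M x v : x \in [:: vr; lim; acc] -> keeps d k M (update M x d v).
Proof.
move=> hx; split=> //=.
- move=> y yu j; rewrite /update; case: eqP yu => [->|//].
  by move: hx; rewrite !inE => /or3P[] /eqP ->.
- by rewrite /update; move: hx; rewrite !inE => /or3P[] /eqP ->.
- by move=> j jk; rewrite /update; move: hx; rewrite !inE => /or3P[] /eqP ->.
- by move=> y w hy wd; rewrite /update; case: (w =P d) wd => [->|]; rewrite ?ltnn ?andbF.
Qed.

Lemma updE m x i v : update m x i v x i = v.
Proof. by rewrite /update !eqxx. Qed.

Lemma updN m x i v y j : y != x -> update m x i v y j = m y j.
Proof. by rewrite /update => /negbTE ->. Qed.

Lemma exec_assign O x i e M t :
  ecost M i + ecost M e + bits (eval M i) + bits (eval M e) <= t ->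
  exists M' t', [/\ exec O (Assign x i e) M M' t' [::], t' <= t
    & M' = update M x (eval M i) (eval M e)].
Proof. by move=> h; do 2!eexists; split; [exact: ExecAssign|exact: h|]. Qed.

Definition cond_cost d n := 9 * (d + n + 2).

Lemma cond_cost_le M d i n : M vr d = i -> M lim d = n -> i <= n ->
  ecost M (Bin Lt (loop_var d) (loop_lim d)) <= cond_cost d n.
Proof.
move=> hi hn le; rewrite /= hi hn /cond_cost.
by have := bits_le d; have := bits_le i; have := bits_le n; lia.
Qed.

(** The common core of compiled sums and compiled loops. The body has to advance the counter itself
    and to leave the limit intact. *)
Lemma exec_count O (I : nat -> memory -> Prop) d n body t (Q : nat -> seq _) M :
  (forall i M, i < n -> I i M -> M vr d = i -> M lim d = n -> exists M' t',
     [/\ exec O body M M' t' (Q i), t' <= t, I i.+1 M', M' vr d = i.+1 & M' lim d = n]) ->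
  I 0 M -> M vr d = 0 -> M lim d = n ->
  exists M' t', [/\ exec O (While (Bin Lt (loop_var d) (loop_lim d)) body) M M' t' (flatten [seq Q i | i <- iota 0 n]),
     t' <= n * (t + cond_cost d n) + cond_cost d n & I n M'].
Proof.
move=> step; have main j : forall i M, i + j = n -> I i M -> M vr d = i -> M lim d = n ->
  exists M' t', [/\ exec O (While (Bin Lt (loop_var d) (loop_lim d)) body) M M' t' (flatten [seq Q i | i <- iota i j]),
     t' <= j * (t + cond_cost d n) + cond_cost d n & I n M'].
  elim: j => [|j IH] i M1 ij Ii Vi Ln.
    rewrite addn0 in ij; exists M1, (ecost M1 (Bin Lt (loop_var d) (loop_lim d))); split.
    - by apply: ExecWhileFalse; rewrite /= Vi Ln ij ltnn.
    - by rewrite mul0n add0n (cond_cost_le Vi Ln) // ij.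
    - by rewrite -ij.
  have lt_in : i < n by rewrite -ij addnS ltnS leq_addr.
  have [M2 [t2 [e2 b2 I2 V2 L2]]] := step _ _ lt_in Ii Vi Ln.
  have [|M3 [t3 [e3 b3 I3]]] := IH i.+1 M2 _ I2 V2 L2; first by rewrite addSnnS.
  exists M3, (ecost M1 (Bin Lt (loop_var d) (loop_lim d)) + t2 + t3); split=> //.
    by apply: ExecWhileTrue e2 e3; rewrite /= Vi Ln lt_in.
  rewrite mulSn; have := cond_cost_le Vi Ln (ltnW lt_in); lia.
by move=> I0 V0 Ln; apply: main.
Qed.

Definition op_cost (X d k n : nat) : nat := 40 * (X + d + k + n + 2).

Lemma pb_op_cost f d k n : pbound f -> pbound (fun X => op_cost (f X) d k n).
Proof.
move=> h; apply: (pb_mul (pb_const 40)); apply: pb_add (pb_const 2); apply: pb_add (pb_const n).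
by apply: pb_add (pb_const k); apply: pb_add (pb_const d).
Qed.

Lemma comp_exec e : forall d k, exists2 f, pbound f & forall O M r X,
  size r = d -> wfe d e -> (forall v, v < d -> M vr v = nth 0 r (d - v.+1)) ->
  bounded M X -> all (leq^~ X) r ->
  exists M' t, [/\ exec O (comp d k e) M M' t [::], t <= f X, M' tmp k = reval M r e & keeps d k M M'].
Proof.
elim: e => [n|v|x i IH|o a IHa b IHb|n IHn b IHb] d k.
- exists (fun X => op_cost X d k n) => [|O M r X sr w Mr mX rX]; first exact: pb_op_cost pb_id.
  have [|M' [t [ex tb E]]] := @exec_assign O tmp (Cst k) (Cst n) M (op_cost X d k n).
    by rewrite /= /op_cost; have := bits_le k; have := bits_le n; lia.
  by exists M', t; split=> //; rewrite E; [rewrite updE|apply: keeps_tmp].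
- exists (fun X => op_cost X d k v) => [|O M r X sr w Mr mX rX]; first exact: pb_op_cost pb_id.
  have Mv : M vr (d - v.+1) = nth 0 r v.
    have vd : v < d by exact: w.
    by rewrite Mr; [congr nth|]; lia.
  have [|M' [t [ex tb E]]] := @exec_assign O tmp (Cst k) (loop_var (d - v.+1)) M (op_cost X d k v).
    rewrite /= /op_cost Mv; have := bits_le k; have := bits_le (d - v.+1).
    by have := bits_le (nth 0 r v); have := nth_le_all v rX; lia.
  by exists M', t; split=> //; rewrite E; [rewrite updE /= Mv|apply: keeps_tmp].
- have [f pf hf] := IH d k.
  exists (fun X => f X + op_cost (X + vb i X) d k 0) => [|O M r X sr /andP[xu wi] Mr mX rX].
    by apply: pb_add => //; apply: pb_op_cost; apply: pb_add pb_id (pb_vb i).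
  have [M1 [t1 [e1 b1 E1 K1]]] := hf O M r X sr wi Mr mX rX.
  have [|M' [t [ex tb E]]] := @exec_assign O tmp (Cst k) (Get x (tmp_reg k)) M1 (op_cost (X + vb i X) d k 0).
    rewrite /= /op_cost E1 (keep_user K1) //.
    have hv : reval M r i <= vb i X by apply: reval_le; rewrite ?sr.
    have := bits_le k; have := bits_le (reval M r i).
    by have := bits_le (M x (reval M r i)); have := mX x (reval M r i) xu; lia.
  exists M', (t1 + t); split.
  + exact: (ExecThen e1 ex).
  + exact: leq_add.
  + by rewrite E updE /= E1 (keep_user K1).
  + by rewrite E; apply: keeps_trans K1 _; apply: keeps_tmp.
- have [f pf hf] := IHa d k; have [g pg hg] := IHb d k.+1.
  exists (fun X => f X + (g X + op_cost (vb a X + vb b X + (vb a X + 1) * (vb b X + 1)) d k 1)).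
    apply: pb_add => //; apply: pb_add => //; apply: pb_op_cost; apply: pb_add.
      by apply: pb_add; apply: pb_vb.
    by apply: pb_mul; apply: pb_add (pb_const 1); apply: pb_vb.
  move=> O M r X sr /andP[wa wb] Mr mX rX.
  have [M1 [t1 [e1 b1 E1 K1]]] := hf O M r X sr wa Mr mX rX.
  have [|||M2 [t2 [e2 b2 E2 K2]]] := hg O M1 r X sr wb.
  + by move=> v vd; rewrite (keep_reg K1) ?Mr // !inE eqxx.
  + by move=> x i xu; rewrite (keep_user K1) // mX.
  + exact: rX.
  have Eb : reval M1 r b = reval M r b by apply: reval_ext (keep_user K1); rewrite sr.
  have hva : reval M r a <= vb a X by apply: reval_le; rewrite ?sr.
  have hvb : reval M r b <= vb b X by apply: reval_le; rewrite ?sr.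
  have E1' : M2 tmp k = reval M r a by rewrite (keep_tmp K2).
  have [|M' [t [ex tb E]]] := @exec_assign O tmp (Cst k) (Bin o (tmp_reg k) (tmp_reg k.+1)) M2
     (op_cost (vb a X + vb b X + (vb a X + 1) * (vb b X + 1)) d k 1).
    rewrite /= /op_cost E2 Eb E1'.
    have hv : op_eval o (reval M r a) (reval M r b) <= (vb a X + 1) * (vb b X + 1).
      by apply: leq_trans (op_eval_le _ _ _) _; rewrite !addn1 leq_mul // ltnS.
    have := bits_le k; have := bits_le k.+1; have := bits_le (reval M r a); have := bits_le (reval M r b).
    by have := bits_le (op_eval o (reval M r a) (reval M r b)); lia.
  exists M', (t1 + (t2 + t)); split.
  + exact: (ExecThen e1 (ExecThen e2 ex)).
  + by rewrite !leq_add.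
  + by rewrite E updE /= E2 Eb E1'.
  + rewrite E; apply: keeps_trans K1 _; apply: keeps_trans (keeps_weak _ _ K2) _ => //.
    exact: keeps_tmp.
have [f pf hf] := IHn d k; have [g pg hg] := IHb d.+1 k.
(* [X'] also bounds the counter of the sum, and [S] bounds its partial sums. *)
pose X' X := X + vb n X.
pose S X := vb n X * vb b (X' X).
pose body := fun X => g (X' X) + (op_cost (S X + S X + vb b (X' X)) d k 1 + op_cost (vb n X + vb n X) d k 1).
pose cc := fun X => 9 * (d + vb n X + 2).
have pX' : pbound X' by apply: pb_add pb_id (pb_vb n).
have pvb' : pbound (fun X => vb b (X' X)) by apply: pb_comp (pb_vb b) pX'.
have pS : pbound S by apply: pb_mul (pb_vb n) pvb'.
have pcc : pbound cc.
  by apply: (pb_mul (pb_const 9)); apply: pb_add (pb_const 2); apply: pb_add (pb_const d) (pb_vb n).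
exists (fun X => f X + (op_cost (vb n X) d k 0 + (op_cost 0 d k 0 + (op_cost 0 d k 0 +
   ((vb n X * (body X + cc X) + cc X) + op_cost (S X) d k 0))))).
  apply: pb_add => //; apply: pb_add; first exact: pb_op_cost (pb_vb n).
  apply: pb_add; first exact: pb_const.
  apply: pb_add; first exact: pb_const.
  apply: pb_add; last exact: pb_op_cost.
  apply: pb_add => //; apply: pb_mul; first exact: pb_vb.
  apply: pb_add => //; apply: pb_add; first exact: pb_comp.
  apply: pb_add; first by apply: pb_op_cost; apply: pb_add => //; apply: pb_add.
  by apply: pb_op_cost; apply: pb_add; apply: pb_vb.
move=> O M r X sr /andP[wn wb] Mr mX rX.
have [M1 [t1 [e1 b1 E1 K1]]] := hf O M r X sr wn Mr mX rX.
set N := reval M r n in E1.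
have hN : N <= vb n X by apply: reval_le; rewrite ?sr.
have [|M2 [t2 [e2 b2 E2]]] := @exec_assign O lim (Cst d) (tmp_reg k) M1 (op_cost (vb n X) d k 0).
  rewrite /= E1 /op_cost; have := bits_le d; have := bits_le k; have := bits_le N; lia.
have [|M3 [t3 [e3 b3 E3]]] := @exec_assign O acc (Cst d) (Cst 0) M2 (op_cost 0 d k 0).
  rewrite /= /op_cost; have := bits_le d; have := bits_le 0; lia.
have [|M4 [t4 [e4 b4 E4]]] := @exec_assign O vr (Cst d) (Cst 0) M3 (op_cost 0 d k 0).
  rewrite /= /op_cost; have := bits_le d; have := bits_le 0; lia.
have K4 : keeps d k M M4.
  rewrite E4 E3 E2; apply: keeps_trans K1 _.
  apply: (@keeps_trans _ _ _ (update M1 lim d (eval M1 (tmp_reg k)))); first exact: keeps_reg.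
  by apply: (@keeps_trans _ _ _ (update (update M1 lim d (eval M1 (tmp_reg k))) acc d 0)); apply: keeps_reg.
pose s i := \sum_(j < i) reval M (val j :: r) b.
have hs i : i <= N -> s i <= S X.
  move=> iN; apply: (@leq_trans (\sum_(j < i) vb b (X' X))); last first.
    by rewrite sum_nat_const card_ord leq_mul2r (leq_trans iN hN) orbT.
  apply: leq_sum => j _; apply: reval_le; rewrite /= ?sr //.
    by move=> x y xu; apply: leq_trans (mX _ _ xu) (leq_addr _ _).
  apply/andP; split.
    by apply: leq_trans (ltnW (ltn_ord j)) (leq_trans iN (leq_trans hN (leq_addl _ _))).
  by apply: sub_all rX => y /leq_trans; apply; apply: leq_addr.
have [||||M5 [t5 [e5 b5 [K5 A5]]]] := @exec_count O (fun i M' => keeps d k M M' /\ M' acc d = s i) d N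
  (Then (comp d.+1 k b) (Then (Assign acc (Cst d) (Bin Add (loop_acc d) (tmp_reg k)))
            (Assign vr (Cst d) (Bin Add (loop_var d) (Cst 1))))) (body X) (fun=> [::]) M4.
- move=> i M5 iN [K5 A5] V5 L5.
  have aX : all (leq^~ (X' X)) (i :: r).
    rewrite /=; apply/andP; split.
      by apply: leq_trans (ltnW iN) (leq_trans hN (leq_addl _ _)).
    by apply: sub_all rX => y /leq_trans; apply; apply: leq_addr.
  have mX' : bounded M (X' X) by move=> x y xu; apply: leq_trans (mX _ _ xu) (leq_addr _ _).
  have [||||M6 [t6 [e6 b6 E6 K6]]] := hg O M5 (i :: r) (X' X) _ wb.
  + by rewrite /= sr.
  + move=> v; rewrite ltnS leq_eqVlt => /orP[/eqP ->|vd]; first by rewrite subnn.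
    by rewrite (keep_reg K5) ?Mr // ?inE ?eqxx // subSn.
  + by move=> x y xu; rewrite (keep_user K5) // mX'.
  + exact: aX.
  have Eb : reval M5 (i :: r) b = reval M (i :: r) b.
    by apply: reval_ext (keep_user K5); rewrite /= sr.
  rewrite Eb in E6; set v := reval M _ b in Eb E6.
  have hv : v <= vb b (X' X) by apply: reval_le; rewrite /= ?sr.
  have A6 : M6 acc d = s i by rewrite (keep_reg K6) // !inE eqxx !orbT.
  have V6 : M6 vr d = i by rewrite (keep_reg K6) // !inE eqxx !orbT.
  have L6 : M6 lim d = N by rewrite (keep_reg K6) // !inE eqxx !orbT.
  have si : s i.+1 = s i + v by rewrite /s big_ord_recr.
  have hsi := hs _ (ltnW iN); have hsi1 := hs _ iN.
  have [|M7 [t7 [e7 b7 E7]]] := @exec_assign O acc (Cst d) (Bin Add (loop_acc d) (tmp_reg k)) M6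
       (op_cost (S X + S X + vb b (X' X)) d k 1).
    rewrite /= A6 E6 -si /op_cost; have := bits_le d; have := bits_le k; have := bits_le v.
    by have := bits_le (s i); have := bits_le (s i.+1); lia.
  have V7 : M7 vr d = i by rewrite E7 updN.
  have [|M8 [t8 [e8 b8 E8]]] := @exec_assign O vr (Cst d) (Bin Add (loop_var d) (Cst 1)) M7
       (op_cost (vb n X + vb n X) d k 1).
    rewrite /= V7 /op_cost; have := bits_le d; have := bits_le i; have := bits_le (i + 1).
    by have := bits_le 1; lia.
  have K7 : keeps d k M6 M7 by rewrite E7; apply: keeps_reg.
  have K8 : keeps d k M7 M8 by rewrite E8; apply: keeps_reg.
  exists M8, (t6 + (t7 + t8)); split.
  + exact: (ExecThen e6 (ExecThen e7 e8)).
  + by rewrite !leq_add.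
  + split; last by rewrite E8 /= updN // E7 updE /= A6 E6 si.
    apply: keeps_trans K5 _; apply: keeps_trans (keeps_weak _ _ K6) _ => //.
    exact: keeps_trans K7 K8.
  + by rewrite E8 updE /= V7 addn1.
  + by rewrite E8 updN // E7 updN.
- by split=> //; rewrite E4 updN // E3 updE /s big_ord0.
- by rewrite E4 updE.
- by rewrite E4 updN // E3 updN // E2 updE /= E1.
have [|M6 [t6 [e6 b6 E6]]] := @exec_assign O tmp (Cst k) (loop_acc d) M5 (op_cost (S X) d k 0).
  rewrite /= A5 /op_cost; have := bits_le d; have := bits_le k; have := bits_le (s N).
  by have := hs _ (leqnn N); lia.
have eq0 : flatten [seq [::] | i <- iota 0 N] = [::] :> seq (seq nat * seq nat).
  by elim: (iota 0 N).
rewrite eq0 in e5.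
exists M6, (t1 + (t2 + (t3 + (t4 + (t5 + t6))))); split.
- exact: (ExecThen e1 (ExecThen e2 (ExecThen e3 (ExecThen e4 (ExecThen e5 e6))))).
- do 4!(apply: leq_add => //); apply: leq_add => //; apply: leq_trans b5 _.
  apply: leq_add; last by rewrite /cond_cost /cc; lia.
  by apply: leq_mul => //; rewrite leq_add2l /cond_cost /cc; lia.
- by rewrite E6 updE /= A5.
by rewrite E6; apply: keeps_trans K5 _; apply: keeps_tmp.
Qed.

Notation query := (seq nat * seq nat)%type.
Notation oracle := (seq nat -> seq nat -> bool).

Inductive prg :=
  | PSkip
  | PSet of nat & rex & rex
  | PSeq of prg & prg
  | PIf of rex & prg & prg
  | PFor of rex & prg
  | PQry of nat & nat & rex & nat & rex.

Fixpoint wfp (d : nat) (c : prg) : bool :=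
  match c with
  | PSkip => true
  | PSet x i e => [&& x < usr, wfe d i & wfe d e]
  | PSeq a b => wfp d a && wfp d b
  | PIf e a b => [&& wfe d e, wfp d a & wfp d b]
  | PFor n a => wfe d n && wfp d.+1 a
  | PQry r x k y l => [&& r < usr, x < usr, wfe d k, y < usr & wfe d l]
  end.

(** The last round is split off, so that invariants run forward from 0. *)
Fixpoint loop (F : nat -> memory -> memory * seq query) (n : nat) (m : memory) :=
  if n is n'.+1 then
    let a := loop F n' m in let b := F n' a.1 in (b.1, a.2 ++ b.2)
  else (m, [::]).

(* Values are stored modulo [B]: this is what bounds the cost of an arbitrary program. *)
Fixpoint run (O : oracle) (B : nat) (r : seq nat) (c : prg) (m : memory) : memory * seq query :=
  match c with
  | PSkip => (m, [::])
  | PSet x i e => (update m x (reval m r i) (reval m r e %% B), [::])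
  | PSeq a b => let u := run O B r a m in let v := run O B r b u.1 in (v.1, u.2 ++ v.2)
  | PIf e a b => if reval m r e != 0 then run O B r a m else run O B r b m
  | PFor n a => loop (fun j => run O B (j :: r) a) (reval m r n) m
  | PQry x y k z l =>
      let S := table_at m y (reval m r k) in let T := table_at m z (reval m r l) in
      (update m x 0 (O S T), [:: (S, T)])
  end.

Lemma loop_ind (F : nat -> memory -> memory * seq query) n m (I : nat -> memory -> Prop) (J : query -> Prop) :
  I 0 m -> (forall i m', i < n -> I i m' -> I i.+1 (F i m').1 /\ forall q, q \in (F i m').2 -> J q) ->
  I n (loop F n m).1 /\ forall q, q \in (loop F n m).2 -> J q.
Proof.
move=> I0 step; elim: n step => [|n IH] step; first by split.
have [|In Jn] := IH; first by move=> i m' /ltnW h; apply: step.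
have [In1 Jn1] := step n _ (ltnSn n) In.
by split=> //= q; rewrite mem_cat => /orP[/Jn|/Jn1].
Qed.

Lemma run_bounded O B c r m : 0 < B -> bounded m B -> bounded (run O B r c m).1 B.
Proof.
move=> B0; elim: c r m => [|x i e|a IHa b IHb|e a IHa b IHb|n a IHa|x y k z l] r m mB //=.
- move=> y j yu; rewrite /update; case: ifP => _; last exact: mB.
  by apply: ltnW; apply: ltn_pmod.
- by apply: IHb; apply: IHa.
- by case: ifP => _; [apply: IHa|apply: IHb].
- by elim: (reval m r n) => //= j IH; apply: IHa.
- move=> u j uu; rewrite /update; case: ifP => _; last exact: mB.
  by case: (O _ _).
Qed.

Fixpoint cc (d : nat) (c : prg) : cmd :=
  match c with
  | PSkip => Skip
  | PSet x i e => Then (comp d 0 i) (Then (comp d 1 e) (Assign x (tmp_reg 0) (Bin Mod (tmp_reg 1) (Get bnd (Cst 0)))))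
  | PSeq a b => Then (cc d a) (cc d b)
  | PIf e a b => Then (comp d 0 e) (If (tmp_reg 0) (cc d a) (cc d b))
  | PFor n a => Then (comp d 0 n) (Then (Assign lim (Cst d) (tmp_reg 0)) (Then (Assign vr (Cst d) (Cst 0))
      (While (Bin Lt (loop_var d) (loop_lim d)) (Then (cc d.+1 a) (Assign vr (Cst d) (Bin Add (loop_var d) (Cst 1)))))))
  | PQry r x k y l => Then (comp d 0 k) (Then (comp d 1 l) (Query r x (tmp_reg 0) y (tmp_reg 1)))
  end.

Record linked (d B : nat) (r : seq nat) (m M : memory) : Prop := Linked {
  link_user : same_user M m;
  link_bnd : M bnd 0 = B;
  link_var : forall v, v < d -> M vr v = nth 0 r (d - v.+1) }.

Lemma linked_keeps d k B r m M M' : linked d B r m M -> keeps d k M M' -> linked d B r m M'.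
Proof.
move=> [a b c] K; split.
- by move=> x xu i; rewrite (keep_user K) ?a.
- by rewrite (keep_bnd K).
- by move=> v vd; rewrite (keep_reg K) ?c // !inE eqxx.
Qed.

Lemma usr_neq x y : x < usr -> usr <= y -> (y != x) * (x != y).
Proof. by move=> a b; rewrite !neq_ltn (leq_trans a b) orbT. Qed.

Lemma linked_update d B r m M x i v : x < usr -> linked d B r m M ->
  linked d B r (update m x i v) (update M x i v).
Proof.
move=> xu [a b c]; split.
- by move=> y yu j; rewrite /update a.
- by rewrite updN // (usr_neq xu).
- by move=> w wd; rewrite updN ?c // (usr_neq xu).
Qed.

(** A body must also preserve the limits of the loops around it. [linked] does not mention them, and
    [keeps] is too strong because programs change user arrays. *)
Definition same_lim (d : nat) (M M' : memory) := forall v, v < d -> M' lim v = M lim v.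

Lemma same_lim_keeps d k M M' : keeps d k M M' -> same_lim d M M'.
Proof. by move=> K v vd; rewrite (keep_reg K) // !inE eqxx orbT. Qed.

Lemma same_lim_trans d M1 M2 M3 : same_lim d M1 M2 -> same_lim d M2 M3 -> same_lim d M1 M3.
Proof. by move=> a b v vd; rewrite b ?a. Qed.

Lemma same_lim_upd d M x i v : (x == lim) && (i < d) = false -> same_lim d M (update M x i v).
Proof.
move=> h w wd; rewrite /update; case: (lim =P x) => [ex|//]; case: (w =P i) => [ei|//].
by move: h; rewrite -ex -ei eqxx wd.
Qed.

Lemma table_cost_le m x k B : (forall i, m x i <= B) -> table_cost (table_at m x k) <= k ^ 2 * B.+1.
Proof.
move=> h; rewrite /table_cost /table_at big_map.
apply: (@leq_trans (\sum_(i <- iota 0 (k ^ 2)) B.+1)).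
  by apply: leq_sum => i _; apply: leq_trans (bits_le _) _; apply: h.
by rewrite big_const_seq count_predT size_iota iter_addn_0 mulnC.
Qed.

(** The clamp makes this true of every program: stored values never exceed [B], so expressions have
    polynomially bounded values and loops polynomially many rounds, however deeply nested. *)
Lemma cc_exec c : forall d, wfp d c -> exists2 f, pbound f & forall O B M m r X,
  0 < B -> B <= X -> size r = d -> linked d B r m M -> bounded m B -> all (leq^~ X) r ->
  exists M' t, [/\ exec O (cc d c) M M' t (run O B r c m).2, t <= f X,
    linked d B r (run O B r c m).1 M' & same_lim d M M'].
Proof.
have MX (M m : memory) d B r X : B <= X -> linked d B r m M -> bounded m B -> bounded M X.
  by move=> BX lk mB x i xu; rewrite (link_user lk) // (leq_trans (mB _ _ xu)).
have Ev (M m : memory) d B r e : size r = d -> linked d B r m M -> wfe d e -> reval M r e = reval m r e.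
  by move=> sr lk we; apply: reval_ext (link_user lk); rewrite sr.
elim: c => [|x i e|a IHa b IHb|e a IHa b IHb|n a IHa|x y k z l] d.
- move=> _; exists (fun=> 1) => [|O B M m r X B0 BX sr lk mB rX]; first exact: pb_const.
  by exists M, 1; split=> //; apply: ExecSkip.
- move=> /and3P[xu wi we]; have [f pf hf] := comp_exec i d 0; have [g pg hg] := comp_exec e d 1.
  exists (fun X => f X + (g X + op_cost (vb i X + vb e X + X) 0 0 0)).
    apply: pb_add => //; apply: pb_add => //; apply: pb_op_cost; apply: pb_add pb_id.
    by apply: pb_add; apply: pb_vb.
  move=> O B M m r X B0 BX sr lk mB rX.
  have [M1 [t1 [e1 b1 E1 K1]]] := hf O M r X sr wi (link_var lk) (MX _ _ _ _ _ _ BX lk mB) rX.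
  have lk1 := linked_keeps lk K1.
  have [M2 [t2 [e2 b2 E2 K2]]] := hg O M1 r X sr we (link_var lk1) (MX _ _ _ _ _ _ BX lk1 mB) rX.
  have lk2 := linked_keeps lk1 (keeps_weak (leqnn d) (leq0n 1) K2).
  rewrite (Ev _ _ _ _ _ _ sr lk wi) in E1; rewrite (Ev _ _ _ _ _ _ sr lk1 we) in E2.
  have E1' : M2 tmp 0 = reval m r i by rewrite (keep_tmp K2).
  have [|M3 [t3 [e3 b3 E3]]] := @exec_assign O x (tmp_reg 0) (Bin Mod (tmp_reg 1) (Get bnd (Cst 0))) M2
      (op_cost (vb i X + vb e X + X) 0 0 0).
    have hi : reval m r i <= vb i X.
      by rewrite -(Ev _ _ _ _ _ _ sr lk wi); apply: reval_le => //; [rewrite sr|apply: MX BX lk mB].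
    have he : reval m r e <= vb e X.
      by rewrite -(Ev _ _ _ _ _ _ sr lk we); apply: reval_le => //; [rewrite sr|apply: MX BX lk mB].
    rewrite /= E1' E2 (link_bnd lk2) /op_cost.
    have := ltn_pmod (reval m r e) B0.
    have := bits_le 0; have := bits_le 1; have := bits_le (reval m r i); have := bits_le (reval m r e).
    by have := bits_le B; have := bits_le (reval m r e %% B); lia.
  exists M3, (t1 + (t2 + t3)); split.
  + exact: (ExecThen e1 (ExecThen e2 e3)).
  + by rewrite !leq_add.
  + by rewrite E3 /= E1' E2 (link_bnd lk2); apply: linked_update.
  + apply: same_lim_trans (same_lim_keeps K1) _; apply: same_lim_trans (same_lim_keeps K2) _.
    by rewrite E3; apply: same_lim_upd; case: eqP xu => [->|].
- move=> /andP[/IHa[f pf hf] /IHb[g pg hg]]; exists (fun X => f X + g X); first exact: pb_add.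
  move=> O B M m r X B0 BX sr lk mB rX.
  have [M1 [t1 [e1 b1 l1 s1]]] := hf O B M m r X B0 BX sr lk mB rX.
  have [M2 [t2 [e2 b2 l2 s2]]] := hg O B M1 _ r X B0 BX sr l1 (run_bounded O a r B0 mB) rX.
  exists M2, (t1 + t2); split=> //=.
  + exact: ExecThen e1 e2.
  + exact: leq_add.
  + exact: same_lim_trans s1 s2.
- move=> /and3P[we /IHa[f pf hf] /IHb[g pg hg]]; have [h ph hh] := comp_exec e d 0.
  exists (fun X => h X + (op_cost (vb e X) 0 0 0 + (f X + g X))).
    by apply: pb_add => //; apply: pb_add; [apply: pb_op_cost (pb_vb e)|apply: pb_add].
  move=> O B M m r X B0 BX sr lk mB rX.
  have [M1 [t1 [e1 b1 E1 K1]]] := hh O M r X sr we (link_var lk) (MX _ _ _ _ _ _ BX lk mB) rX.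
  have lk1 := linked_keeps lk K1.
  rewrite (Ev _ _ _ _ _ _ sr lk we) in E1.
  have tc : ecost M1 (tmp_reg 0) <= op_cost (vb e X) 0 0 0.
    have he : reval m r e <= vb e X.
      by rewrite -(Ev _ _ _ _ _ _ sr lk we); apply: reval_le => //; [rewrite sr|apply: MX BX lk mB].
    by rewrite /= E1 /op_cost; have := bits_le 0; have := bits_le (reval m r e); lia.
  rewrite /=; case: ifP => [en0|/negbFE/eqP e0].
    have [M2 [t2 [e2 b2 l2 s2]]] := hf O B M1 _ r X B0 BX sr lk1 mB rX.
    exists M2, (t1 + (ecost M1 (tmp_reg 0) + t2)); split=> //.
    + by apply: (ExecThen e1); apply: ExecIfTrue e2; rewrite /= E1.
    + by rewrite leq_add // leq_add // (leq_trans b2) // leq_addr.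
    + exact: same_lim_trans (same_lim_keeps K1) s2.
  have [M2 [t2 [e2 b2 l2 s2]]] := hg O B M1 _ r X B0 BX sr lk1 mB rX.
  exists M2, (t1 + (ecost M1 (tmp_reg 0) + t2)); split=> //.
  + by apply: (ExecThen e1); apply: ExecIfFalse e2; rewrite /= E1.
  + by rewrite leq_add // leq_add // (leq_trans b2) // leq_addl.
  + exact: same_lim_trans (same_lim_keeps K1) s2.
- move=> /andP[wn /IHa[g pg hg]]; have [f pf hf] := comp_exec n d 0.
  pose X' X := X + vb n X.
  have pX' : pbound X' by apply: pb_add pb_id (pb_vb n).
  pose kk := fun X => 9 * (d + vb n X + 2).
  have pkk : pbound kk.
    by apply: (pb_mul (pb_const 9)); apply: pb_add (pb_const 2); apply: pb_add (pb_const d) (pb_vb n).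
  pose body := fun X => g (X' X) + op_cost (vb n X + vb n X) d 0 1.
  have pbody : pbound body.
    by apply: pb_add; [apply: pb_comp pg pX'|apply: pb_op_cost; apply: pb_add; apply: pb_vb].
  exists (fun X => f X + (op_cost (vb n X) d 0 0 + (op_cost 0 d 0 0 + (vb n X * (body X + kk X) + kk X)))).
    apply: pb_add => //; apply: pb_add; first exact: pb_op_cost (pb_vb n).
    apply: pb_add; first exact: pb_const.
    by apply: pb_add => //; apply: pb_mul (pb_vb n) _; apply: pb_add.
  move=> O B M m r X B0 BX sr lk mB rX.
  have [M1 [t1 [e1 b1 E1 K1]]] := hf O M r X sr wn (link_var lk) (MX _ _ _ _ _ _ BX lk mB) rX.
  have lk1 := linked_keeps lk K1.
  have hN : reval m r n <= vb n X.
    by rewrite -(Ev _ _ _ _ _ _ sr lk wn); apply: reval_le => //; [rewrite sr|apply: MX BX lk mB].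
  rewrite (Ev _ _ _ _ _ _ sr lk wn) in E1; rewrite /=; set N := reval m r n in E1 hN *.
  have [|M2 [t2 [e2 b2 E2]]] := @exec_assign O lim (Cst d) (tmp_reg 0) M1 (op_cost (vb n X) d 0 0).
    rewrite /= E1 /op_cost; have := bits_le d; have := bits_le 0; have := bits_le N; lia.
  have [|M3 [t3 [e3 b3 E3]]] := @exec_assign O vr (Cst d) (Cst 0) M2 (op_cost 0 d 0 0).
    rewrite /= /op_cost; have := bits_le d; have := bits_le 0; lia.
  have K3 : keeps d 0 M1 M3.
    rewrite E3 E2; apply: (@keeps_trans _ _ _ (update M1 lim d (eval M1 (tmp_reg 0)))); exact: keeps_reg.
  pose F j := run O B (j :: r) a.
  have bF i : bounded (loop F i m).1 B by elim: i => //= i IH; apply: run_bounded.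
  have [||||M4 [t4 [e4 b4 [l4 s4]]]] := @exec_count O
     (fun i M' => linked d B r (loop F i m).1 M' /\ same_lim d M1 M') d N
     (Then (cc d.+1 a) (Assign vr (Cst d) (Bin Add (loop_var d) (Cst 1)))) (body X)
     (fun i => (F i (loop F i m).1).2) M3.
  + move=> i M4 iN [l4 s4] V4 L4.
    have aX : all (leq^~ (X' X)) (i :: r).
      apply/andP; split.
        by apply: leq_trans (ltnW iN) (leq_trans hN (leq_addl _ _)).
      by apply: sub_all rX => y /leq_trans; apply; apply: leq_addr.
    have [|||M5 [t5 [e5 b5 l5 s5]]] := hg O B M4 (loop F i m).1 (i :: r) (X' X) B0 _ _ _ (bF i) aX.
    * exact: leq_trans BX (leq_addr _ _).
    * by rewrite /= sr.
    * case: l4 => u1 u2 u3; split=> // v; rewrite ltnS leq_eqVlt => /orP[/eqP ->|vd].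
        by rewrite subnn.
      by rewrite u3 // subSn.
    have V5 : M5 vr d = i by rewrite (link_var l5) // subnn.
    have [|M6 [t6 [e6 b6 E6]]] := @exec_assign O vr (Cst d) (Bin Add (loop_var d) (Cst 1)) M5
       (op_cost (vb n X + vb n X) d 0 1).
      rewrite /= V5 /op_cost; have := bits_le d; have := bits_le i; have := bits_le (i + 1).
      by have := bits_le 1; lia.
    exists M6, (t5 + t6); split.
    * by rewrite -[X in exec _ _ _ _ _ X]cats0; apply: ExecThen e5 e6.
    * exact: leq_add.
    * split; last first.
        apply: same_lim_trans s4 _ => v vd; rewrite E6 updN // s5 //; exact: ltnW.
      case: l5 => u1 u2 u3; rewrite E6; split=> //=.
        by move=> y yu j; rewrite updN ?u1 // (usr_neq yu).
      move=> v vd; rewrite /update /= (ltn_eqF vd) u3; last exact: ltnW.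
      by rewrite subSn.
    * by rewrite E6 updE /= V5 addn1.
    * by rewrite E6 updN // s5.
  + split; first exact: linked_keeps lk1 K3.
    exact: same_lim_keeps K3.
  + by rewrite E3 updE.
  + by rewrite E3 updN // E2 updE /= E1.
  have El : (loop F N m).2 = flatten [seq (F i (loop F i m).1).2 | i <- iota 0 N].
    elim: (N) => [//|j IH]; rewrite -[j.+1]addn1 iotaD map_cat flatten_cat /= cats0 add0n.
    by rewrite -IH addn1.
  exists M4, (t1 + (t2 + (t3 + t4))); split.
  + by rewrite El; apply: (ExecThen e1 (ExecThen e2 (ExecThen e3 e4))).
  + do 3!(apply: leq_add => //); apply: leq_trans b4 _.
    apply: leq_add; last by rewrite /cond_cost /kk; lia.
    by apply: leq_mul => //; rewrite leq_add2l /cond_cost /kk; lia.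
  + exact: l4.
  + exact: same_lim_trans (same_lim_keeps K1) s4.
move=> /and5P[xu yu wk zu wl]; have [f pf hf] := comp_exec k d 0; have [g pg hg] := comp_exec l d 1.
exists (fun X => f X + (g X + (op_cost (vb k X + vb l X) 0 0 0 + ((vb k X * vb k X + vb l X * vb l X) * (X + 1))))).
  apply: pb_add => //; apply: pb_add => //; apply: pb_add.
    by apply: pb_op_cost; apply: pb_add; apply: pb_vb.
  by apply: pb_mul; [apply: pb_add; apply: pb_mul; apply: pb_vb|apply: pb_add pb_id (pb_const 1)].
move=> O B M m r X B0 BX sr lk mB rX.
have [M1 [t1 [e1 b1 E1 K1]]] := hf O M r X sr wk (link_var lk) (MX _ _ _ _ _ _ BX lk mB) rX.
have lk1 := linked_keeps lk K1.
have [M2 [t2 [e2 b2 E2 K2]]] := hg O M1 r X sr wl (link_var lk1) (MX _ _ _ _ _ _ BX lk1 mB) rX.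
have lk2 := linked_keeps lk1 (keeps_weak (leqnn d) (leq0n 1) K2).
rewrite (Ev _ _ _ _ _ _ sr lk wk) in E1; rewrite (Ev _ _ _ _ _ _ sr lk1 wl) in E2.
have E1' : M2 tmp 0 = reval m r k by rewrite (keep_tmp K2).
have hk : reval m r k <= vb k X.
  by rewrite -(Ev _ _ _ _ _ _ sr lk wk); apply: reval_le => //; [rewrite sr|apply: MX BX lk mB].
have hl : reval m r l <= vb l X.
  by rewrite -(Ev _ _ _ _ _ _ sr lk wl); apply: reval_le => //; [rewrite sr|apply: MX BX lk mB].
have Ta u w : u < usr -> table_at M2 u w = table_at m u w.
  by move=> uu; apply: eq_map => i; rewrite (link_user lk2).
have := @ExecQuery O x y (tmp_reg 0) z (tmp_reg 1) M2; rewrite /= E1' E2 !Ta // => e3.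
set tq := (_ + _ + _ + _ + _) in e3.
exists (update M2 x 0 (O (table_at m y (reval m r k)) (table_at m z (reval m r l)))), (t1 + (t2 + tq)).
split.
- exact: (ExecThen e1 (ExecThen e2 e3)).
- apply: leq_add => //; apply: leq_add => //; rewrite /tq.
  have c1 := @table_cost_le m y (reval m r k) X (fun i => leq_trans (mB y i yu) BX).
  have c2 := @table_cost_le m z (reval m r l) X (fun i => leq_trans (mB z i zu) BX).
  have hk2 : reval m r k ^ 2 * X.+1 <= vb k X * vb k X * (X + 1).
    by rewrite addn1 leq_mul // -mulnn leq_mul.
  have hl2 : reval m r l ^ 2 * X.+1 <= vb l X * vb l X * (X + 1).
    by rewrite addn1 leq_mul // -mulnn leq_mul.
  rewrite /op_cost; have := bits_le 0; have := bits_le 1.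
  have := bits_le (reval m r k); have := bits_le (reval m r l); rewrite mulnDl; lia.
- exact: linked_update.
apply: same_lim_trans (same_lim_keeps K1) _; apply: same_lim_trans (same_lim_keeps K2) _.
by apply: same_lim_upd; case: eqP xu => [->|].
Qed.

(** Programs pick out an element by summing over all candidates an expression that vanishes except
    at the desired one. *)
Lemma sum_only n (F : nat -> nat) i : i < n ->
  (forall j, j < n -> j != i -> F j = 0) -> \sum_(j < n) F j = F i.
Proof.
move=> lt_in h; rewrite (bigD1 (Ordinal lt_in)) //= big1 ?addn0 // => j ji.
by apply: h.
Qed.

Lemma nth_cayley (gT : finGroupType) (s : seq gT) i j : i < size s -> j < size s ->
  nth 0 (cayley s) (i * size s + j) = index (nth 1%g s i * nth 1%g s j)%g s.
Proof.
move=> hi hj; rewrite /cayley; set n := size s in hj *.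
have hn : n = size s by [].
have main t : i < size t ->
  nth 0 [seq index (x * y)%g s | x <- t, y <- s] (i * n + j) = index (nth 1%g t i * nth 1%g s j)%g s.
  elim: t i {hi} => [|x t IH] [|i] //= hi.
    by rewrite mul0n add0n nth_cat size_map -hn hj (nth_map 1%g).
  by rewrite nth_cat size_map -hn mulSn -addnA ltnNge leq_addr /= addKn IH.
exact: main.
Qed.

Lemma size_cayley (gT : finGroupType) (s : seq gT) : size (cayley s) = size s ^ 2.
Proof. by rewrite size_allpairs mulnn. Qed.

Lemma cayley_table (gT : finGroupType) (s : seq gT) (m : memory) x :
  (forall i j, i < size s -> j < size s ->
     m x (i * size s + j) = index (nth 1%g s i * nth 1%g s j)%g s) ->
  table_at m x (size s) = cayley s.
Proof.
move=> h; apply: (@eq_from_nth _ 0); first by rewrite size_mkseq size_cayley.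
move=> i; rewrite size_mkseq => hi; rewrite nth_mkseq //.
have s0 : 0 < size s by move: hi; case: (size s) => //; rewrite exp0n.
rewrite (divn_eq i (size s)) h ?ltn_pmod // ?nth_cayley ?ltn_pmod // ltn_divLR // mulnn //.
Qed.

(** * Frame conditions and array-filling loops *)

Fixpoint reads (e : rex) : seq nat :=
  match e with
  | RCst _ | RVar _ => [::]
  | RGet x i => x :: reads i
  | RBin _ a b | RSum a b => reads a ++ reads b
  end.

Fixpoint writes (c : prg) : seq nat :=
  match c with
  | PSkip => [::]
  | PSet x _ _ => [:: x]
  | PSeq a b | PIf _ a b => writes a ++ writes b
  | PFor _ a => writes a
  | PQry r _ _ _ _ => [:: r]
  end.

Fixpoint quiet (c : prg) : bool :=
  match c with
  | PSeq a b | PIf _ a b => quiet a && quiet b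
  | PFor _ a => quiet a
  | PQry _ _ _ _ _ => false
  | _ => true
  end.

Lemma reval_reads e m m' r : (forall x, x \in reads e -> m x =1 m' x) ->
  reval m r e = reval m' r e.
Proof.
elim: e r => [n|v|x i IH|o a IHa b IHb|n IHn b IHb] r //= h.
- by rewrite (IH r) => [|y yi]; [rewrite h // inE eqxx|apply: h; rewrite inE yi orbT].
- by rewrite IHa ?IHb // => x hx; apply: h; rewrite mem_cat hx ?orbT.
- rewrite IHn => [|x hx]; last by apply: h; rewrite mem_cat hx.
  by apply: eq_bigr => j _; apply: IHb => x hx; apply: h; rewrite mem_cat hx orbT.
Qed.

Section Run.
Variables (O : oracle) (B : nat).

Lemma run_frame c r m x : x \notin writes c -> (run O B r c m).1 x =1 m x.
Proof.
elim: c r m => [|y i e|a IHa b IHb|e a IHa b IHb|n a IHa|y u k z l] r m //=.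
- by rewrite inE => h j; rewrite updN.
- by rewrite mem_cat negb_or => /andP[ha hb] j; rewrite IHb ?IHa.
- by rewrite mem_cat negb_or => /andP[ha hb] j; case: ifP => _; rewrite ?IHb ?IHa.
- by move=> ha; elim: (reval m r n) => //= i IH j; rewrite IHa ?IH.
- by rewrite inE => h j; rewrite updN.
Qed.

Lemma run_quiet c r m : quiet c -> (run O B r c m).2 = [::].
Proof.
elim: c r m => [|y i e|a IHa b IHb|e a IHa b IHb|n a IHa|y u k z l] r m //=.
- by move=> /andP[ha hb]; rewrite IHa ?IHb.
- by move=> /andP[ha hb]; case: ifP => _; rewrite ?IHb ?IHa.
- by move=> ha; elim: (reval m r n) => //= i ->; rewrite IHa.
Qed.

Lemma run_seq1 r a b m : (run O B r (PSeq a b) m).1 = (run O B r b (run O B r a m).1).1.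
Proof. by []. Qed.

Lemma run_seq2 r a b m : (run O B r (PSeq a b) m).2 = (run O B r a m).2 ++ (run O B r b (run O B r a m).1).2.
Proof. by []. Qed.

Lemma run_for (I : nat -> memory -> Prop) (J : query -> Prop) r n a m :
  I 0 m ->
  (forall i m', i < reval m r n -> I i m' ->
     I i.+1 (run O B (i :: r) a m').1 /\ forall q, q \in (run O B (i :: r) a m').2 -> J q) ->
  I (reval m r n) (run O B r (PFor n a) m).1 /\ forall q, q \in (run O B r (PFor n a) m).2 -> J q.
Proof. exact: loop_ind. Qed.

Lemma run_for1 (I : nat -> memory -> Prop) r n a m :
  I 0 m -> (forall i m', i < reval m r n -> I i m' -> I i.+1 (run O B (i :: r) a m').1) ->
  I (reval m r n) (run O B r (PFor n a) m).1.
Proof.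
move=> I0 step; have [] // := @loop_ind (fun j => run O B (j :: r) a) (reval m r n) m I (fun=> True) I0.
by move=> i m' hi hI; split=> //; apply: step.
Qed.

(** Since [e] does not read the array being filled, cells written earlier do not influence later
    ones. *)
Lemma run_fill r n x e m : x \notin reads e ->
  forall y j, (run O B r (PFor n (PSet x (RVar 0) e)) m).1 y j =
  if (y == x) && (j < reval m r n) then reval m (j :: r) e %% B else m y j.
Proof.
move=> xe; apply: (@run_for1 (fun k m' => forall y j, m' y j =
  if (y == x) && (j < k) then reval m (j :: r) e %% B else m y j)).
  by move=> y j; rewrite ltn0 andbF.
move=> i m' hi hI y j /=; rewrite /update.
have -> : reval m' (i :: r) e = reval m (i :: r) e.
  apply: reval_reads => z ze w; rewrite hI; case: (z =P x) => // zx.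
  by rewrite -zx ze in xe.
have [->|yx] := eqVneq y x; last by rewrite /= hI (negbTE yx).
have [->|ji] := eqVneq j i; first by rewrite ltnSn.
by rewrite /= hI eqxx /= ltnS (leq_eqVlt j i) (negbTE ji).
Qed.

(** [Me] is evaluated at three depths, as either limit and inside the index, so it may not depend on
    the two counters. *)
Lemma run_fill2 r x e Me m :
  x \notin reads e -> x \notin reads Me ->
  let M := reval m r Me in
  (forall j r', reval m (j :: r') Me = reval m r' Me) ->
  forall i j, i < M -> j < M ->
  (run O B r (PFor Me (PFor Me (PSet x (RBin Add (RBin Mul (RVar 1) Me) (RVar 0)) e))) m).1 x (i * M + j)
   = reval m (j :: i :: r) e %% B.
Proof.
move=> xe xM M Mc.
set I := fun k (m' : memory) => (forall y, y != x -> m' y =1 m y) /\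
  forall i j, i < k -> j < M -> m' x (i * M + j) = reval m (j :: i :: r) e %% B.
suff [] : I M (run O B r (PFor Me (PFor Me (PSet x (RBin Add (RBin Mul (RVar 1) Me) (RVar 0)) e))) m).1 by [].
have rd E m' r' : (forall y, y != x -> m' y =1 m y) -> x \notin reads E -> reval m' r' E = reval m r' E.
  by move=> hm xE; apply: reval_reads => z ze w; rewrite hm //; apply: contraNneq xE => <-.
apply: run_for1; first by split.
move=> i m1 iM [h1 h2].
set I2 := fun k (m' : memory) => (forall y, y != x -> m' y =1 m y) /\
  forall i' j, j < M -> (i' < i) || (i' == i) && (j < k) -> m' x (i' * M + j) = reval m (j :: i' :: r) e %% B.
have : I2 (reval m1 (i :: r) Me) (run O B (i :: r) (PFor Me (PSet x (RBin Add (RBin Mul (RVar 1) Me) (RVar 0)) e)) m1).1.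
  apply: run_for1; first by split=> // i' j jM; rewrite ltn0 andbF orbF => /h2 ->.
  move=> j m2; rewrite (rd _ _ _ h1 xM) Mc => jM [g1 g2].
  rewrite /= (rd _ _ _ g1 xM) !Mc (rd _ _ _ g1 xe) -/M; split=> [y yx w|i' j' jM' hij].
    by rewrite updN // g1.
  rewrite /update eqxx /=; case: eqP => [E|ne].
    have M0 : 0 < M by apply: leq_ltn_trans iM.
    have Ei : i' = i.
      have := congr1 (fun t => t %/ M) E; rewrite !divnMDl // !divn_small //; lia.
    by move: E; rewrite Ei => /addnI ->.
  apply: g2 => //; case/orP: hij => [->//|/andP[/eqP ei]].
  rewrite ltnS leq_eqVlt => /orP[/eqP ej|->]; last by rewrite ei eqxx orbT.
  by case: ne; rewrite ei ej.
rewrite (rd _ _ _ h1 xM) Mc => -[g1 g2]; split=> // i' j hi jM.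
by apply: g2 => //; rewrite jM andbT orbC -leq_eqVlt -ltnS.
Qed.

End Run.

(** * Digits *)

Section Digits.
Variable p : nat.
Hypothesis p_pr : prime p.
Let p_gt0 : 0 < p. Proof. exact: prime_gt0. Qed.
Let pX_gt0 n : 0 < p ^ n. Proof. by rewrite expn_gt0 p_gt0. Qed.

(* The digit of weight [p ^ j]: the quotient need not be reduced modulo [p],
   because the cast to ['F_p] does it. *)
Definition dg (j a : nat) : 'F_p := ((a %/ p ^ j)%:R)%R.

Lemma natFp_eq a b : (a%:R == b%:R :> 'F_p)%R = (a == b %[mod p]).
Proof.
rewrite -(Fp_nat_mod p_pr a) -(Fp_nat_mod p_pr b); apply/eqP/eqP => [|->] //.
by move/(congr1 (@nat_of_ord _)); rewrite !val_Fp_nat // !modn_mod.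
Qed.

Lemma dg_small j a : a < p ^ j -> dg j a = 0%R.
Proof. by move=> h; rewrite /dg divn_small. Qed.

(** In base [p], multiplication by [p ^ i] takes the place of multiplication of a polynomial by
    ['X^i]. *)
Lemma dg_mul_low i j Z : j < i -> dg j (Z * p ^ i) = 0%R.
Proof.
move=> ji; rewrite /dg -(subnK (ltnW ji)) expnD mulnA mulnK //.
have -> : p ^ (i - j) = p * p ^ (i - j).-1 by rewrite -expnS prednK // subn_gt0.
by rewrite mulnCA natrM pchar_Fp_0 // mul0r.
Qed.

Lemma dg_mul_high i j Z : i <= j -> dg j (Z * p ^ i) = dg (j - i) Z.
Proof. by move=> ij; rewrite /dg -{1}(subnK ij) expnD divnMr. Qed.

(** Writing [C] above the [d] low digits of [v] is the numerical form of [rVpoly y + 'X^d * c x]. *)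
Lemma dgD_low i d v C : i < d -> dg i (v %% p ^ d + p ^ d * C) = dg i v.
Proof.
move=> id; apply/eqP; rewrite natFp_eq.
have E : p ^ d = p ^ (d - i) * p ^ i by rewrite -expnD subnK // ltnW.
have Ep : p ^ (d - i) = p * p ^ (d - i).-1 by rewrite -expnS prednK // subn_gt0.
have key w D : (w + p ^ d * D) %/ p ^ i = (p ^ (d - i).-1 * D) * p + w %/ p ^ i.
  by rewrite addnC E mulnAC divnMDl // Ep -mulnA mulnC.
by rewrite [X in _ == X %/ _ %[mod _]](divn_eq v (p ^ d)) [X in _ == X %/ _ %[mod _]]addnC
  [(v %/ _) * _]mulnC !key !modnMDl.
Qed.

Lemma dgD_high i d v C : d <= i -> v < p ^ d -> dg i (v + p ^ d * C) = dg (i - d) C.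
Proof.
move=> di vd; rewrite /dg -{1}(subnKC di) expnD divnMA addnC mulnC divnMDl //.
by rewrite (divn_small vd) addn0.
Qed.

Lemma sum_digits_lt (e : nat -> nat) n : (forall j, e j < p) -> \sum_(i < n) p ^ i * e i < p ^ n.
Proof.
move=> ep; elim: n => [|n IH]; first by rewrite big_ord0.
rewrite big_ord_recr /= expnS.
have h : p ^ n * e n <= p ^ n * p.-1 by rewrite leq_mul2l -ltnS prednK // ep orbT.
have -> : p * p ^ n = p ^ n + p ^ n * p.-1 by rewrite -mulnS prednK // mulnC.
by rewrite -addSn leq_add.
Qed.

Lemma dg_sum (e : nat -> nat) n j : (forall j, e j < p) -> j < n ->
  dg j (\sum_(i < n) p ^ i * e i) = ((e j)%:R)%R.
Proof.
move=> ep jn; rewrite -(subnKC jn); elim: (n - j.+1) => [|k IH].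
  rewrite addn0 big_ord_recr /= dgD_high ?subnn ?sum_digits_lt //.
  by rewrite /dg expn0 divn1.
rewrite addnS big_ord_recr /=.
by rewrite -IH -[X in dg j (X + _)](@modn_small _ (p ^ (j.+1 + k))) ?dgD_low ?sum_digits_lt // leq_addr.
Qed.

Lemma dg_ext n a b : a < p ^ n -> b < p ^ n -> (forall j, j < n -> dg j a = dg j b) -> a = b.
Proof.
elim: n a b => [|n IH] a b; first by rewrite !ltnS !leqn0 => /eqP -> /eqP ->.
rewrite expnSr => ha hb h.
have /eqP := h 0 isT; rewrite /dg expn0 !divn1 natFp_eq => /eqP e0.
rewrite (divn_eq a p) (divn_eq b p) e0 (IH (a %/ p) (b %/ p)) ?ltn_divLR //.
by move=> j jn; have := h j.+1 jn; rewrite /dg !expnS !divnMA.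
Qed.

Definition numpoly (n a : nat) : {poly 'F_p} := (\poly_(j < n) dg j a)%R.

Lemma coef_numpoly n a j : a < p ^ n -> ((numpoly n a)`_j = dg j a)%R.
Proof.
move=> h; rewrite coef_poly; case: ltnP => // nj.
by rewrite dg_small // (leq_trans h) // leq_pexp2l.
Qed.

Lemma size_numpoly n a : size (numpoly n a) <= n.
Proof. exact: size_poly. Qed.

Lemma numpoly_inj n a b : a < p ^ n -> b < p ^ n -> numpoly n a = numpoly n b -> a = b.
Proof.
move=> ha hb e; apply: (@dg_ext n) => // j _.
by rewrite -(coef_numpoly j ha) -(coef_numpoly j hb) e.
Qed.

Lemma numpoly_surj n (P : {poly 'F_p}) : size P <= n -> exists2 a, a < p ^ n & numpoly n a = P.
Proof.
move=> sP; pose e j : nat := (P`_j)%R.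
have ep j : e j < p by rewrite -[X in _ < X](Fp_cast p_pr); apply: ltn_ord.
exists (\sum_(i < n) p ^ i * e i); first exact: sum_digits_lt.
apply/polyP => j; rewrite coef_numpoly ?sum_digits_lt //.
have [jn|nj] := ltnP j n; first by rewrite dg_sum // /e natr_Zp.
rewrite dg_small; first by rewrite nth_default // (leq_trans sP).
by apply: leq_trans (sum_digits_lt _ ep) _; rewrite leq_pexp2l.
Qed.

Lemma numpoly0 n : numpoly n 0 = 0%R.
Proof. by apply/polyP => j; rewrite coef_numpoly // /dg div0n coef0. Qed.

Lemma numpoly_top n a b : a < p ^ n -> b < p ->
  numpoly n.+1 (a + p ^ n * b) = (numpoly n a + (b%:R)%:P * 'X^n)%R.
Proof.
move=> ha hb; apply/polyP => j.
have h : a + p ^ n * b < p ^ n.+1.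
  rewrite expnSr; have : p ^ n * b.+1 <= p ^ n * p by rewrite leq_mul2l hb orbT.
  by rewrite mulnS; lia.
rewrite coef_numpoly // coefD coefCM coefXn coef_numpoly //.
case: (ltngtP j n) => [jn|nj|->].
- by rewrite mulr0 addr0 -[X in dg j (X + _)](modn_small ha) dgD_low.
- rewrite mulr0 addr0 !dg_small //; first by rewrite (leq_trans ha) // leq_pexp2l // ltnW.
  by rewrite (leq_trans h) // leq_pexp2l.
by rewrite mulr1 dgD_high // subnn /dg expn0 divn1 divn_small // add0r.
Qed.

End Digits.

(** * The programs *)

Declare Scope rex_scope.
Delimit Scope rex_scope with rex.
Bind Scope rex_scope with rex.
Notation "a + b" := (RBin Add a b) : rex_scope.
Notation "a - b" := (RBin Sub a b) : rex_scope.
Notation "a * b" := (RBin Mul a b) : rex_scope.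
Notation "a / b" := (RBin Div a b) : rex_scope.
Notation "a %% b" := (RBin Mod a b) : rex_scope.
Notation "a == b" := (RBin Eq a b) : rex_scope.
Notation "a < b" := (RBin Lt a b) : rex_scope.
Notation "x .{ i }" := (RGet x i) (at level 1, left associativity, format "x .{ i }") : rex_scope.
Notation K := RCst.
Notation X := RVar.
Notation cell x := (RGet x (RCst 0)).
Notation "a ;; b" := (PSeq a b) (at level 60, right associativity).
Notation "x |{ i } <- e" := (PSet x i%rex e%rex) (at level 55, i at level 54, e at level 54).

(** The divisor 1 is left out, so that for a power of a prime the result is the exponent. *)
Definition num_divisors (e : rex) : rex :=
  RSum (e + (K 1)) (((K 1) < (X 0)) * ((e %% (X 0)) == (K 0))).

(* Array 0 holds the order [N] and then the output, 1 and 2 the tables of [G] and [H], 6 the powers of [p];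
   cells 3, 4, 5 hold [N], [p], [l].  Arrays 11 and 21 hold the coordinates of [G] and [H] increased by 1
   (0 means that they are not known yet), 12 and 22 the identities, 13 and 23 the numbers [p ^ n].  Covectors
   are stored as base [p] numbers: 30 is the part of 11 below the current digit, 31 the pinned covector on
   [H], 32 a candidate for its extension, 33 the last successful candidate; 37 counts the successes. *)
Definition setup : prg :=
  3 |{ (K 0) } <- 0 .{ (K 0) } ;;
  4 |{ (K 0) } <- RSum ((cell 3) + (K 1)) ((X 0) * (((K 1) < (X 0)) * ((((cell 3) %% (X 0)) == (K 0)) *
     (RSum (X 0) (((K 1) < (X 0)) * (((cell 3) %% (X 0)) == (K 0))) == (K 0))))) ;;
  5 |{ (K 0) } <- num_divisors (cell 3) ;;
  6 |{ (K 0) } <- (K 1) ;;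
  PFor ((K 3) * (cell 5) + (K 40)) (6 |{ (X 0) + (K 1) } <- 6 .{ (X 0) } * (cell 4)).

(** Adjoins the element in cell 10 to the subgroup coded in [co], unless it is there already. Array
    8 holds the powers x^a of that element and array 7 the old codes; x^a z receives the code of z
    plus a times the step in cell 9. *)
Definition extend (T co e : nat) : prg :=
  PIf (co .{ (cell 10) } == (K 0))
   (8 |{ (K 0) } <- (cell e) ;;
    PFor (cell 4) (8 |{ (X 0) + (K 1) } <- T .{ 8 .{ (X 0) } * (cell 3) + (cell 10) }) ;;
    PFor (cell 3) (7 |{ (X 0) } <- co .{ (X 0) }) ;;
    PFor (cell 3) (co |{ (X 0) } <- RSum (cell 4) (RSum (cell 3) (((K 0) < 7 .{ (X 0) }) *
        ((T .{ 8 .{ (X 1) } * (cell 3) + (X 0) } == (X 2)) * (7 .{ (X 0) } + (X 1) * (cell 9)))))) ;;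
    9 |{ (K 0) } <- (cell 9) * (cell 4))
   PSkip.

(* Adjoining first all commutators with step [0] and then all elements with step [p ^ n] gives the
   coordinates modulo the derived subgroup. *)
Definition coordinates (T co e w : nat) : prg :=
  e |{ (K 0) } <- RSum (cell 3) ((X 0) * (T .{ (X 0) * (cell 3) + (X 0) } == (X 0))) ;;
  PFor (cell 3) (co |{ (X 0) } <- ((X 0) == (cell e))) ;;
  9 |{ (K 0) } <- (K 0) ;;
  PFor (cell 3) (PFor (cell 3)
    (10 |{ (K 0) } <- RSum (cell 3) ((X 0) *
        (T .{ T .{ (X 1) * (cell 3) + (X 2) } * (cell 3) + (X 0) } == T .{ (X 2) * (cell 3) + (X 1) })) ;;
     extend T co e)) ;;
  9 |{ (K 0) } <- (K 1) ;;
  PFor (cell 3) (10 |{ (K 0) } <- (X 0) ;; extend T co e) ;;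
  w |{ (K 0) } <- (cell 9).

(* The elements of the gadget are numbered in base [p], the element of the group being least significant.
   This is the digit [X 0] of the product of the elements [X 2] and [X 1] of the gadget, modulo [p]. *)
Definition gadget_digit (c : nat) : rex :=
  let dig a := (a / 6 .{ (X 0) })%rex in
  let q i := (((X 2) / (cell 3)) / 6 .{ (cell 5) + (K (9 + i)) })%rex in
  let z := (((((X 1) / (cell 3)) %% 6 .{ (cell 5) + (K 9) }) + 6 .{ (cell 5) + (K 9) } *
    c .{ (X 1) %% (cell 3) }) * 6 .{ (cell 5) + (K 12) })%rex in
  (dig ((X 2) / (cell 3)) + dig ((X 1) / (cell 3)) + q 0 * dig z + q 1 * dig (z * 6 .{ (K 1) }) +
   q 2 * (dig (z * 6 .{ (K 8) }) + dig (z * 6 .{ (K 6) }) + dig (z * 6 .{ (K 5) })))%rex.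

(** Each digit is reduced modulo [p] before the digits are assembled, so no carry passes from one
    coordinate to the next. *)
Definition gadget_cell (T c : nat) : rex :=
  T .{ ((X 1) %% (cell 3)) * (cell 3) + (X 0) %% (cell 3) } +
  (cell 3) * RSum (cell 42) (6 .{ (X 0) } * (gadget_digit c %% (cell 4))).

Definition gadget_table (T c out : nat) : prg :=
  PFor (cell 41) (PFor (cell 41) (out |{ (X 1) * (cell 41) + (X 0) } <- gadget_cell T c)).

Definition try_candidate : prg :=
  PFor (cell 3) (32 |{ (X 0) } <- 31 .{ (X 0) } + 6 .{ (cell 43) } *
     (RSum (cell 5) (((X 2) / 6 .{ (X 0) }) * ((21 .{ (X 1) } - (K 1)) / 6 .{ (X 0) })) %% (cell 4))) ;;
  gadget_table 2 32 35 ;;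
  PQry 36 34 (cell 41) 35 (cell 41) ;;
  PIf (cell 36) (37 |{ (cell 43) } <- 37 .{ (cell 43) } + (K 1) ;;
    PFor (cell 3) (33 |{ (X 0) } <- 32 .{ (X 0) })) PSkip.

(* The covector pinned on [H] is continued by array [fin]: the successful candidate (33) when searching,
   the coordinates of [G = H] themselves (30) when counting. *)
Definition pin_next (fin : nat) : prg :=
  43 |{ (K 0) } <- (X 0) ;;
  40 |{ (K 0) } <- (X 0) + (K 1) ;;
  42 |{ (K 0) } <- (K 2) * (cell 5) + (cell 40) + (K 29) ;;
  41 |{ (K 0) } <- (cell 3) * 6 .{ (cell 42) } ;;
  PFor (cell 3) (30 |{ (X 0) } <- (11 .{ (X 0) } - (K 1)) %% 6 .{ (cell 40) }) ;;
  gadget_table 1 30 34 ;;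
  37 |{ (X 0) } <- (K 0) ;;
  PFor (cell 23) try_candidate ;;
  PFor (cell 3) (31 |{ (X 0) } <- fin .{ (X 0) }).

Definition pin_all (fin : nat) : prg :=
  14 |{ (K 0) } <- num_divisors (cell 13) ;;
  PFor (cell 3) (31 |{ (X 0) } <- (K 0)) ;;
  PFor (cell 3) (33 |{ (X 0) } <- (K 0)) ;;
  PFor (cell 14) (pin_next fin).

(* The least elements 38 and 39 with unit coordinates correspond to each other, and the map 24 is closed
   under right multiplication by them in [N] rounds. *)
Definition extend_map : prg :=
  PFor (cell 14) (38 |{ (X 0) } <- RSum (cell 3) ((X 0) * ((11 .{ (X 0) } == 6 .{ (X 1) } + (K 1)) *
      (RSum (X 0) (11 .{ (X 0) } == 6 .{ (X 2) } + (K 1)) == (K 0))))) ;;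
  PFor (cell 14) (39 |{ (X 0) } <- RSum (cell 3) ((X 0) * ((31 .{ (X 0) } == 6 .{ (X 1) }) *
      (RSum (X 0) (31 .{ (X 0) } == 6 .{ (X 2) }) == (K 0))))) ;;
  PFor (cell 3) (24 |{ (X 0) } <- (K 0)) ;;
  24 |{ (cell 12) } <- (cell 22) + (K 1) ;;
  PFor (cell 3) (PFor (cell 3) (PFor (cell 14) (PIf 24 .{ (X 1) }
     (24 |{ 1 .{ (X 1) * (cell 3) + 38 .{ (X 0) } } } <- (K 1) + 2 .{ (24 .{ (X 1) } - (K 1)) * (cell 3) + 39 .{ (X 0) } })
     PSkip))) ;;
  PFor (cell 3) (0 |{ (X 0) } <- 24 .{ (X 0) } - (K 1)).

Definition search_prg : prg :=
  setup ;; coordinates 1 11 12 13 ;; coordinates 2 21 22 23 ;; pin_all 33 ;; extend_map.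

(** The table of G is copied in order to reuse the pinning code with H = G. The order of the derived
    subgroup is multiplied into each of the n counts separately, which keeps all stored numbers
    below the clamp. *)
Definition count_prg : prg :=
  (setup ;; PFor ((cell 3) * (cell 3)) (2 |{ (X 0) } <- 1 .{ (X 0) })) ;;
  coordinates 1 11 12 13 ;; coordinates 2 21 22 23 ;; pin_all 30 ;;
  PFor (cell 14) (37 |{ (X 0) } <- 37 .{ (X 0) } * ((cell 3) / (cell 13))).

Lemma wf_search : wfp 0 search_prg. Proof. by []. Qed.
Lemma wf_count : wfp 0 count_prg. Proof. by []. Qed.

(** * Correctness of the programs *)

Lemma count_divisors p n : prime p ->
  \sum_(j < (p ^ n).+1) ((1 < j) * (p ^ n %% j == 0) : nat) = n.
Proof.
move=> p_pr; have p1 := prime_gt1 p_pr.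
pose h (i : 'I_n) : 'I_(p ^ n).+1 := inord (p ^ i.+1).
have hE i : h i = p ^ i.+1 :> nat by rewrite inordK // ltnS leq_pexp2l ?prime_gt0.
have h_inj : injective h.
  by move=> i j /(congr1 val); rewrite /= !hE => /eqP; rewrite eqn_exp2l // => /eqP [] /val_inj.
transitivity (\sum_(j in h @: [set: 'I_n]) 1); last first.
  by rewrite sum1_card card_imset // cardsT card_ord.
rewrite [RHS]big_mkcond /=; apply: eq_bigr => j _; rewrite -[p ^ n %% j == 0]/(j %| p ^ n).
case: imsetP => [[i _ ->]|nim].
  by rewrite hE dvdn_exp2l // -{1}(expn0 p) ltn_exp2l.
case: (ltnP 1 j) => // j1; rewrite mul1n; apply/eqP; rewrite eqb0; apply/negP.
move=> /(dvdn_pfactor _ _ p_pr)[k kn jk]; apply: nim.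
case: k kn jk => [|k] kn jk; first by rewrite jk expn0 in j1.
by exists (Ordinal kn); rewrite ?inE //; apply: val_inj; rewrite /= hE.
Qed.

(** All divisors above 1 are powers of [p], and the inner sum, which counts the smaller ones,
    vanishes for [p] alone. *)
Lemma least_divisor p l : prime p -> 0 < l ->
  \sum_(i < (p ^ l).+1) (i * ((1 < i) * ((p ^ l %% i == 0) *
    (\sum_(j < i) ((1 < j) * (p ^ l %% j == 0) : nat) == 0)))) = p.
Proof.
move=> p_pr l0; have p1 := prime_gt1 p_pr.
have dv j : 1 < j -> p ^ l %% j = 0 -> exists k, j = p ^ k.+1.
  move=> j1 /eqP; rewrite -[_ == 0]/(j %| p ^ l) => /(dvdn_pfactor _ _ p_pr)[[|k] _ jk]; last by exists k.
  by rewrite jk expn0 in j1.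
have pl : p <= p ^ l by rewrite -{1}(expn1 p) leq_exp2l.
rewrite (@sum_only _ (fun i => i * ((1 < i) * ((p ^ l %% i == 0) *
    (\sum_(j < i) ((1 < j) * (p ^ l %% j == 0) : nat) == 0)))) p) //.
  rewrite p1 -[p ^ l %% p == 0]/(p %| p ^ l) dvdn_exp // big1 ?eqxx ?muln1 // => j _.
  case: (ltnP 1 j) => // j1; case: eqP => // /(dv _ j1)[k jk].
  by have := ltn_ord j; rewrite jk -{2}(expn1 p) ltn_exp2l.
move=> i _ ip; case: (ltnP 1 i) => [i1|]; last by rewrite mul0n muln0.
case: eqP => [/(dv _ i1)[k ik]|]; last by rewrite mul0n !muln0.
case: eqP => [h|]; last by rewrite !muln0.
have pi : p < i.
  rewrite ik -{1}(expn1 p) ltn_exp2l // ltnS lt0n; apply: contraNneq ip => k0.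
  by rewrite ik k0 expn1.
have /eqP := h; rewrite (bigD1 (Ordinal pi)) //= p1 mul1n.
by rewrite -[p ^ l %% p == 0]/(p %| p ^ l) dvdn_exp.
Qed.

(** A gadget has at most [3 * l + 29] coordinates over ['F_p], so this range of powers covers all
    exponents that the programs use. *)
Record base (N p l : nat) (m : memory) : Prop := Base {
  baseN : m 3 0 = N;
  baseP : m 4 0 = p;
  baseL : m 5 0 = l;
  basePow : forall j, j <= 3 * l + 40 -> m 6 j = p ^ j }.

Lemma base_ext N p l m m' : base N p l m -> (forall x, x \in [:: 3; 4; 5; 6] -> m' x =1 m x) ->
  base N p l m'.
Proof.
by move=> [a b c d] h; split; rewrite ?h ?inE // => j jl; rewrite h ?inE // d.
Qed.

Section Setup.
Variables (O : oracle) (N p l : nat).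
Hypotheses (p_pr : prime p) (l_gt0 : 0 < l) (N_eq : N = p ^ l).
Notation B := (N ^ 50).

(** [B = p ^ (50 * l)], and [3 * l + 40 < 50 * l] because [l] is positive. *)
Lemma expp_lt_B j : j <= 3 * l + 40 -> p ^ j < B.
Proof.
by move=> h; rewrite N_eq -expnM ltn_exp2l ?prime_gt1 //; lia.
Qed.

Lemma N_gt1 : 1 < N. Proof. by rewrite N_eq -(expn0 p) ltn_exp2l ?prime_gt1. Qed.
Lemma N_lt_B : N < B. Proof. by rewrite -{1}(expn1 N) ltn_exp2l ?N_gt1. Qed.
Lemma p_le_N : p <= N. Proof. by rewrite N_eq -{1}(expn1 p) leq_exp2l ?prime_gt1. Qed.
Lemma l_lt_N : l < N. Proof. by rewrite N_eq ltn_expl ?prime_gt1. Qed.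

Lemma setup_ok m : m 0 0 = N -> base N p l (run O B [::] setup m).1.
Proof.
move=> m0; rewrite /setup.
set a1 := PSet 3 _ _; set a2 := PSet 4 _ _; set a3 := PSet 5 _ _; set a4 := PSet 6 _ _; set a5 := PFor _ _.
set m1 := (run O B [::] a1 m).1.
have h1 : m1 3 0 = N by rewrite /m1 /= m0 modn_small ?N_lt_B.
set m2 := (run O B [::] a2 m1).1.
have h2 : m2 4 0 = p.
  rewrite /m2 /= h1 /update /= addn1 N_eq (least_divisor p_pr l_gt0) -N_eq modn_small //.
  exact: leq_ltn_trans p_le_N N_lt_B.
have h2' x : x != 4 -> m2 x =1 m1 x by move=> hx j; apply: run_frame; rewrite inE.
set m3 := (run O B [::] a3 m2).1.
have h3 : m3 5 0 = l.
  rewrite /m3 /= h2' // h1 /update /= addn1 N_eq (count_divisors _ p_pr) -N_eq modn_small //.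
  exact: ltn_trans l_lt_N N_lt_B.
have h3' x : x != 5 -> m3 x =1 m2 x by move=> hx j; apply: run_frame; rewrite inE.
set m4 := (run O B [::] a4 m3).1.
have h4 : m4 6 0 = 1 by rewrite /m4 /= /update /= modn_small // (ltn_trans N_gt1 N_lt_B).
have h4' x : x != 6 -> m4 x =1 m3 x by move=> hx j; apply: run_frame; rewrite inE.
have e4 : m4 4 0 = p by rewrite h4' // h3'.
have e5 : m4 5 0 = l by rewrite h4'.
have e3 : m4 3 0 = N by rewrite h4' // h3' // h2'.
have -> : (run O B [::] (a1 ;; a2 ;; a3 ;; a4 ;; a5) m).1 = (run O B [::] a5 m4).1 by [].
have fr x : x != 6 -> (run O B [::] a5 m4).1 x =1 m4 x.
  by move=> hx j; apply: run_frame; rewrite inE.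
split; rewrite ?fr //.
pose I k (m' : memory) := m' 4 0 = p /\ forall j, j <= k -> m' 6 j = p ^ j.
have : I (reval m4 [::] (RBin Add (RBin Mul (K 3) (cell 5)) (K 40))) (run O B [::] a5 m4).1.
  apply: run_for1; first by split=> // j; rewrite leqn0 => /eqP ->.
  move=> i m'; rewrite /= e5 => hi [p' hI]; split; first by rewrite /update.
  move=> j; rewrite leq_eqVlt ltnS /update /= addn1 p' hI //.
  case: (j =P i.+1) => [-> _|_ /= /hI //].
  by rewrite -expnSr modn_small // expp_lt_B.
by rewrite /= e5 => -[].
Qed.

End Setup.

(** * Adjoining an element of order p to a subgroup that it normalises *)

Section PrimeStep.
Variables (gT : finGroupType) (p : nat) (S : {group gT}) (x : gT).
Hypotheses (p_pr : prime p) (xp : (x ^+ p = 1)%g) (xS : x \notin S) (xN : x \in 'N(S)%g).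

Lemma mem_expg_coprime k : ~~ (p %| k) -> (x ^+ k)%g \in S -> x \in S.
Proof.
move=> pk hk; have k0 : 0 < k by rewrite lt0n; apply: contraNneq pk => ->; rewrite dvdn0.
case: (egcdnP p k0) => a b; rewrite gcdnC (eqnP (_ : coprime p k)) ?prime_coprime // => e _.
have : (x ^+ (a * k))%g \in S by rewrite mulnC expgM groupX.
by rewrite e expgD mulnC expgM xp expg1n mul1g.
Qed.

(** Two different exponents would put [x ^+ (b - a)], whose exponent is prime to [p], into [S], and
    hence [x] itself. *)
Lemma prime_step_unique a b y : a < p -> b < p ->
  (x ^- a * y)%g \in S -> (x ^- b * y)%g \in S -> a = b.
Proof.
wlog ab : a b / a <= b => [h ap bp ha hb|].
  by case: (leqP a b) => [/h|/ltnW /h e]; [apply|symmetry; apply: e].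
move=> ap bp ha hb; apply/eqP; rewrite eqn_leq ab /= leqNgt; apply/negP => lt.
case/negP: xS; apply: (@mem_expg_coprime (b - a)).
  by apply/negP => /dvdn_leq; rewrite subn_gt0 lt => /(_ isT); lia.
have -> : (x ^+ (b - a) = (x ^- a * y) * (x ^- b * y)^-1)%g.
  by rewrite invMg invgK mulgA mulgK -{2}(subnKC ab) expgD mulKg.
by rewrite groupM ?groupV.
Qed.

Lemma mem_prime_step y : reflect (exists2 a, a < p & (x ^- a * y)%g \in S) (y \in (S <*> <[x]>)%g).
Proof.
have E : (S <*> <[x]> = <[x]> * S)%g.
  by rewrite norm_joinEr ?cycle_subG // normC // cycle_subG.
rewrite E; apply: (iffP idP) => [/mulsgP[_ z /cycleP[i ->] zS ->]|[a ap h]].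
  exists (i %% p); first by rewrite ltn_pmod ?prime_gt0.
  by rewrite expg_mod // mulKg.
by apply/mulsgP; exists (x ^+ a)%g (x ^- a * y)%g; rewrite ?mem_cycle // mulKVg.
Qed.

Lemma card_prime_step : #|(S <*> <[x]>)%g| = p * #|S|.
Proof.
have ox : #[x]%g = p.
  have : #[x]%g %| p by rewrite order_dvdn xp eqxx.
  case/primeP: p_pr => _ h /h/orP[/eqP e1|/eqP //].
  by case/negP: xS; move/eqP: e1; rewrite order_eq1 => /eqP ->; apply: group1.
rewrite norm_joinEr ?cycle_subG // mulnC -[p in RHS]ox.
apply: TI_cardMg; apply/trivgP/subsetP => z; rewrite inE => /andP[zS /cycleP[i zi]].
have [pi|npi] := boolP (p %| i).
  by case/dvdnP: pi => k ki; rewrite zi ki mulnC expgM xp expg1n inE.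
by case/negP: xS; apply: (mem_expg_coprime npi); rewrite -zi.
Qed.

End PrimeStep.

(** * Numbered elements and the program that enlarges a subgroup *)

Section Numbered.
Variables (gT : finGroupType) (s : seq gT).
Hypothesis s_num : numbering s.
Notation N := #|gT|.

Definition ix (x : gT) := index x s.
Definition el (i : nat) : gT := nth 1%g s i.

Lemma size_num : size s = N.
Proof. by case: s_num => u e; rewrite -cardsT -(eq_card e); apply/esym/card_uniqP. Qed.

Lemma mem_num x : x \in s. Proof. by case: s_num => _ ->; rewrite inE. Qed.
Lemma ix_lt x : ix x < N. Proof. by rewrite -size_num index_mem mem_num. Qed.
Lemma elK x : el (ix x) = x. Proof. by rewrite /el nth_index ?mem_num. Qed.
Lemma ixK i : i < N -> ix (el i) = i.
Proof. by move=> h; rewrite /ix /el index_uniq ?size_num //; case: s_num. Qed.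
Lemma ix_inj : injective ix. Proof. exact: can_inj elK. Qed.

Definition tabl (m : memory) (a : nat) := forall x y, m a (ix x * N + ix y) = ix (x * y)%g.

Lemma tabl_ext m m' a : tabl m a -> m' a =1 m a -> tabl m' a.
Proof. by move=> h e x y; rewrite e. Qed.

Definition coded (m : memory) (co : nat) (S : {set gT}) (C : gT -> nat) :=
  forall y, m co (ix y) = if y \in S then (C y).+1 else 0.

Lemma sum_el (F : nat -> nat) x : (forall y, y != x -> F (ix y) = 0) ->
  \sum_(j < N) F j = F (ix x).
Proof.
move=> h; apply: sum_only; first exact: ix_lt.
move=> j jN jx; rewrite -(ixK jN); apply: h; apply: contraNneq jx => <-.
by rewrite ixK.
Qed.

Variables (O : oracle) (p l : nat).
Hypotheses (p_pr : prime p) (l_gt0 : 0 < l) (N_eq : N = p ^ l).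
Hypothesis expp : forall x : gT, (x ^+ p = 1)%g.
Notation B := (N ^ 50).
Let NB : N < B. Proof. exact: N_lt_B p_pr l_gt0 N_eq. Qed.

Lemma ix_small x : ix x %% B = ix x.
Proof. by rewrite modn_small // (ltn_trans (ix_lt x) NB). Qed.

Section Extend.
Variables (T co e : nat) (r : seq nat) (m : memory) (S : {group gT}) (C : gT -> nat) (x : gT) (W : nat).
Hypotheses (T3 : T < 3) (co10 : 10 < co < 30) (e10 : 10 < e < 30) (coe : co != e).
Hypotheses (m_base : base N p l m) (m_T : tabl m T) (m_e : m e 0 = ix 1%g) (m_x : m 10 0 = ix x)
  (m_W : m 9 0 = W) (m_co : coded m co S C).
Hypotheses (xN : x \in 'N(S)%g) (C_small : forall y, y \in S -> (C y + p * W).+1 < B) (W_small : W * p < B).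

Lemma extend_ok : let m' := (run O B r (extend T co e) m).1 in
  if x \in S then coded m' co S C /\ m' 9 0 = W
  else (forall a z, a < p -> z \in S -> m' co (ix (x ^+ a * z)%g) = (C z + a * W).+1) /\
       (forall y, y \notin (S <*> <[x]>)%g -> m' co (ix y) = 0) /\ m' 9 0 = W * p.
Proof.
rewrite /extend; set b1 := PSet 8 _ _; set b2 := PFor _ (PSet 8 _ _); set b3 := PFor _ (PSet 7 _ _).
set b4 := PFor _ (PSet co _ _); set b5 := PSet 9 _ _; cbv zeta.
have -> : run O B r (PIf (RBin Eq (RGet co (cell 10)) (K 0)) (b1 ;; b2 ;; b3 ;; b4 ;; b5) PSkip) m =
  if x \in S then (m, [::]) else run O B r (b1 ;; b2 ;; b3 ;; b4 ;; b5) m.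
  by rewrite /= m_x m_co; case: (x \in S).
case: (boolP (x \in S)) => [xS //|xS].
pose m1 := (run O B r b1 m).1; pose m2 := (run O B r b2 m1).1; pose m3 := (run O B r b3 m2).1.
pose m4 := (run O B r b4 m3).1.
have -> : (run O B r (b1 ;; b2 ;; b3 ;; b4 ;; b5) m).1 = (run O B r b5 m4).1 by [].
have [mN mP mL _] := m_base.
have f1 y : y != 8 -> m1 y =1 m y by move=> h j; apply: run_frame; rewrite inE.
have h1 : m1 8 0 = ix 1%g by rewrite /m1 /= updE m_e ix_small.
have [f2 h2] : (forall y, y != 8 -> m2 y =1 m y) /\ forall a, a <= p -> m2 8 a = ix (x ^+ a)%g.
  pose I k (m' : memory) := (forall y, y != 8 -> m' y =1 m y) /\
     forall a, a <= k -> m' 8 a = ix (x ^+ a)%g.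
  suff : I (reval m1 r (cell 4)) m2 by rewrite /= f1 // mP.
  apply: run_for1; first by split=> // a; rewrite leqn0 => /eqP ->.
  move=> i m'; rewrite [reval _ _ _]/= f1 // mP => ip [g1 g2]; split=> [y y8 j|a].
    by rewrite [in LHS]/= updN // g1.
  rewrite leq_eqVlt ltnS [run _ _ _ _ _]/= /update /= addn1.
  case: (a =P i.+1) => [-> _|_ /= /g2 //].
  have T8 : T != 8 by lia.
  by rewrite g2 // !g1 // mN m_x m_T ix_small expgSr.
have h3 y : m3 7 (ix y) = if y \in S then (C y).+1 else 0.
  rewrite /m3 run_fill; last by rewrite !inE; lia.
  rewrite /= f2 // mN ix_lt f2 ?m_co; last by lia.
  case: ifP => yS; last by rewrite mod0n.
  rewrite modn_small //.
  by apply: leq_ltn_trans (C_small yS); rewrite ltnS leq_addr.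
have f3 y : y != 7 -> y != 8 -> m3 y =1 m y.
  by move=> h h' j; rewrite /m3 run_frame ?f2 // inE.
have h8 a : a <= p -> m3 8 a = ix (x ^+ a)%g.
  by move=> ap; rewrite /m3 run_frame ?h2 // inE.
(* In the sum over all elements only [x ^- a * y] can contribute, and it does if it lies in [S]. By
   uniqueness of the decomposition at most one [a] then survives in the outer sum. *)
have inner y a : a < p ->
    \sum_(z < N) ((0 < m3 7 z) * ((m3 T (m3 8 a * N + z) == ix y) * (m3 7 z + a * W))) =
    if (x ^- a * y)%g \in S then (C (x ^- a * y)%g + a * W).+1 else 0.
  move=> ap; pose F z := (0 < m3 7 z) * ((m3 T (m3 8 a * N + z) == ix y) * (m3 7 z + a * W)).
  have Fz z : F (ix z) = if (z \in S) && (x ^+ a * z == y)%g then (C z + a * W).+1 else 0.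
    have [T7 T8] : T != 7 /\ T != 8 by lia.
    rewrite /F h3 (h8 _ (ltnW ap)) f3 // m_T.
    by rewrite (inj_eq ix_inj); case: (z \in S); case: (_ == y); rewrite /= ?mul1n ?muln0.
  rewrite (@sum_el F (x ^- a * y)%g) ?Fz ?mulKVg ?eqxx ?andbT //.
  move=> z zy; rewrite Fz; case: eqP => [e'|_]; last by rewrite andbF.
  by case/eqP: zy; rewrite -e' mulKg.
have outer y : m4 co (ix y) = (\sum_(a < p) if (x ^- a * y)%g \in S then (C (x ^- a * y)%g + a * W).+1 else 0) %% B.
  rewrite /m4 run_fill; last by rewrite !inE; lia.
  rewrite eqxx /= f3 // mN ix_lt f3 // mP; congr (_ %% _); apply: eq_bigr => a _.
  by rewrite -inner //; apply: eq_bigr => z _ /=; rewrite (f3 9) // m_W.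
have c9 : co != 9 by lia.
split=> [a z ap zS|].
  rewrite /b5 /= updN // outer.
  rewrite (@sum_only _ (fun a' => if (x ^- a' * (x ^+ a * z))%g \in S then
     (C (x ^- a' * (x ^+ a * z))%g + a' * W).+1 else 0) a) //; last first.
    move=> a' ap' aa; case: ifP => // h; case/eqP: aa.
    by apply: (prime_step_unique p_pr (expp x) xS xN ap' ap h); rewrite mulKg.
  rewrite mulKg zS modn_small //; apply: leq_ltn_trans (C_small zS).
  by rewrite ltnS leq_add2l leq_mul2r (ltnW ap) orbT.
split=> [y yS|]; last first.
  rewrite /b5 /= updE /m4 !run_frame ?inE //; try by lia.
  by rewrite f3 // f3 // m_W mP modn_small.
rewrite /b5 /= updN // outer big1 ?mod0n // => a _.
case: ifP => // h; case/negP: yS.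
by apply/(mem_prime_step p_pr (expp x) xN); exists a.
Qed.

End Extend.
End Numbered.

(** Read through [numpoly], [C] is a homomorphism from [S] onto the polynomials of size at most [n]
    with the derived subgroup as kernel, that is, a coordinate system on the quotient. *)
Record coord (gT : finGroupType) (p : nat) (S : {set gT}) (n : nat) (C : gT -> nat) : Prop := Coord {
  coord_card : p ^ n * #|[set: gT]^`(1)%g| = #|S|;
  coord_lt : forall y, y \in S -> C y < p ^ n;
  coordM : forall y z, y \in S -> z \in S ->
    (numpoly p n (C (y * z)%g) = numpoly p n (C y) + numpoly p n (C z))%R;
  coord_ker : forall y, y \in S -> (C y == 0) = (y \in [set: gT]^`(1)%g);
  coord_surj : forall v, v < p ^ n -> exists2 y, y \in S & C y = v }.

Lemma coord_der (gT : finGroupType) p : coord p [set: gT]^`(1)%g 0 (fun=> 0).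
Proof.
split=> [|||y ->|[|v]] //=; first by rewrite expn0 mul1n.
  by move=> y z _ _; apply/polyP => j; rewrite coefD !coef_poly /= addr0.
by move=> _; exists 1%g; rewrite ?group1.
Qed.

(** Adjoining [x] adds one digit on top. For products, x^a z x^b z' is x^(a+b) z [z, x^b] z', and
    the commutator has coordinate 0. *)
Lemma coord_step (gT : finGroupType) p (S : {group gT}) n C C' x :
  prime p -> (x ^+ p = 1)%g -> coord p S n C -> [set: gT]^`(1)%g \subset S -> x \notin S ->
  (forall a z, a < p -> z \in S -> C' (x ^+ a * z)%g = C z + a * p ^ n) ->
  coord p (S <*> <[x]>)%g n.+1 C'.
Proof.
move=> p_pr xp [cc clt cM ck cs] GS xS hC'.
have p0 := prime_gt0 p_pr.
have xN : x \in 'N(S)%g.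
  have /andP[_ /subsetP] : (S <| [set: gT])%g by apply: sub_der1_normal; rewrite ?subsetT.
  by apply; rewrite inE.
have memS y : y \in (S <*> <[x]>)%g -> exists a z, [/\ a < p, z \in S & y = (x ^+ a * z)%g].
  by move=> /(mem_prime_step p_pr xp xN)[a ap h]; exists a, (x ^- a * y)%g; rewrite mulKVg.
have Sx a z : a < p -> z \in S -> (x ^+ a * z)%g \in (S <*> <[x]>)%g.
  by move=> ap zS; apply/(mem_prime_step p_pr xp xN); exists a; rewrite // mulKg.
have C'lt a z : a < p -> z \in S -> C' (x ^+ a * z)%g < p ^ n.+1.
  move=> ap zS; rewrite hC' // expnS.
  have : a.+1 * p ^ n <= p * p ^ n by rewrite leq_mul2r ap orbT.
  by rewrite mulSn; have := clt z zS; lia.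
have C'poly a z : a < p -> z \in S ->
    numpoly p n.+1 (C' (x ^+ a * z)%g) = (numpoly p n (C z) + (a%:R)%:P * 'X^n)%R.
  by move=> ap zS; rewrite hC' // mulnC numpoly_top // clt.
split.
- by rewrite (card_prime_step p_pr xp xS xN) -cc expnS mulnA.
- by move=> y /memS[a [z [ap zS ->]]]; apply: C'lt.
- move=> y w /memS[a [z [ap zS ->]]] /memS[b [z' [bp zS' ->]]].
  have -> : (x ^+ a * z * (x ^+ b * z') = x ^+ ((a + b) %% p) * (z * [~ z, x ^+ b] * z'))%g.
    move: [~ z, x ^+ b]%g (commgC z (x ^+ b)%g) => w' e.
    by rewrite expg_mod // expgD -!mulgA; congr (_ * _)%g; rewrite (mulgA z (x ^+ b)%g) e -!mulgA.
  have cS : [~ z, x ^+ b]%g \in S by rewrite (subsetP GS) // comm_in_der.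
  have c0 : C [~ z, x ^+ b]%g = 0 by apply/eqP; rewrite ck // comm_in_der.
  have zzS : (z * [~ z, x ^+ b] * z')%g \in S by apply: groupM => //; apply: groupM.
  rewrite (C'poly _ _ (ltn_pmod _ p0) zzS) (C'poly a) // (C'poly b) //.
  rewrite (cM _ _ (groupM zS cS) zS') (cM _ _ zS cS) c0 numpoly0 // addr0.
  by rewrite Fp_nat_mod // natrD polyCD mulrDl addrACA.
- move=> y /memS[a [z [ap zS ->]]]; rewrite hC' //.
  have pn0 : 0 < p ^ n by rewrite expn_gt0 p0.
  have [->|a0] := posnP a; first by rewrite mul0n addn0 expg0 mul1g ck.
  rewrite [LHS]gtn_eqF; last by rewrite addn_gt0 muln_gt0 a0 pn0 orbT.
  apply/esym/negbTE; apply: contra xS => h.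
  apply: (mem_expg_coprime p_pr xp (S := S) (k := a)).
    by apply/negP => /dvdn_leq -/(_ a0); rewrite leqNgt ap.
  by rewrite -(mulgK z (x ^+ a)%g) groupM ?groupV // (subsetP GS).
move=> v hv; have pn0 : 0 < p ^ n by rewrite expn_gt0 p0.
have [z zS ez] := cs (v %% p ^ n) (ltn_pmod _ pn0).
have ap : v %/ p ^ n < p by rewrite ltn_divLR // -expnS.
by exists (x ^+ (v %/ p ^ n) * z)%g; rewrite ?Sx // hC' // ez addnC -divn_eq.
Qed.

Section Coordinates.
Variables (gT : finGroupType) (s : seq gT) (O : oracle) (p l : nat).
Hypotheses (s_num : numbering s) (p_pr : prime p) (l_gt0 : 0 < l) (N_eq : #|gT| = p ^ l).
Hypothesis gT_p : class_le2_expp p gT.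
Notation N := #|gT|.
Notation B := (N ^ 50).
Notation ix := (ix s).
Notation G' := [set: gT]^`(1)%g.
Let expp (x : gT) : (x ^+ p = 1)%g. Proof. exact: expg_p1 gT_p x. Qed.
Let NB : N < B. Proof. exact: N_lt_B p_pr l_gt0 N_eq. Qed.
Let N1 : 1 < N. Proof. exact: N_gt1 p_pr l_gt0 N_eq. Qed.

Lemma small_sum a b : a <= N -> b <= N * N -> (a + b).+1 < B.
Proof.
move=> ha hb; apply: (@leq_trans (N ^ 3)); last by rewrite leq_pexp2l // ltnW.
rewrite !expnS expn0 muln1; have : 2 * (N * N) <= N * (N * N) by rewrite leq_mul2r N1 orbT.
have : 2 * N <= N * N by rewrite leq_mul2r N1 orbT.
lia.
Qed.

Variables (T co e w : nat).
Hypotheses (T3 : 0 < T < 3) (co10 : 10 < co < 30) (e10 : 10 < e < 30) (w10 : 10 < w < 30)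
  (coe : co != e) (wco : w != co) (we : w != e).

Lemma coordinates_ok m : base N p l m -> tabl s m T ->
  let m' := (run O B [::] (coordinates T co e w) m).1 in
  exists n C, [/\ coord p [set: gT] n C, (forall y, m' co (ix y) = (C y).+1),
     m' w 0 = p ^ n & m' e 0 = ix 1%g].
Proof.
move=> m_base m_T; rewrite /coordinates.
set b1 := PSet e _ _; set b2 := PFor _ (PSet co _ _); set b3 := PSet 9 _ (K 0).
set b4 := PFor _ (PFor _ _); set b5 := PSet 9 _ (K 1); set b6 := PFor _ _; set b7 := PSet w _ _.
pose m1 := (run O B [::] b1 m).1; pose m2 := (run O B [::] b2 m1).1.
pose m3 := (run O B [::] b3 m2).1; pose m4 := (run O B [::] b4 m3).1.
pose m5 := (run O B [::] b5 m4).1; pose m6 := (run O B [::] b6 m5).1.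
have -> : (run O B [::] (b1 ;; b2 ;; b3 ;; b4 ;; b5 ;; b6 ;; b7) m).1 = (run O B [::] b7 m6).1 by [].
have [mN mP mL _] := m_base.
have ixs x : ix x %% B = ix x by exact: (ix_small s_num p_pr l_gt0 N_eq).
have m1e : m1 e 0 = ix 1%g.
  (* The identity is the only idempotent, so the sum has a single nonzero term at most. *)
  rewrite /m1 /= updE mN; pose F i := i * (m T (i * N + i) == i).
  rewrite (@sum_el _ _ s_num F 1%g); first by rewrite /F m_T mulg1 eqxx muln1 ixs.
  move=> y y1; rewrite /F m_T (inj_eq (ix_inj s_num)).
  have -> : (y * y == y)%g = (y == 1)%g by rewrite -[X in _ == X](mulg1 y) (inj_eq (mulgI y)).
  by rewrite (negbTE y1) muln0.
pose W := [:: 7; 8; 9; 10; co].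
pose fr (m' : memory) := forall y, y \notin W -> m' y =1 m1 y.
have fr_fix m' : fr m' -> [/\ base N p l m', tabl s m' T & m' e 0 = ix 1%g].
  move=> h; split.
  - apply: (base_ext m_base) => y yW j; rewrite h; last by move: yW; rewrite !inE; lia.
    by rewrite /m1 run_frame //; move: yW; rewrite !inE; lia.
  - apply: (tabl_ext m_T) => j; rewrite h; last by rewrite !inE; lia.
    by rewrite /m1 run_frame // !inE; lia.
  - by rewrite h // !inE; lia.
(* In the first pass the step is 0, so all codes stand for coordinate 0 and merely record membership
   in the growing subgroup [S]; [P] says which commutators have been adjoined. *)
pose phase1 (m' : memory) (P : gT -> gT -> Prop) := fr m' /\ exists S : {group gT},
  [/\ S \subset G', coded s m' co S (fun=> 0), m' 9 0 = 0 & forall x y, P x y -> [~ x, y]%g \in S].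
have ext_frame r m' : fr m' -> fr (run O B r (extend T co e) m').1.
  move=> h y yW j; rewrite run_frame ?h //; move: yW; rewrite !inE; lia.
have set10 r m' ex : fr m' -> fr (run O B r (PSet 10 (K 0) ex) m').1.
  by move=> h y yW j; rewrite run_frame ?h //; move: yW; rewrite !inE; lia.
have c9 : co != 9 by lia.
have c10 : co != 10 by lia.
have P3 : phase1 m3 (fun _ _ => False).
  split; first by move=> y yW j; rewrite /m3 /m2 !run_frame //; move: yW; rewrite !inE; lia.
  exists 1%G; split=> //; rewrite ?sub1G //; last by rewrite /m3 /= updE mod0n.
  move=> y; rewrite /m3 run_frame ?inE // /m2 run_fill; last by rewrite /= !inE; lia.
  have -> : reval m1 [::] (cell 3) = N by rewrite /= /m1 run_frame // inE; lia.
  rewrite eqxx ix_lt //= m1e (inj_eq (ix_inj s_num)) modn_small; first by case: eqP.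
  by rewrite (leq_ltn_trans (leq_b1 _)) // (ltn_trans N1 NB).
have P4 : phase1 m4 (fun _ _ => True).
  pose I k (m' : memory) := phase1 m' (fun x _ => ix x < k).
  have b3N : reval m3 [::] (cell 3) = N by have [/fr_fix[[h _ _ _] _ _] _] := P3.
  suff : I (reval m3 [::] (cell 3)) m4.
    rewrite b3N => -[h [S [h1 h2 h3 h4]]]; split=> //; exists S; split=> // x y _.
    by apply: h4; apply: ix_lt.
  apply: run_for1.
    by case: P3 => h [S [h1 h2 h3 h4]]; split=> //; exists S; split.
  move=> i m' iN Ii.
  pose I2 k (m' : memory) := phase1 m' (fun x y => (ix x < i) || (ix x == i) && (ix y < k)).
  have bN m'' : fr m'' -> forall r, reval m'' r (cell 3) = N by move=> /fr_fix[[h _ _ _] _ _] r.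
  have fr' : fr m' by case: Ii.
  set bb := (_ ;; _).
  suff : I2 (reval m' [:: i] (cell 3)) (run O B [:: i] (PFor (cell 3) bb) m').1.
    rewrite (bN _ fr') => -[h [S [h1 h2 h3 h4]]]; split=> //; exists S; split=> // x y hx.
    by apply: h4; rewrite ix_lt // andbT orbC -leq_eqVlt -ltnS.
  apply: run_for1.
    case: Ii => h [S [h1 h2 h3 h4]]; split=> //; exists S; split=> // x y.
    by rewrite ltn0 andbF orbF; apply: h4.
  move=> j mj; rewrite (bN _ fr') => jN [frj [S [SG Sc S9 Sm]]].
  rewrite b3N in iN.
  have [bj Tj ej] := fr_fix _ frj; have [bjN bjP _ _] := bj.
  pose x := el s i; pose y := el s j.
  have ei : i = ix x by rewrite ixK.
  have ejx : j = ix y by rewrite ixK.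
  rewrite /bb; set a1 := PSet 10 _ _.
  have -> : (run O B [:: j; i] (a1 ;; extend T co e) mj).1 =
     (run O B [:: j; i] (extend T co e) (run O B [:: j; i] a1 mj).1).1 by [].
  set mk := (run O B [:: j; i] a1 mj).1.
  have frk : fr mk by apply: set10.
  have mk10 : mk 10 0 = ix [~ x, y]%g.
    rewrite /mk /= updE bjN ei ejx !Tj.
    pose F c := c * (mj T (ix (y * x)%g * N + c) == ix (x * y)%g).
    rewrite (@sum_el _ _ s_num F [~ x, y]%g); first by rewrite /F Tj -commgC eqxx muln1 ixs.
    move=> z zc; rewrite /F Tj (inj_eq (ix_inj s_num)); case: eqP => [hz|]; last by rewrite muln0.
    by case/eqP: zc; apply: (mulgI (y * x)%g); rewrite hz -commgC.
  have [bk Tk ek] := fr_fix _ frk.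
  have Sck : coded s mk co S (fun=> 0) by move=> z; rewrite -Sc /mk /= updN.
  have S9k : mk 9 0 = 0 by rewrite /mk /= updN.
  have cN : [~ x, y]%g \in 'N(S)%g.
    rewrite inE; apply/subsetP => _ /imsetP[z zS ->].
    by rewrite /conjg (der_central gT_p [~ x, y] (subsetP SG _ zS)) mulKg.
  have T3' : T < 3 by lia.
  have C0 z : z \in S -> (0 + p * 0).+1 < B by move=> _; rewrite muln0; apply: ltn_trans N1 NB.
  have W0 : 0 * p < B by rewrite mul0n; apply: ltn_trans (ltnW N1) NB.
  have := extend_ok s_num O p_pr l_gt0 N_eq expp [:: j; i] T3' co10 e10 coe bk Tk ek mk10 S9k Sck cN C0 W0.
  have addP (S' : {group gT}) : [~ x, y]%g \in S' -> S \subset S' -> forall u v,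
      (ix u < i) || (ix u == i) && (ix v < j.+1) -> [~ u, v]%g \in S'.
    move=> cS SS u v; rewrite ltnS (leq_eqVlt (ix v)) andb_orr orbCA => /orP[|/Sm/(subsetP SS) //].
    by case/andP => /eqP hu /eqP hv; rewrite -(elK s_num u) -(elK s_num v) hu hv.
  cbv zeta; case: ifP => cS; case=> h1.
    move=> h2; split; first exact: ext_frame.
    by exists S; split=> //; apply: addP.
  case=> h2 h3; split; first exact: ext_frame.
  exists (S <*> <[[~ x, y]]>)%G; split.
  - by rewrite join_subG SG cycle_subG comm_in_der.
  - move=> z; case: ifP => [/(mem_prime_step p_pr (expp _) cN)[a ap hz]|/negbT/h2 //].
    by rewrite -(mulKVg ([~ x, y] ^+ a)%g z) h1 // muln0.
  - by rewrite h3 mul0n.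
  - by apply: addP; [rewrite mem_gen // inE cycle_id orbT|apply: joing_subl].
(* The second pass climbs from the derived subgroup to the whole group, and cell 9 is the weight of
   the next digit. *)
pose phase2 k (m' : memory) := fr m' /\ exists (S : {group gT}) n C,
  [/\ G' \subset S, coded s m' co S C, m' 9 0 = p ^ n, coord p S n C & forall x, ix x < k -> x \in S].
have P5 : phase2 0 m5.
  case: P4 => h [S [SG Sc S9 Sm]]; split.
    by move=> y yW j; rewrite /m5 run_frame ?h //; move: yW; rewrite !inE; lia.
  exists S, 0, (fun=> 0).
  have eS : S :=: G'.
    apply/eqP; rewrite eqEsubset SG gen_subG; apply/subsetP => _ /imset2P[x y _ _ ->].
    exact: Sm.
  split=> //.
  - by rewrite eS.
  - by move=> y; rewrite -Sc /m5 run_frame // inE.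
  - by rewrite /m5 /= updE modn_small // (ltn_trans N1 NB).
  - by rewrite eS; apply: coord_der.
have P6 : phase2 N m6.
  have b5N : reval m5 [::] (cell 3) = N by have [/fr_fix[[h _ _ _] _ _] _] := P5.
  suff : phase2 (reval m5 [::] (cell 3)) m6 by rewrite b5N.
  apply: run_for1 => // i mi; rewrite b5N => iN [fri [S [n [C [SG Sc S9 Sco Sm]]]]].
  have [bi Ti ei] := fr_fix _ fri; have [biN biP _ _] := bi.
  set a1 := PSet 10 _ _.
  have -> : (run O B [:: i] (a1 ;; extend T co e) mi).1 =
     (run O B [:: i] (extend T co e) (run O B [:: i] a1 mi).1).1 by [].
  set mk := (run O B [:: i] a1 mi).1.
  have frk : fr mk by apply: set10.
  pose x := el s i; have eix : i = ix x by rewrite ixK.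
  have mk10 : mk 10 0 = ix x by rewrite /mk /= updE modn_small -?eix // (ltn_trans iN NB).
  have [bk Tk ek] := fr_fix _ frk.
  have Sck : coded s mk co S C by move=> z; rewrite -Sc /mk /= updN.
  have S9k : mk 9 0 = p ^ n by rewrite /mk /= updN.
  have xN : x \in 'N(S)%g.
    have /andP[_ /subsetP] : (S <| [set: gT])%g by apply: sub_der1_normal; rewrite ?subsetT.
    by apply; rewrite inE.
  have pnN : p ^ n <= N.
    by rewrite (leq_trans _ (max_card (mem S))) // -(coord_card Sco) leq_pmulr ?cardG_gt0.
  have pW : p * p ^ n <= N * N by rewrite leq_mul // (p_le_N p_pr l_gt0 N_eq).
  have T3' : T < 3 by lia.
  have Cs z : z \in S -> (C z + p * p ^ n).+1 < B.
    by move=> zS; apply: small_sum => //; apply: leq_trans pnN; apply: ltnW; apply: (coord_lt Sco).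
  have Ws : p ^ n * p < B.
    by have := small_sum (leq0n N) pW; rewrite add0n mulnC => /ltnW.
  have := extend_ok s_num O p_pr l_gt0 N_eq expp [:: i] T3' co10 e10 coe bk Tk ek mk10 S9k Sck xN Cs Ws.
  have addP (S' : {group gT}) : x \in S' -> S \subset S' -> forall u, ix u < i.+1 -> u \in S'.
    move=> xS SS u; rewrite ltnS leq_eqVlt => /orP[/eqP hu|/Sm/(subsetP SS) //].
    by rewrite -(elK s_num u) hu.
  cbv zeta; case: ifP => xS; case=> h1.
    move=> h2; split; first exact: ext_frame.
    by exists S, n, C; split=> //; apply: addP.
  case=> h2 h3; split; first exact: ext_frame.
  set m' := (run O B [:: i] (extend T co e) mk).1 in h1 h2 h3 *.
  have SS : S \subset (S <*> <[x]>)%G by apply: joing_subl.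
  exists (S <*> <[x]>)%G, n.+1, (fun y => (m' co (ix y)).-1); split.
  - exact: subset_trans SG SS.
  - move=> z; case: ifP => [/(mem_prime_step p_pr (expp _) xN)[a ap hz]|/negbT/h2 //].
    by rewrite -(mulKVg (x ^+ a)%g z) h1.
  - by rewrite h3 expnSr.
  - apply: (coord_step p_pr (expp x) Sco SG) => [|a z ap zS]; first by rewrite xS.
    by rewrite h1.
  - by apply: addP => //; rewrite mem_gen // inE cycle_id orbT.
case: P6 => fr6 [S [n [C [SG Sc S9 Sco Sm]]]].
have eS : S :=: [set: gT] by apply/setP => x; rewrite inE Sm // ix_lt.
rewrite eS in Sco; exists n, C; split=> //.
- by move=> y; rewrite /b7 /= updN 1?eq_sym // Sc eS inE.
- rewrite /b7 /= updE S9 modn_small // (leq_ltn_trans _ NB) //.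
  by have := coord_card Sco; rewrite cardsT => <-; rewrite leq_pmulr ?cardG_gt0.
by rewrite /b7 /= updN 1?eq_sym //; have [_ _] := fr_fix _ fr6.
Qed.

End Coordinates.

(** * Cayley tables of gadgets *)

Section GadgetTable.
Variables (gT : finGroupType) (s : seq gT) (O : oracle) (p l k : nat).
Hypotheses (s_num : numbering s) (p_pr : prime p) (l_gt0 : 0 < l) (N_eq : #|gT| = p ^ l).
Notation N := #|gT|.
Notation B := (N ^ 50).
Notation ix := (ix s).
Notation el := (el s).
(** [l + 9] meets both demands on [d]: it is at least 9, and [N * p ^ 3 < p ^ d]. [L] equals
    [d + 3 + (d + k + 8)], the number of coordinates over ['F_p]. *)
Notation d := (l + 9).
Notation L := (2 * l + k + 29).
Notation M := (N * p ^ L).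
Variables (c : covector gT p k) (C : gT -> nat).
Hypotheses (C_lt : forall x, C x < p ^ k) (C_cov : forall x, c x = numpoly p k (C x)).
Hypothesis k_le_l : k <= l.

Let p0 : 0 < p. Proof. exact: prime_gt0. Qed.
Let N0 : 0 < N. Proof. by rewrite N_eq expn_gt0 p0. Qed.
Let pX0 j : 0 < p ^ j. Proof. by rewrite expn_gt0 p0. Qed.

Definition dec (A : nat) : gadget d c :=
  mke (gad_pairing d c) (el (A %% N)) (\row_(j < d) dg p j (A %/ N))%R
    (\row_(j < 3) dg p (d + j) (A %/ N))%R (\row_(j < d + k + 8) dg p (d + 3 + j) (A %/ N))%R.

Lemma dec_inj A A' : A < M -> A' < M -> dec A = dec A' -> A = A'.
Proof.
move=> hA hA' [ex ey eq er].
rewrite (divn_eq A N) (divn_eq A' N); congr (_ * _ + _); last first.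
  by rewrite -(ixK s_num (ltn_pmod A N0)) ex ixK // ltn_pmod.
apply: (@dg_ext p p_pr L); rewrite ?ltn_divLR ?[p ^ _ * _]mulnC //.
move=> j jL; case: (ltnP j d) => [jd|dj].
  by move/rowP/(_ (Ordinal jd)): ey; rewrite !mxE.
case: (ltnP j (d + 3)) => [jd|dj'].
  have j3 : j - d < 3 by lia.
  by move/rowP/(_ (Ordinal j3)): eq; rewrite !mxE /= subnKC.
have jr : j - (d + 3) < d + k + 8 by lia.
by move/rowP/(_ (Ordinal jr)): er; rewrite !mxE /= subnKC.
Qed.

Definition gad_num := mkseq dec M.

Lemma gad_numP : numbering gad_num.
Proof.
have u : uniq gad_num.
  by apply/mkseq_uniqP => A A'; rewrite !inE; apply: dec_inj.
split=> //; have sz : size gad_num = #|[set: gadget d c]|.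
  rewrite size_mkseq card_gadget // cardsT; congr (_ * p ^ _); lia.
have : gad_num =i enum [set: gadget d c].
  apply: (uniq_min_size u _ _).2 => [x _|]; first by rewrite mem_enum inE.
  by rewrite sz cardE.
by move=> h x; rewrite h mem_enum.
Qed.

Lemma coef_marker (vB : nat) x (i : nat) :
  ((marker c x (\row_(j < d) dg p j vB)%R)`_i)%R = dg p i (vB %% p ^ d + p ^ d * C x).
Proof.
rewrite /marker coefD coefXnM C_cov coef_numpoly // coef_rVpoly.
case: insubP => [j jd ji|]; first by rewrite jd mxE ji addr0 dgD_low.
by rewrite -leqNgt => di; rewrite ltnNge di /= add0r dgD_high // ltn_pmod.
Qed.

Lemma coef_pencilM (q : 'rV['F_p]_3) (P : {poly 'F_p}) (j : nat) :
  ((pencilv q * P)`_j = q 0 0 * P`_j + q 0 1 * (if (j < 1)%N then 0 else P`_(j - 1)) +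
   q 0 2%:R * ((if (j < 8)%N then 0 else P`_(j - 8)) + (if (j < 6)%N then 0 else P`_(j - 6)) +
     (if (j < 5)%N then 0 else P`_(j - 5))))%R.
Proof.
rewrite /pencilv /pencil !mulrDl -!mulrA !coefD !coefCM; congr (_ + _ * _ + _ * _)%R.
  by rewrite -['X%R]expr1 coefXnM.
by rewrite /octic !mulrDl !coefD !coefXnM.
Qed.

Variables (T co out : nat) (r : seq nat) (m : memory).
Hypotheses (m_base : base N p l m) (m_T : tabl s m T) (m_co : forall x, m co (ix x) = C x)
  (m_L : m 42 0 = L) (m_M : m 41 0 = M).
Hypotheses (T3 : T < 3) (co29 : 29 < co < 34) (out34 : 33 < out < 36).

Let pw j : j <= 3 * l + 40 -> m 6 j = p ^ j. Proof. exact: (basePow m_base). Qed.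

(** Pencil members act by shifts: the factor [p ^ (d + 3)] moves the marker to where the [r] digits
    begin, and a further [p ^ i] multiplies it by ['X^i]. Quotients are not reduced, since only
    their classes modulo [p] matter. *)
Lemma digit_value A A' j : A' < M -> j < L ->
  ((reval m [:: j, A', A & r] (gadget_digit co))%:R =
   dg p j (A %/ N) + dg p j (A' %/ N) +
   (if (j < d + 3)%N then 0 else
    (pencilv (qpart (dec A)) * marker c (gpart (dec A')) (ypart (dec A')))`_(j - (d + 3))))%R.
Proof.
move=> hA' jL; have [mN mP mL _] := m_base.
have x'N : A' %% N < N by rewrite ltn_pmod.
rewrite /= mN mL !pw; try by lia.
have -> : m co (A' %% N) = C (el (A' %% N)) by rewrite -m_co ixK.
set vA := A %/ N; set vB := A' %/ N.
set Z0 := vB %% p ^ (l + 9) + p ^ (l + 9) * C (el (A' %% N)).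
have -> : p ^ (l + 12) = p ^ (d + 3) by congr (p ^ _); lia.
have shift i : ((Z0 * p ^ (d + 3) * p ^ i %/ p ^ j)%N%:R =
   if (j < d + 3)%N then 0 else if (j - (d + 3) < i)%N then 0 else dg p (j - (d + 3) - i) Z0 :> 'F_p)%R.
  rewrite -mulnA -expnD -/(dg p j (Z0 * p ^ (d + 3 + i))).
  case: ltnP => [h|h]; first by rewrite dg_mul_low //; lia.
  case: ltnP => [h'|h']; first by rewrite dg_mul_low //; lia.
  by rewrite dg_mul_high ?subnDA //; lia.
rewrite !natrD !natrM !natrD !shift.
have := shift 0; rewrite expn0 muln1 => ->.
rewrite -/(dg p j vA) -/(dg p j vB) -!addrA; congr (_ + (_ + _))%R.
case: (ltnP j (d + 3)) => h; first by rewrite !(mulr0, addr0).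
rewrite coef_pencilM /dec /mke /qpart /gpart /ypart /= !mxE /= !addnA !addn0 !coef_marker.
by rewrite subn0 -/vA -/vB -/Z0 !addrA.
Qed.

Lemma reval_cell A A' : reval m [:: A', A & r] (gadget_cell T co) =
  m T ((A %% m 3 0) * m 3 0 + A' %% m 3 0) +
  m 3 0 * \sum_(j < m 42 0) m 6 j * (reval m [:: val j, A', A & r] (gadget_digit co) %% m 4 0).
Proof. by []. Qed.

Lemma cell_value A A' : A < M -> A' < M ->
  let v := reval m [:: A', A & r] (gadget_cell T co) in
  v < M /\ dec v = (dec A * dec A')%g.
Proof.
move=> hA hA'; have [mN mP mL _] := m_base.
set v := reval _ _ _; cbv zeta.
pose e j := reval m [:: j, A', A & r] (gadget_digit co) %% p.
have ep j : e j < p by rewrite ltn_pmod.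
have xN i : i %% N < N by rewrite ltn_pmod.
have Ev : v = ix (el (A %% N) * el (A' %% N))%g + N * \sum_(j < L) p ^ j * e j.
  rewrite /v reval_cell mN m_L mP -m_T !(ixK s_num (xN _)); congr (_ + _ * _).
  apply: eq_bigr => j _; rewrite pw; first by rewrite /e.
  by have := ltn_ord j; lia.
set V := \sum_(j < L) _ in Ev.
have VL : V < p ^ L by apply: sum_digits_lt.
have vq : v %/ N = V by rewrite Ev addnC mulnC divnMDl // divn_small ?addn0 // ix_lt.
have vr : v %% N = ix (el (A %% N) * el (A' %% N))%g.
  by rewrite Ev addnC mulnC modnMDl modn_small // ix_lt.
have dV j : j < L -> dg p j V = (dg p j (A %/ N) + dg p j (A' %/ N) +
   (if (j < d + 3)%N then 0 else
    (pencilv (qpart (dec A)) * marker c (gpart (dec A')) (ypart (dec A')))`_(j - (d + 3))))%R.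
  by move=> jL; rewrite dg_sum // /e Fp_nat_mod // digit_value.
split; first by rewrite mulnC -ltn_divLR // vq.
apply: ext_eq.
- by rewrite gpartM /dec /mke /gpart /= vr elK.
- rewrite ypartM; apply/rowP => j; rewrite /dec /mke /ypart /= !mxE vq dV; last by have := ltn_ord j; lia.
  by case: ltnP => [_|h]; rewrite ?addr0 //; have := ltn_ord j; lia.
- rewrite qpartM; apply/rowP => j; rewrite /dec /mke /qpart /= !mxE vq dV; last by have := ltn_ord j; lia.
  by case: ltnP => [_|h]; rewrite ?addr0 //; have := ltn_ord j; lia.
rewrite rpartM; apply/rowP => j; rewrite [in LHS]/dec /mke [in LHS]/rpart /= !mxE vq dV; last by have := ltn_ord j; lia.
rewrite ltnNge leq_addr /= addKn; congr (_ + _)%R.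
Qed.

Lemma gadget_table_ok :
  table_at (run O B r (gadget_table T co out) m).1 out M = cayley gad_num.
Proof.
have sz : size gad_num = M by rewrite size_mkseq.
rewrite -[in LHS]sz; apply: cayley_table => i j; rewrite sz => iM jM.
have [vM dv] := cell_value iM jM.
have oC : out \notin reads (gadget_cell T co) by rewrite !inE; lia.
have o41 : out \notin reads (cell 41) by rewrite !inE; lia.
have := @run_fill2 O B r out (gadget_cell T co) (cell 41) m oC o41.
have -> : reval m r (cell 41) = M by rewrite -m_M.
cbv zeta => /(_ (fun _ _ => erefl) i j iM jM) ->.
(* As [k <= l], the exponent is at most [4 * l + 29], which is below [50 * l]. *)
have MB : M < B.
  by rewrite N_eq -expnD -expnM ltn_exp2l ?prime_gt1 //; lia.
rewrite modn_small; last exact: ltn_trans vM MB.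
by rewrite !nth_mkseq // -dv -[dec _](nth_mkseq 1%g _ vM) index_uniq ?size_mkseq //; case: gad_numP.
Qed.

End GadgetTable.

(** * Covectors coded by numbers *)

Section CodedCovectors.
Variables (gT : finGroupType) (p : nat).
Hypothesis p_pr : prime p.

Definition digit_additive (C : gT -> nat) :=
  forall x y j, (dg p j (C (x * y)%g) = dg p j (C x) + dg p j (C y))%R.

Record is_cov (k : nat) (C : gT -> nat) : Prop := IsCov {
  cov_lt : forall x, C x < p ^ k;
  cov_add : digit_additive C }.

Definition cov_fun_of (k : nat) (C : gT -> nat) x := numpoly p k (C x).

Lemma cov_of_subproof k C : is_cov k C ->
  forall x y, cov_fun_of k C (x * y)%g = (cov_fun_of k C x + cov_fun_of k C y)%R.
Proof.
move=> [Clt Cadd] x y; apply/polyP => j.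
by rewrite coefD !coef_numpoly // Cadd.
Qed.

Definition cov_of k C (h : is_cov k C) : covector gT p k :=
  Covector (cov_of_subproof h) (fun x => size_numpoly p k (C x)).

Lemma is_cov_weak k k' C : k <= k' -> is_cov k C -> is_cov k' C.
Proof.
by move=> kk [a b]; split=> // x; rewrite (leq_trans (a x)) // leq_pexp2l ?prime_gt0.
Qed.

Lemma dg0 j : dg p j 0 = 0%R. Proof. by rewrite /dg div0n. Qed.

Lemma is_cov0 k : is_cov k (fun=> 0).
Proof. by split=> [x|x y j]; rewrite ?expn_gt0 ?prime_gt0 // !dg0 addr0. Qed.

Lemma dg_mod k j a : dg p j (a %% p ^ k) = (if (j < k)%N then dg p j a else 0)%R.
Proof.
case: ltnP => jk; first by rewrite -[X in dg p j X]addn0 -(muln0 (p ^ k)) dgD_low.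
by rewrite dg_small // (leq_trans (ltn_pmod _ _)) ?expn_gt0 ?prime_gt0 // leq_pexp2l ?prime_gt0.
Qed.

Lemma is_cov_mod k C : digit_additive C -> is_cov k (fun x => C x %% p ^ k).
Proof.
move=> Cadd; split=> [x|x y j]; first by rewrite ltn_pmod // expn_gt0 prime_gt0.
by rewrite !dg_mod Cadd; case: ifP; rewrite ?addr0.
Qed.

Lemma is_cov_top k C (f : gT -> nat) : is_cov k C ->
  (forall x y, ((f (x * y)%g)%:R = (f x)%:R + (f y)%:R :> 'F_p)%R) ->
  is_cov k.+1 (fun x => C x + p ^ k * (f x %% p)).
Proof.
move=> [Clt Cadd] fM; have p0 := prime_gt0 p_pr.
have pk0 : 0 < p ^ k by rewrite expn_gt0 p0.
have dgE x j : dg p j (C x + p ^ k * (f x %% p)) =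
    (if (j < k)%N then dg p j (C x) else if j == k then (f x)%:R else 0)%R.
  case: ltnP => [jk|kj]; first by rewrite -{1}(modn_small (Clt x)) dgD_low.
  rewrite dgD_high //; case: eqP => [->|jk]; first by rewrite subnn /dg expn0 divn1 Fp_nat_mod.
  rewrite dg_small // (leq_trans (ltn_pmod _ p0)) // -{1}(expn1 p) leq_pexp2l //; lia.
split=> [x|x y j]; last by rewrite !dgE Cadd fM; case: ifP => // _; case: ifP; rewrite ?addr0.
have : p ^ k * (f x %% p).+1 <= p ^ k * p by rewrite leq_mul2l ltn_pmod ?orbT.
by rewrite expnSr mulnS; have := Clt x; lia.
Qed.

Section Coord.
Variables (n : nat) (C : gT -> nat).
Hypothesis C_coord : coord p [set: gT] n C.

Lemma coord_ltT y : C y < p ^ n. Proof. by apply: (coord_lt C_coord); rewrite inE. Qed.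

Lemma coord_additive : digit_additive C.
Proof.
move=> x y j; have := coordM C_coord (in_setT x) (in_setT y).
move/(congr1 (fun q : {poly 'F_p} => q`_j))%R.
by rewrite /= coefD !coef_numpoly // coord_ltT.
Qed.

Lemma additive1 (h : gT -> 'F_p) : (forall x y, h (x * y)%g = h x + h y)%R -> h 1%g = 0%R.
Proof. by move=> hM; apply: (addrI (h 1%g)); rewrite -hM mulg1 addr0. Qed.

Lemma additiveV (h : gT -> 'F_p) : (forall x y, h (x * y)%g = h x + h y)%R ->
  forall x, h x^-1%g = (- h x)%R.
Proof. by move=> hM x; apply: (addrI (h x)); rewrite -hM mulgV additive1 // subrr. Qed.

Lemma additiveX (h : gT -> 'F_p) : (forall x y, h (x * y)%g = h x + h y)%R ->
  forall x i, h (x ^+ i)%g = (h x *+ i)%R.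
Proof.
by move=> hM x; elim=> [|i IH]; rewrite ?additive1 // expgS hM IH mulrS.
Qed.

Lemma additive_der (h : gT -> 'F_p) : (forall x y, h (x * y)%g = h x + h y)%R ->
  forall z, z \in [set: gT]^`(1)%g -> h z = 0%R.
Proof.
move=> hM z hz; have hM' x y : ((h (x * y)%g)%:P = (h x)%:P + (h y)%:P :> {poly 'F_p})%R.
  by rewrite hM polyCD.
have hs x : size ((h x)%:P)%R <= 1 by apply: size_polyC_leq1.
apply: (@polyC_inj 'F_p); exact: (cov_der (Covector hM' hs) hz).
Qed.

Lemma additive_prod (h : gT -> 'F_p) m (b : 'I_m -> gT) (a : 'I_m -> 'F_p) :
  (forall x y, h (x * y)%g = h x + h y)%R ->
  (h (\prod_(j < m) b j ^+ (a j : nat))%g = \sum_(j < m) a j * h (b j))%R.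
Proof.
move=> hM; rewrite (big_morph h hM (additive1 hM)).
by apply: eq_bigr => j _; rewrite additiveX // -mulr_natl natr_Zp.
Qed.

Lemma coord_eq x y : (C x == C y) = ((x^-1 * y)%g \in [set: gT]^`(1)%g).
Proof.
have add i u v : (dg p i (C (u * v)%g) = dg p i (C u) + dg p i (C v))%R by apply: coord_additive.
rewrite -(coord_ker C_coord) ?inE //; apply/eqP/eqP => h.
  apply: (dg_ext p_pr (coord_ltT _)) => [|i _]; first by rewrite expn_gt0 prime_gt0.
  by rewrite add (additiveV (add i)) h addNr dg0.
apply: (dg_ext p_pr (coord_ltT _) (coord_ltT _)) => i _.
by rewrite -[in RHS](mulKVg x y) add h dg0 addr0.
Qed.

Lemma coord_basis : {b : 'I_n -> gT | forall j : 'I_n, C (b j) = p ^ j}.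
Proof.
have ex (j : 'I_n) : exists y, C y == p ^ j.
  have [|y _ hy] := coord_surj C_coord (v := p ^ j); first by rewrite ltn_exp2l ?prime_gt1.
  by exists y; apply/eqP.
by exists (fun j => xchoose (ex j)) => j; apply/eqP: (xchooseP (ex j)).
Qed.

Lemma dg_exp i j : dg p i (p ^ j) = (i == j)%:R%R.
Proof.
have p0 := prime_gt0 p_pr; have [ij|ij|->] := ltngtP i j.
- by rewrite -[p ^ j]mul1n dg_mul_low.
- by rewrite dg_small // ltn_exp2l ?prime_gt1.
- by rewrite /dg divnn expn_gt0 p0.
Qed.

(** A normal form of [y] modulo the derived subgroup, for a basis [b]. *)
Definition coord_word (b : 'I_n -> gT) y := (\prod_(j < n) b j ^+ (dg p j (C y) : nat))%g.

Lemma coord_wordP b y : (forall j : 'I_n, C (b j) = p ^ j) -> ((coord_word b y)^-1 * y)%g \in [set: gT]^`(1)%g.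
Proof.
move=> bC; rewrite -coord_eq; apply/eqP.
have add i x z : (dg p i (C (x * z)%g) = dg p i (C x) + dg p i (C z))%R by apply: coord_additive.
apply: (dg_ext p_pr (coord_ltT _) (coord_ltT _)) => i ilt.
rewrite /coord_word (additive_prod _ _ (add i)).
rewrite (bigD1 (Ordinal ilt)) //= bC dg_exp eqxx mulr1 big1 ?addr0 // => j ji.
by rewrite bC dg_exp [i == j]eq_sym -val_eqE /= in ji *; rewrite (negbTE ji) mulr0.
Qed.

(** [h] kills the derived subgroup, so it takes the same value on [y] and on its normal form. The
    values on a basis are the digits of [c]. *)
Lemma coord_functional (h : gT -> 'F_p) : (forall x y, h (x * y)%g = h x + h y)%R ->
  exists2 c, c < p ^ n & forall y, h y = (\sum_(j < n) dg p j c * dg p j (C y))%R.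
Proof.
move=> hM; have [b bC] := coord_basis.
pose e i : nat := if insub i is Some j then h (b j) else 0%R.
have ep i : e i < p.
  by rewrite -[X in _ < X](Fp_cast p_pr) /e; case: insub => [j|//]; apply: ltn_ord.
exists (\sum_(i < n) p ^ i * e i); first exact: sum_digits_lt.
move=> y; have := additive_der hM (coord_wordP y bC).
rewrite hM (additiveV hM) => /eqP; rewrite addrC subr_eq0 => /eqP ->.
rewrite (additive_prod _ _ hM); apply: eq_bigr => j _.
by rewrite dg_sum // /e valK natr_Zp mulrC.
Qed.

End Coord.
End CodedCovectors.

Lemma modn_expS a p k : 0 < p -> a %% p ^ k.+1 = a %% p ^ k + p ^ k * ((a %/ p ^ k) %% p).
Proof.
move=> p0; have pk : 0 < p ^ k by rewrite expn_gt0 p0.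
have E : a = a %/ p ^ k %/ p * (p * p ^ k) + (a %% p ^ k + p ^ k * ((a %/ p ^ k) %% p)).
  by rewrite mulnA [p ^ k * _]mulnC addnCA -mulnDl -divn_eq addnC -divn_eq.
rewrite {1}E expnS modnMDl modn_small //.
have : p ^ k * ((a %/ p ^ k) %% p).+1 <= p ^ k * p by rewrite leq_mul2l ltn_pmod ?orbT.
by rewrite mulnS [p * _]mulnC; have := ltn_pmod a pk; lia.
Qed.

(** * Isomorphisms with prescribed coordinates *)

Section Pins.
Variables (gT hT : finGroupType) (p N l : nat).
Hypotheses (gG : class2_expp p N gT) (hG : class2_expp p N hT) (N_eq : N = p ^ l) (l_gt0 : 0 < l).
Local Notation p_pr := (class2_prime gG).
Let p_prime : prime p. Proof. exact: p_pr. Qed.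
Let cardG : #|gT| = N. Proof. by case: gG => _ _ _ _ <-; rewrite cardsT. Qed.
Let cardH : #|hT| = N. Proof. by case: hG => _ _ _ _ <-; rewrite cardsT. Qed.
Let p0 : 0 < p. Proof. exact: prime_gt0 p_pr. Qed.

(** Finite functions make the condition boolean, so that it can be an oracle answer and a summand.
    Injectivity suffices because the groups have the same order. *)
Definition pinb k (C : gT -> nat) (D : hT -> nat) : bool :=
  [exists phi : {ffun gT -> hT},
    [&& [forall x, forall y, phi (x * y)%g == (phi x * phi y)%g], injectiveb phi &
        [forall x, D (phi x) == C x %% p ^ k]]].

Lemma pinbP k C D : reflect (exists phi : gT -> hT, [/\ {morph phi : x y / (x * y)%g},
  injective phi & forall x, D (phi x) = C x %% p ^ k]) (pinb k C D).
Proof.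
apply: (iffP existsP) => [[phi /and3P[/forallP hM /injectiveP hi /forallP hD]]|[phi [hM hi hD]]].
  exists phi; split=> // [x y|x]; last exact/eqP.
  by move/forallP: (hM x) => /(_ y)/eqP.
exists (finfun phi); apply/and3P; split.
- by apply/forallP => x; apply/forallP => y; rewrite !ffunE hM.
- by apply/injectiveP => x y; rewrite !ffunE; apply: hi.
- by apply/forallP => x; rewrite ffunE hD.
Qed.

Variables (n1 n2 : nat) (C : gT -> nat) (E : hT -> nat).
Hypotheses (C_coord : coord p [set: gT] n1 C) (E_coord : coord p [set: hT] n2 E).

Definition top_cov k : is_cov p k (fun x => C x %% p ^ k) :=
  is_cov_mod p_pr k (coord_additive p_pr C_coord).

(** [k <= n1] makes the truncated coordinates surjective onto the polynomials of size at most [k],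
    as [gadget_isogP] demands of the first covector. *)
Lemma isog_pin k D (hD : is_cov p k D) : k <= n1 ->
  ([set: gadget (l + 9) (cov_of p_pr (top_cov k))] \isog [set: gadget (l + 9) (cov_of p_pr hD)])%g
  = pinb k C D.
Proof.
move=> kn; have lt9 : (N * p ^ 3 < p ^ (l + 9))%N.
  by rewrite N_eq -expnD ltn_exp2l ?prime_gt1 //; lia.
have full (P : {poly 'F_p}) : size P <= k -> exists x, cov_of p_pr (top_cov k) x = P.
  move=> /(numpoly_surj p_pr)[a ak aP].
  have [|x _ xa] := coord_surj C_coord (v := a).
    by rewrite (leq_trans ak) // leq_pexp2l.
  by exists x; rewrite -aP /= /cov_fun_of xa modn_small.
apply/(gadget_isogP _ gG hG (leq_addl _ _) lt9 full)/pinbP => -[phi [hM hi hE]]; exists phi; split=> // x.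
  apply: (numpoly_inj p_pr (cov_lt hD _) _ (hE x)); first by rewrite ltn_pmod // expn_gt0 p0.
by rewrite /= /cov_fun_of hE.
Qed.

(* The functionals on [H] are the linear combinations, with digits of [c] as coefficients, of coordinates. *)
Definition cand k (D : hT -> nat) c y :=
  D y + p ^ k * ((\sum_(j < l) (c %/ p ^ j) * (E y %/ p ^ j)) %% p).

Lemma candF c y : ((\sum_(j < l) (c %/ p ^ j) * (E y %/ p ^ j))%N%:R =
   \sum_(j < l) dg p j c * dg p j (E y) :> 'F_p)%R.
Proof. by rewrite natr_sum; apply: eq_bigr => j _; rewrite natrM. Qed.

Lemma cand_cov k D c : is_cov p k D -> is_cov p k.+1 (cand k D c).
Proof.
move=> hD; apply: (is_cov_top p_pr hD) => x y; rewrite !candF -big_split /=.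
by apply: eq_bigr => j _; rewrite (coord_additive p_pr E_coord) mulrDr.
Qed.

Lemma coord_dim (G : finGroupType) n (F : G -> nat) : coord p [set: G] n F -> #|G| = N -> n <= l.
Proof.
move=> h cG; rewrite -(leq_exp2l _ _ (prime_gt1 p_pr)) -N_eq -cG -cardsT -(coord_card h).
by rewrite leq_pmulr ?cardG_gt0.
Qed.

(** The digit of weight [p ^ k] of [C], carried to [hT] by the inverse of [phi], is a functional
    there and therefore one of the candidates. So [phi] itself remains admissible. *)
Lemma cand_exists k D (phi : gT -> hT) : {morph phi : x y / (x * y)%g} -> injective phi ->
  (forall x, D (phi x) = C x %% p ^ k) ->
  exists2 c, c < p ^ n2 & forall x, cand k D c (phi x) = C x %% p ^ k.+1.
Proof.
move=> hM hi hD.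
have [|psi phiK psiK] := inj_card_bij hi; first by rewrite cardG cardH.
have psiM x y : (psi (x * y) = psi x * psi y)%g by apply: hi; rewrite hM !psiK.
pose h y := dg p k (C (psi y)).
have hadd x y : (h (x * y)%g = h x + h y)%R.
  by rewrite /h psiM (coord_additive p_pr C_coord).
have [c cn hc] := coord_functional p_pr E_coord hadd.
exists c => // x.
have n2l : n2 <= l by apply: coord_dim E_coord cardH.
have sumE : (\sum_(j < l) (c %/ p ^ j) * (E (phi x) %/ p ^ j))%N%:R%R = dg p k (C x).
  rewrite candF -{2}(phiK x) -/(h (phi x)) hc.
  rewrite -(subnKC n2l) big_split_ord /= [X in (_ + X)%R]big1 ?addr0 // => j _.
  rewrite dg_small ?mul0r // (leq_trans cn) // leq_pexp2l //; exact: leq_addr.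
rewrite /cand hD; move: sumE; set S := (\sum_(j < l) _)%N; rewrite /dg => /eqP.
rewrite natFp_eq // => /eqP ->.
by rewrite modn_expS.
Qed.

Lemma pin_extend k D : pinb k C D -> exists2 c, c < p ^ n2 & pinb k.+1 C (cand k D c).
Proof.
move=> /pinbP[phi [hM hi hD]]; have [c cn hc] := cand_exists hM hi hD.
by exists c => //; apply/pinbP; exists phi.
Qed.

(** Elements with coordinates [p ^ i] read off the digits of [c]. *)
Lemma cand_inj k D c c' : c < p ^ n2 -> c' < p ^ n2 -> cand k D c =1 cand k D c' -> c = c'.
Proof.
move=> cn cn' cc; apply: (dg_ext p_pr cn cn') => i ilt.
have n2l : n2 <= l by apply: coord_dim E_coord cardH.
have [|y _ yi] := coord_surj E_coord (v := p ^ i); first by rewrite ltn_exp2l ?prime_gt1.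
have /addnI/eqP := cc y; rewrite eqn_pmul2l ?expn_gt0 ?p0 // -natFp_eq // !candF.
have sE d : (\sum_(j < l) dg p j d * dg p j (E y) = dg p i d)%R.
  rewrite (bigD1 (Ordinal (leq_trans ilt n2l))) //= yi dg_exp // eqxx mulr1 big1 ?addr0 // => j ji.
  by rewrite dg_exp // -val_eqE /= in ji *; rewrite (negbTE ji) mulr0.
by rewrite !sE => /eqP.
Qed.

Lemma isog_pin0 : ([set: gT] \isog [set: hT])%g -> pinb 0 C (fun=> 0).
Proof.
move=> /isog_bij[f [g [fM fK gK]]]; apply/pinbP; exists f; split=> //.
  exact: can_inj fK.
by move=> x; rewrite expn0 modn1.
Qed.

End Pins.

Section Static.
Variables (gT hT : finGroupType) (s : seq gT) (t : seq hT) (p N l n1 n2 : nat) (C : gT -> nat) (E : hT -> nat).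

(** What the coordinate passes leave behind and no pinning stage overwrites. *)
Record static (m : memory) : Prop := Static {
  st_base : base N p l m;
  st_T1 : tabl s m 1;
  st_T2 : tabl t m 2;
  st_C : forall x, m 11 (ix s x) = (C x).+1;
  st_E : forall y, m 21 (ix t y) = (E y).+1;
  st_w1 : m 13 0 = p ^ n1;
  st_w2 : m 23 0 = p ^ n2 }.

Definition kept := [:: 1; 2; 3; 4; 5; 6; 11; 13; 21; 23].

Lemma static_ext m m' : static m -> (forall x, x \in kept -> m' x =1 m x) -> static m'.
Proof.
move=> [a b c e f g h] k; split.
- by apply: (base_ext a) => x hx; apply: k; move: hx; rewrite !inE; lia.
- by apply: (tabl_ext b); apply: k.
- by apply: (tabl_ext c); apply: k.
- by move=> x; rewrite k.
- by move=> y; rewrite k.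
- by rewrite k.
- by rewrite k.
Qed.

End Static.

(** * One stage of pinning *)

Section Pinning.
Variables (gT hT : finGroupType) (s : seq gT) (t : seq hT) (O : oracle) (p N l : nat).
Hypotheses (gG : class2_expp p N gT) (hG : class2_expp p N hT) (N_eq : N = p ^ l) (l_gt0 : 0 < l).
Hypotheses (s_num : numbering s) (t_num : numbering t) (O_iso : iso_oracle p O).
Local Notation p_pr := (class2_prime gG).
Let p_prime : prime p. Proof. exact: p_pr. Qed.
Let cardG : #|gT| = N. Proof. by case: gG => _ _ _ _ <-; rewrite cardsT. Qed.
Let cardH : #|hT| = N. Proof. by case: hG => _ _ _ _ <-; rewrite cardsT. Qed.
Let p0 : 0 < p. Proof. exact: prime_gt0 p_pr. Qed.
Variables (n1 n2 : nat) (C : gT -> nat) (E : hT -> nat).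
Hypotheses (C_coord : coord p [set: gT] n1 C) (E_coord : coord p [set: hT] n2 E).
Notation B := (N ^ 50).
Let NB : N < B. Proof. exact: N_lt_B p_pr l_gt0 N_eq. Qed.
Let n1l : n1 <= l. Proof. exact: coord_dim gG N_eq _ _ _ C_coord cardG. Qed.
Let n2l : n2 <= l. Proof. exact: coord_dim gG N_eq _ _ _ E_coord cardH. Qed.
Let pX_ltB j : j <= 3 * l + 40 -> p ^ j < B.
Proof. exact: expp_lt_B. Qed.

Notation static := (static s t p N l n1 n2 C E).

Definition valid_q (q : query) := valid_query p B q.

Section Step.
Variables (k : nat) (D : hT -> nat).
Hypotheses (kn : k < n1) (D_cov : is_cov p k D).
Notation M := (N * p ^ (2 * l + k.+1 + 29)).
Notation numG := (gad_num s l (cov_of p_pr (top_cov gG C_coord k.+1))).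

(** The state between two candidates of one stage. The table of the first gadget is the same for all
    of them and is computed only once. *)
Record ready (m : memory) : Prop := Ready {
  rd_static : static m;
  rd_D : forall y, m 31 (ix t y) = D y;
  rd_k : m 43 0 = k;
  rd_L : m 42 0 = 2 * l + k.+1 + 29;
  rd_M : m 41 0 = M;
  rd_tab : table_at m 34 M = cayley numG }.

Lemma ready_ext m m' : ready m -> (forall x, x \in [:: 31; 34; 41; 42; 43] ++ kept -> m' x =1 m x) -> ready m'.
Proof.
move=> [a b c e f g] h; split.
- by apply: (static_ext a) => x hx; apply: h; rewrite mem_cat hx orbT.
- by move=> y; rewrite h.
- by rewrite h.
- by rewrite h.
- by rewrite h.
- by rewrite -g; apply: eq_map => i; rewrite h.
Qed.

Let kl : k.+1 <= l. Proof. exact: leq_trans kn n1l. Qed.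

Lemma try_candidate_ok c m : ready m -> c < p ^ n2 ->
  let u := run O B [:: c; k] try_candidate m in
  [/\ forall x, x \notin [:: 32; 33; 35; 36; 37] -> u.1 x =1 m x,
      forall j, u.1 37 j = if (j == k) && pinb p k.+1 C (cand p l E k D c) then (m 37 k).+1 %% B else m 37 j,
      forall y, u.1 33 (ix t y) = if pinb p k.+1 C (cand p l E k D c) then cand p l E k D c y else m 33 (ix t y)
    & forall q, q \in u.2 -> valid_q q].
Proof.
move=> rm cn; have [[mb T1 T2 mC mE w1 w2] mD mk mL mM mtab] := rm.
have [mN mP ml mpow] := mb.
set D' := cand p l E k D c.
have D'cov : is_cov p k.+1 D' by apply: cand_cov gG _ _ E_coord _ _ _ D_cov.
rewrite /try_candidate; set a1 := PFor _ (PSet 32 _ _); set a2 := gadget_table _ _ _.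
set a3 := PQry _ _ _ _ _; set a4 := PIf _ _ _; cbv zeta.
set r := [:: c; k].
set m1 := (run O B r a1 m).1.
set m2 := (run O B r a2 m1).1.
set m3 := (run O B r a3 m2).1.
have D'B y : D' y < B.
  apply: leq_trans (cov_lt D'cov y) _; apply: ltnW; apply: pX_ltB; lia.
have h1 y : m1 32 (ix t y) = D' y.
  rewrite /m1 run_fill //= mN -cardH ix_lt // mD mk mpow ?ml ?mP ?mE; last by lia.
  rewrite subn1 /= cardH modn_small; last first.
    rewrite (_ : D y + _ = D' y) //.
    by congr (_ + _ * (_ %% _)); apply: eq_bigr => j _; rewrite !mpow //; have := ltn_ord j; lia.
  by congr (_ + _ * (_ %% _)); apply: eq_bigr => j _; rewrite !mpow //; have := ltn_ord j; lia.
have f1 x : x != 32 -> m1 x =1 m x by move=> hx j; rewrite /m1 run_frame // inE.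
have tabH : table_at m2 35 M = cayley (gad_num t l (cov_of p_pr D'cov)).
  have HN : #|hT| = p ^ l by rewrite cardH.
  have b1 : base #|hT| p l m1 by rewrite cardH; apply: (base_ext mb) => x hx; apply: f1; move: hx; rewrite !inE; lia.
  have t1 : tabl t m1 2 by apply: (tabl_ext T2); apply: f1.
  have L1 : m1 42 0 = 2 * l + k.+1 + 29 by rewrite f1.
  have M1 : m1 41 0 = #|hT| * p ^ (2 * l + k.+1 + 29) by rewrite f1 // cardH.
  have := gadget_table_ok O t_num p_pr l_gt0 HN (c := cov_of p_pr D'cov) (cov_lt D'cov) (fun=> erefl) kl
    (T := 2) (co := 32) (out := 35) r b1 t1 h1 L1 M1 isT isT isT.
  by rewrite cardH => ->.
have f2 x : x != 35 -> m2 x =1 m1 x by move=> hx j; rewrite /m2 run_frame // inE.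
have tabG : table_at m2 34 M = cayley numG.
  by rewrite -mtab; apply: eq_map => i; rewrite f2 ?f1.
have M2 : m2 41 0 = M by rewrite f2 // f1.
have GN : #|gT| = p ^ l by rewrite cardG.
have gnum := gad_numP s_num p_pr l_gt0 GN (cov_of p_pr (top_cov gG C_coord k.+1)) kl.
have HN : #|hT| = p ^ l by rewrite cardH.
have hnum := gad_numP t_num p_pr l_gt0 HN (cov_of p_pr D'cov) kl.
have clG := gadget_class_le2 (l + 9) (cov_of p_pr (top_cov gG C_coord k.+1)) (class2_le2 gG) (class2_odd gG).
have clH := gadget_class_le2 (l + 9) (cov_of p_pr D'cov) (class2_le2 hG) (class2_odd gG).
have ans : O (cayley numG) (cayley (gad_num t l (cov_of p_pr D'cov))) = pinb p k.+1 C D'.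
  by rewrite (O_iso clG clH gnum hnum) (isog_pin gG hG N_eq l_gt0 C_coord).
have E3 : run O B r a3 m2 = (update m2 36 0 (pinb p k.+1 C D'), [:: (cayley numG, cayley (gad_num t l (cov_of p_pr D'cov)))]).
  by rewrite /a3 [run _ _ _ _ _]/= M2 tabG tabH ans.
have q1 : (run O B r a1 m).2 = [::] by apply: run_quiet.
have q2 : (run O B r a2 m1).2 = [::] by apply: run_quiet.
have q4 : (run O B r a4 m3).2 = [::] by apply: run_quiet.
have Eu1 : (run O B r (a1 ;; a2 ;; a3 ;; a4) m).1 = (run O B r a4 m3).1 by [].
have Eu2 : (run O B r (a1 ;; a2 ;; a3 ;; a4) m).2 = [:: (cayley numG, cayley (gad_num t l (cov_of p_pr D'cov)))].
  have -> : (run O B r (a1 ;; a2 ;; a3 ;; a4) m).2 =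
    (run O B r a1 m).2 ++ ((run O B r a2 m1).2 ++ ((run O B r a3 m2).2 ++ (run O B r a4 m3).2)) by [].
  by rewrite q1 q2 q4 E3.
have m3E : m3 = update m2 36 0 (pinb p k.+1 C D') by rewrite /m3 E3.
have m3_36 : m3 36 0 = pinb p k.+1 C D' by rewrite m3E updE.
have f3 x : x \notin [:: 32; 33; 35; 36; 37] -> m3 x =1 m x.
  move=> hx j; rewrite m3E updN; last by move: hx; rewrite !inE; lia.
  by rewrite f2 ?f1 //; move: hx; rewrite !inE; lia.
have m3_37 j : m3 37 j = m 37 j by rewrite m3E updN // f2 // f1.
have m3_33 j : m3 33 j = m 33 j by rewrite m3E updN // f2 // f1.
have m3_32 y : m3 32 (ix t y) = D' y by rewrite m3E updN // f2.
have E4 : run O B r a4 m3 = if pinb p k.+1 C D' then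
    run O B r (37 |{ cell 43 } <- RBin Add (RGet 37 (cell 43)) (K 1) ;; PFor (cell 3) (33 |{ X 0 } <- RGet 32 (X 0))) m3
    else (m3, [::]).
  by rewrite /a4 [LHS]/= m3_36; case: (pinb _ _ _ _).
split.
- move=> x hx j; rewrite Eu1 run_frame ?f3 //.
  by move: hx; rewrite !inE; lia.
- move=> j; rewrite Eu1 E4; case: (pinb _ _ _ _); last by rewrite andbF /= m3_37.
  set a5 := PSet 37 _ _; set a6 := PFor _ _.
  have -> : (run O B r (a5 ;; a6) m3).1 37 j = (run O B r a5 m3).1 37 j.
    have -> : (run O B r (a5 ;; a6) m3).1 = (run O B r a6 (run O B r a5 m3).1).1 by [].
    by apply: run_frame; rewrite inE.
  have m3_43 : m3 43 0 = k by rewrite f3.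
  rewrite /a5 /= m3_43 !m3_37 addn1 andbT /update /=.
  by case: eqP => // _; rewrite m3_37.
- move=> y; rewrite Eu1 E4; case: (pinb _ _ _ _); last by rewrite /= m3_33.
  set a5 := PSet 37 _ _; set a6 := PFor _ _.
  have -> : (run O B r (a5 ;; a6) m3).1 = (run O B r a6 (run O B r a5 m3).1).1 by [].
  have yN : ix t y < N by rewrite -cardH ix_lt.
  have m5 x j : x != 37 -> (run O B r a5 m3).1 x j = m3 x j by move=> hx; apply: run_frame; rewrite inE.
  rewrite /a6 run_fill // eqxx.
  have -> : reval (run O B r a5 m3).1 r (cell 3) = N by rewrite -mN -f3 // -m5.
  have -> : reval (run O B r a5 m3).1 (ix t y :: r) (RGet 32 (X 0)) = D' y by rewrite -m3_32 -m5.
  by rewrite yN modn_small.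
move=> q; rewrite Eu2 inE => /eqP ->.
exists (gadget (l + 9) (cov_of p_pr (top_cov gG C_coord k.+1))), (gadget (l + 9) (cov_of p_pr D'cov)), numG, (gad_num t l (cov_of p_pr D'cov)).
split=> //; rewrite !card_gadget // !cardsT cardG cardH.
have -> : l + 9 + 3 + (l + 9 + k.+1 + 8) = 2 * l + k.+1 + 29 by lia.
have MB : M <= B by rewrite N_eq -expnD -expnM leq_pexp2l //; lia.
by [].
Qed.

End Step.
End Pinning.

Section PinNext.
Variables (gT hT : finGroupType) (s : seq gT) (t : seq hT) (O : oracle) (p N l : nat).
Hypotheses (gG : class2_expp p N gT) (hG : class2_expp p N hT) (N_eq : N = p ^ l) (l_gt0 : 0 < l).
Hypotheses (s_num : numbering s) (t_num : numbering t) (O_iso : iso_oracle p O).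
Local Notation p_pr := (class2_prime gG).
Let p_prime : prime p. Proof. exact: p_pr. Qed.
Let cardG : #|gT| = N. Proof. by case: gG => _ _ _ _ <-; rewrite cardsT. Qed.
Let cardH : #|hT| = N. Proof. by case: hG => _ _ _ _ <-; rewrite cardsT. Qed.
Let p0 : 0 < p. Proof. exact: prime_gt0 p_pr. Qed.
Variables (n1 n2 : nat) (C : gT -> nat) (E : hT -> nat).
Hypotheses (C_coord : coord p [set: gT] n1 C) (E_coord : coord p [set: hT] n2 E).
Notation B := (N ^ 50).
Let NB : N < B. Proof. exact: N_lt_B p_pr l_gt0 N_eq. Qed.
Let n1l : n1 <= l. Proof. exact: coord_dim gG N_eq _ _ _ C_coord cardG. Qed.
Let n2l : n2 <= l. Proof. exact: coord_dim gG N_eq _ _ _ E_coord cardH. Qed.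
Let pX_ltB j : j <= 3 * l + 40 -> p ^ j < B.
Proof. exact: expp_lt_B. Qed.
Notation static := (static s t p N l n1 n2 C E).

Section Next.
Variables (k fin : nat) (D E0 : hT -> nat).
Hypotheses (kn : k < n1) (D_cov : is_cov p k D) (E0_cov : is_cov p k E0) (fin_ok : (fin == 30) || (fin == 33)).
Notation ready := (ready s t l gG n2 E C_coord k D).
Notation hit c := (pinb p k.+1 C (cand p l E k D c)).

(** Array 33 has to hold a covector even if no candidate succeeds, as happens for groups that are
    not isomorphic, because the later queries must be valid all the same. This is why its previous
    content [E0], read with one more digit, enters. *)
Lemma pin_next_ok m : static m -> (forall y, m 31 (ix t y) = D y) -> (forall y, m 33 (ix t y) = E0 y) ->
  let u := run O B [:: k] (pin_next fin) m in
  [/\ static u.1, forall x, x \in [:: 12; 14; 22] -> u.1 x =1 m x,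
      forall j, u.1 37 j = if j == k then \sum_(c < p ^ n2) hit c else m 37 j,
      exists E' : hT -> nat, [/\ is_cov p k.+1 E', forall y, u.1 33 (ix t y) = E' y &
         forall c, c < p ^ n2 -> hit c -> pinb p k.+1 C E'] &
      [/\ forall x, u.1 30 (ix s x) = C x %% p ^ k.+1,
      forall j, j < N -> u.1 31 j = u.1 fin j
    & forall q, q \in u.2 -> valid_q p N q]].
Proof.
move=> st mD mE.
have fr : forall x, x \in kept ++ [:: 12; 14; 22] -> (run O B [:: k] (pin_next fin) m).1 x =1 m x.
  by move=> x hx j; apply: run_frame; move: hx; rewrite !inE; lia.
have kl : k.+1 <= l by apply: leq_trans kn n1l.
have kB : k.+1 < B by apply: leq_ltn_trans NB; apply: leq_trans kl _; rewrite N_eq ltnW // ltn_expl // prime_gt1.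
have [mb T1 T2 mC mEE w1 w2] := st; have [mN mP ml mpow] := mb.
pose u := run O B [:: k] (pin_next fin) m; rewrite -/u in fr *; cbv zeta.
move: fr; rewrite /u /pin_next; set r := [:: k].
set b1 := PSet 43 _ _; set b2 := PSet 40 _ _; set b3 := PSet 42 _ _; set b4 := PSet 41 _ _.
set b5 := PFor _ (PSet 30 _ _); set b6 := gadget_table 1 30 34; set b7 := PSet 37 _ _.
set b8 := PFor _ _; set b9 := PFor _ (PSet 31 _ _) => fr.
pose m1 := (run O B r b1 m).1; pose m2 := (run O B r b2 m1).1; pose m3 := (run O B r b3 m2).1.
pose m4 := (run O B r b4 m3).1; pose m5 := (run O B r b5 m4).1; pose m6 := (run O B r b6 m5).1.
pose m7 := (run O B r b7 m6).1; pose m8 := (run O B r b8 m7).1.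
set L := 2 * l + k.+1 + 29.
have LB : p ^ L < B by apply: pX_ltB; rewrite /L; lia.
have L_lt_B : L < B by apply: ltn_trans LB; rewrite ltn_expl // prime_gt1.
have MB : N * p ^ L < B by rewrite N_eq -expnD -expnM ltn_exp2l ?prime_gt1 // /L; lia.
have e43 : m1 43 0 = k by rewrite /m1 /= updE modn_small // ltnW.
have e40 : m2 40 0 = k.+1 by rewrite /m2 /= updE addn1 modn_small.
have f2 x : x \notin [:: 40; 43] -> m2 x =1 m x.
  by move=> hx j; rewrite /m2 /m1 !run_frame //; move: hx; rewrite !inE; lia.
have e42 : m3 42 0 = L by rewrite /m3 /= updE f2 // ml e40 modn_small.
have f4 x : x \notin [:: 40; 41; 42; 43] -> m4 x =1 m x.
  by move=> hx j; rewrite /m4 /m3 /m2 /m1 !run_frame //; move: hx; rewrite !inE; lia.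
have f3 x : x \notin [:: 40; 42; 43] -> m3 x =1 m x.
  by move=> hx j; rewrite /m3 /m2 /m1 !run_frame //; move: hx; rewrite !inE; lia.
have e41 : m4 41 0 = N * p ^ L.
  by rewrite /m4 /= updE f3 // mN e42 f3 // mpow ?modn_small // /L; lia.
have e40' : m4 40 0 = k.+1 by rewrite /m4 run_frame // /m3 run_frame.
have h30 x : m5 30 (ix s x) = C x %% p ^ k.+1.
  rewrite /m5 run_fill // eqxx.
  have -> : reval m4 r (cell 3) = N by rewrite -mN -f4.
  rewrite -cardG ix_lt //= f4 // mC f4 // e40' subn1 mpow /=; last by lia.
  rewrite cardG modn_small // (leq_ltn_trans (leq_mod _ _)) //.
  by apply: ltn_trans (pX_ltB (j := n1) _); [apply: coord_ltT|lia].
have f5 x : x != 30 -> m5 x =1 m4 x by move=> hx j; apply: run_frame; rewrite inE.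
have f6 x : x != 34 -> m6 x =1 m5 x by move=> hx j; apply: run_frame; rewrite inE.
have f7 x : x != 37 -> m7 x =1 m6 x by move=> hx j; apply: run_frame; rewrite inE.
have F7 x : x \notin [:: 30; 34; 37; 40; 41; 42; 43] -> m7 x =1 m x.
  by move=> hx j; rewrite f7 ?f6 ?f5 ?f4 //; move: hx; rewrite !inE; lia.
have R7 : ready m7.
  have st7 : static m7 by apply: (static_ext st) => x hx; apply: F7; move: hx; rewrite !inE; lia.
  split=> //.
  - by move=> y; rewrite F7.
  - by rewrite f7 // f6 // f5 // /m4 run_frame // /m3 run_frame // /m2 run_frame.
  - by rewrite f7 // f6 // f5 // /m4 run_frame.
  - by rewrite f7 // f6 // f5.
  have GN : #|gT| = p ^ l by rewrite cardG.
  have b5' : base #|gT| p l m5.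
    by rewrite cardG; apply: (base_ext mb) => x hx j; rewrite f5 ?f4 //; move: hx; rewrite !inE; lia.
  have t5 : tabl s m5 1 by apply: (tabl_ext T1) => j; rewrite f5 ?f4.
  have L5 : m5 42 0 = 2 * l + k.+1 + 29 by rewrite f5 // /m4 run_frame.
  have M5 : m5 41 0 = #|gT| * p ^ (2 * l + k.+1 + 29) by rewrite f5 // cardG.
  have := gadget_table_ok O s_num p_pr l_gt0 GN (c := cov_of p_pr (top_cov gG C_coord k.+1))
    (cov_lt (top_cov gG C_coord k.+1)) (fun=> erefl) kl (T := 1) (co := 30) (out := 34) r b5' t5 h30 L5 M5 isT isT isT.
  by rewrite cardG => <-; apply: eq_map => i; rewrite f7.
have st7 := rd_static R7.
have pn2N : p ^ n2 <= N by rewrite N_eq leq_exp2l ?prime_gt1.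
(* [E'] is the last successful candidate, or [E0] as long as there is none. *)
pose I c (m' : memory) := [/\ ready m', forall x, x \notin [:: 32; 33; 35; 36; 37] -> m' x =1 m7 x,
   forall j, m' 37 j = if j == k then \sum_(c' < c) hit c' else m 37 j &
   exists E' : hT -> nat, [/\ is_cov p k.+1 E', forall y, m' 33 (ix t y) = E' y &
         forall c', c' < c -> hit c' -> pinb p k.+1 C E']].
have [] : I (reval m7 r (cell 23)) m8 /\ forall q, q \in (run O B r b8 m7).2 -> valid_q p N q.
  apply: run_for.
    split=> //.
      move=> j; rewrite big_ord0 /m7 /b7 /= /update /=; case: eqP => _; first by rewrite mod0n.
      by rewrite f6 // f5 // f4.
    exists E0; split=> // [|y]; first exact: is_cov_weak E0_cov.
    by rewrite F7.
  move=> c m'; have -> : reval m7 r (cell 23) = p ^ n2 by rewrite -(st_w2 st7).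
  move=> cn [rm' fr' h37 [E' [E'cov E'm E'hit]]].
  have [g1 g2 g3 g4] := try_candidate_ok hG N_eq l_gt0 s_num t_num O_iso E_coord kn D_cov rm' cn.
  split=> //; split.
  - by apply: (ready_ext rm') => x hx; apply: g1; move: hx; rewrite !inE; lia.
  - by move=> x hx j; rewrite g1 ?fr'.
  - move=> j; rewrite g2 h37; case: (j =P k) => [->|jk]; last by rewrite h37; move/eqP/negbTE: jk => ->.
    rewrite h37 eqxx big_ord_recr /=; case: (hit c); last by rewrite addn0.
    rewrite addn1 modn_small //.
    have : \sum_(c' < c) hit c' <= c.
      by rewrite -[X in _ <= X]card_ord -sum1_card; apply: leq_sum => c' _; case: (hit _).
    by move=> hs; apply: leq_ltn_trans NB; apply: leq_trans pn2N; apply: leq_ltn_trans hs cn.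
  exists (fun y => if hit c then cand p l E k D c y else E' y).
  have [hc|hc] := boolP (hit c).
    split; first exact: (cand_cov l gG E_coord c D_cov).
      by move=> y; rewrite g3 hc.
    by move=> c' _ _.
  split=> //; first by move=> y; rewrite g3 (negbTE hc) E'm.
  by move=> c'; rewrite ltnS leq_eqVlt => /orP[/eqP -> h|/E'hit//]; rewrite h in hc.
have -> : reval m7 r (cell 23) = p ^ n2 by rewrite -(st_w2 st7).
move=> [R8 fr8 h37 hE'] val8.
pose v := run O B r b9 m8.
have U1 : (run O B r (b1 ;; b2 ;; b3 ;; b4 ;; b5 ;; b6 ;; b7 ;; b8 ;; b9) m).1 = v.1 by [].
have f9 x : x != 31 -> v.1 x =1 m8 x by move=> hx j; apply: run_frame; rewrite inE.
have f31 : fin != 31 by lia.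
split.
- by apply: (static_ext st) => x hx; apply: fr; rewrite mem_cat hx.
- by move=> x hx; apply: fr; rewrite mem_cat hx orbT.
- by move=> j; rewrite U1 f9 // h37.
- by case: hE' => E' [h1 h2 h3]; exists E'; split=> // y; rewrite U1 f9.
split.
- by move=> x; rewrite U1 f9 // fr8 // f7 // f6.
- move=> j jN; rewrite U1 (f9 fin) // /v run_fill; last by rewrite !inE; lia.
  have -> : reval m8 r (cell 3) = N by rewrite -(baseN (st_base (rd_static R8))).
  rewrite eqxx jN /= modn_small //.
  have finE : (fin = 30 \/ fin = 33) by lia.
  case: finE => ->; rewrite -cardG in jN.
    by rewrite -(ixK s_num jN) fr8 // f7 // f6 // h30 (leq_ltn_trans (leq_mod _ _)) //;
       apply: ltn_trans (pX_ltB (j := n1) _); [apply: coord_ltT|lia].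
  rewrite cardG -cardH in jN; case: hE' => E' [h1 h2 _]; rewrite -(ixK t_num jN) h2.
  by apply: leq_trans (cov_lt h1 _) _; apply: ltnW; apply: pX_ltB; lia.
move=> q.
have -> : (run O B r (b1 ;; b2 ;; b3 ;; b4 ;; b5 ;; b6 ;; b7 ;; b8 ;; b9) m).2 =
  (run O B r b5 m4).2 ++ ((run O B r b6 m5).2 ++ ((run O B r b8 m7).2 ++ v.2)) by [].
have -> : (run O B r b5 m4).2 = [::] by apply: run_quiet.
have -> : (run O B r b6 m5).2 = [::] by apply: run_quiet.
have -> : v.2 = [::] by apply: run_quiet.
by rewrite cats0; apply: val8.
Qed.

End Next.
End PinNext.

Section PinAll.
Variables (gT hT : finGroupType) (s : seq gT) (t : seq hT) (O : oracle) (p N l : nat).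
Hypotheses (gG : class2_expp p N gT) (hG : class2_expp p N hT) (N_eq : N = p ^ l) (l_gt0 : 0 < l).
Hypotheses (s_num : numbering s) (t_num : numbering t) (O_iso : iso_oracle p O).
Local Notation p_pr := (class2_prime gG).
Let p_prime : prime p. Proof. exact: p_pr. Qed.
Let cardG : #|gT| = N. Proof. by case: gG => _ _ _ _ <-; rewrite cardsT. Qed.
Let cardH : #|hT| = N. Proof. by case: hG => _ _ _ _ <-; rewrite cardsT. Qed.
Variables (n1 n2 : nat) (C : gT -> nat) (E : hT -> nat).
Hypotheses (C_coord : coord p [set: gT] n1 C) (E_coord : coord p [set: hT] n2 E).
Notation B := (N ^ 50).
Let NB : N < B. Proof. exact: N_lt_B p_pr l_gt0 N_eq. Qed.
Let n1l : n1 <= l. Proof. exact: coord_dim gG N_eq _ _ _ C_coord cardG. Qed.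
Let lN : l < N. Proof. exact: l_lt_N p_pr N_eq. Qed.
Notation static := (static s t p N l n1 n2 C E).
Notation same_on A m' m := (forall x, x \in A -> m' x =1 m x).

(** Searching and counting share the loop and differ only in what [Q] records about the pins. *)
Lemma pin_all_ind fin (Q : nat -> memory -> Prop) m : static m ->
  (forall m', static m' -> (forall y, m' 31 (ix t y) = 0) -> (forall y, m' 33 (ix t y) = 0) ->
     m' 37 =1 m 37 -> Q 0 m') ->
  (forall k m', k < n1 -> static m' -> Q k m' -> let u := run O B [:: k] (pin_next fin) m' in
     [/\ static u.1, same_on [:: 12; 14; 22] u.1 m', Q k.+1 u.1 & forall q, q \in u.2 -> valid_q p N q]) ->
  let u := run O B [::] (pin_all fin) m in
  [/\ static u.1, same_on [:: 12; 22] u.1 m, u.1 14 0 = n1, Q n1 u.1 & forall q, q \in u.2 -> valid_q p N q].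
Proof.
move=> st Q0 Qstep; rewrite /pin_all.
set b1 := PSet 14 _ _; set b2 := PFor _ (PSet 31 _ _); set b3 := PFor _ (PSet 33 _ _).
set b4 := PFor _ _; cbv zeta; set r := [::].
pose m1 := (run O B r b1 m).1; pose m2 := (run O B r b2 m1).1; pose m3 := (run O B r b3 m2).1.
pose v := run O B r b4 m3.
have -> : (run O B r (b1 ;; b2 ;; b3 ;; b4) m).1 = v.1 by [].
have -> : (run O B r (b1 ;; b2 ;; b3 ;; b4) m).2 =
  (run O B r b2 m1).2 ++ ((run O B r b3 m2).2 ++ v.2) by [].
have -> : (run O B r b2 m1).2 = [::] by apply: run_quiet.
have -> : (run O B r b3 m2).2 = [::] by apply: run_quiet.
rewrite !cat0s.
have f3 x : x \notin [:: 14; 31; 33] -> m3 x =1 m x.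
  by move=> hx j; rewrite /m3 /m2 /m1 !run_frame //; move: hx; rewrite !inE; lia.
have st3 : static m3 by apply: (static_ext st) => x hx; apply: f3; move: hx; rewrite !inE; lia.
have hN m' : m' 3 0 = m 3 0 -> reval m' r (cell 3) = N by move=> h; rewrite -(baseN (st_base st)) -h.
have z31 y : m3 31 (ix t y) = 0.
  rewrite /m3 run_frame // /m2 run_fill // hN; last by rewrite /m1 run_frame.
  by rewrite -cardH ix_lt // eqxx mod0n.
have z33 y : m3 33 (ix t y) = 0.
  rewrite /m3 run_fill // hN; last by rewrite /m2 run_frame // /m1 run_frame.
  by rewrite -cardH ix_lt // eqxx mod0n.
have h14 : m3 14 0 = n1.
  rewrite /m3 run_frame // /m2 run_frame // /m1.
  have -> : (run O B r b1 m).1 14 0 = reval m r (num_divisors (cell 13)) %% B by rewrite /= updE.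
  rewrite /= (st_w1 st) addn1 count_divisors // modn_small //.
  by apply: leq_ltn_trans n1l _; apply: ltn_trans lN NB.
pose I k m' := [/\ static m', same_on [:: 12; 14; 22] m' m3 & Q k m'].
have : I (reval m3 r (cell 14)) v.1 /\ forall q, q \in v.2 -> valid_q p N q.
  apply: run_for; first by split=> //; apply: Q0 => //; apply: f3.
  move=> k m'; have -> : reval m3 r (cell 14) = n1 by rewrite -h14.
  move=> kn [st' s' Q']; have [st'' s'' Q'' v''] := Qstep _ _ kn st' Q'.
  by split=> //; split=> // x hx j; rewrite s'' ?s'.
have -> : reval m3 r (cell 14) = n1 by rewrite -h14.
move=> [[st' s' Q'] v']; split=> //.
- move=> x hx j; rewrite s'; last by move: hx; rewrite !inE; lia.
  by apply: f3; move: hx; rewrite !inE; lia.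
- by rewrite s'.
Qed.

(** Isomorphism is a premise of the final pin alone; [D] is a covector and the queries are valid for
    every input. *)
Lemma pin_all_search m : static m -> let u := run O B [::] (pin_all 33) m in
  exists D, [/\ static u.1, same_on [:: 12; 22] u.1 m, u.1 14 0 = n1,
    is_cov p n1 D /\ (forall y, u.1 31 (ix t y) = D y)
    & (([set: gT] \isog [set: hT])%g -> pinb p n1 C D) /\ forall q, q \in u.2 -> valid_q p N q].
Proof.
move=> st; pose Q k (m' : memory) := exists D, [/\ is_cov p k D, forall y, m' 31 (ix t y) = D y,
  forall y, m' 33 (ix t y) = D y & ([set: gT] \isog [set: hT])%g -> pinb p k C D].
suff [st' s' h14 [D [h1 h2 _ h4]] hq] : let u := run O B [::] (pin_all 33) m in
  [/\ static u.1, same_on [:: 12; 22] u.1 m, u.1 14 0 = n1, Q n1 u.1 & forall q, q \in u.2 -> valid_q p N q].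
  by exists D; split.
apply: pin_all_ind => // [m' _ h31 h33 _|k m' kn st' [D [Dcov h31 h33 Dpin]]].
  by exists (fun=> 0); split=> //; [apply: is_cov0|move=> iso; apply: (isog_pin0 p C iso)].
have [s1 s2 s3 [E' [h1 h2 h3]] [s4 s5 s6]] := pin_next_ok gG hG N_eq l_gt0 s_num t_num O_iso C_coord
  E_coord (fin := 33) kn Dcov Dcov isT st' h31 h33.
split=> //; exists E'; split=> //; first by move=> y; rewrite s5 // -cardH ix_lt.
move=> iso; have [c cn hc] := pin_extend gG hG N_eq C_coord E_coord (Dpin iso).
exact: h3 hc.
Qed.

End PinAll.

Section PinAllSelf.
Variables (gT : finGroupType) (s : seq gT) (O : oracle) (p N l : nat).
Hypotheses (gG : class2_expp p N gT) (N_eq : N = p ^ l) (l_gt0 : 0 < l).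
Hypotheses (s_num : numbering s) (O_iso : iso_oracle p O).
Variables (n1 n2 : nat) (C E : gT -> nat).
Hypotheses (C_coord : coord p [set: gT] n1 C) (E_coord : coord p [set: gT] n2 E).
Notation B := (N ^ 50).

(** The length of the orbit of the next coordinate under the automorphisms that fix the first [k]
    coordinates. *)
Definition num_images k := \sum_(c < p ^ n2) pinb p k.+1 C (cand p l E k (fun x => C x %% p ^ k) c).

(** Coordinates are pinned to themselves, so each stage sees exactly the automorphisms fixing the
    earlier ones. *)
Lemma pin_all_count m : static s s p N l n1 n2 C E m -> let u := run O B [::] (pin_all 30) m in
  [/\ static s s p N l n1 n2 C E u.1, u.1 14 0 = n1, forall k, k < n1 -> u.1 37 k = num_images k
    & forall q, q \in u.2 -> valid_q p N q].
Proof.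
move=> st; pose Q k (m' : memory) := [/\ forall x, m' 31 (ix s x) = C x %% p ^ k,
  exists2 D, is_cov p k D & forall y, m' 33 (ix s y) = D y &
  forall j, j < k -> m' 37 j = num_images j].
have p_pr := class2_prime gG.
have cardG : #|gT| = N by case: gG => _ _ _ _ <-; rewrite cardsT.
suff [st' s' h14 [h1 h2 h3] hq] : let u := run O B [::] (pin_all 30) m in
  [/\ static s s p N l n1 n2 C E u.1, forall x, x \in [:: 12; 22] -> u.1 x =1 m x, u.1 14 0 = n1, Q n1 u.1 & forall q, q \in u.2 -> valid_q p N q].
  by [].
apply: (pin_all_ind gG gG) => // [m' _ h31 h33 _|k m' kn st' [h31 [D Dcov h33] h37]].
  split=> // [x|]; first by rewrite expn0 modn1.
  by exists (fun=> 0) => //; apply: is_cov0.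
have [s1 s2 s3 [E' [h1 h2 h3]] [s4 s5 s6]] := pin_next_ok gG gG N_eq l_gt0 s_num s_num O_iso C_coord
  E_coord (fin := 30) kn (top_cov gG C_coord k) Dcov isT st' h31 h33.
split=> //; split=> [x||j jk]; first by rewrite s5 ?s4 // -cardG ix_lt.
  by exists E'.
rewrite s3; case: eqP => [->//|/eqP jk']; apply: h37.
by rewrite ltn_neqAle jk' -ltnS.
Qed.

End PinAllSelf.

(** * Changing a homomorphism by elements of the derived subgroup *)

Section Twist.
Variables (gT hT : finGroupType) (p N : nat).
Hypotheses (gG : class2_expp p N gT) (hG : class2_expp p N hT).
Local Notation p_pr := (class2_prime gG).
Let p_prime : prime p. Proof. exact: p_pr. Qed.
Variables (n : nat) (C : gT -> nat).
Hypothesis C_coord : coord p [set: gT] n C.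
Notation H' := [set: hT]^`(1)%g.
Notation G' := [set: gT]^`(1)%g.
Notation dgC j x := (dg p j (C x) : nat).

Lemma expg_Fp (z : hT) (a b : 'F_p) : (z ^+ (a + b : 'F_p)%R = z ^+ a * z ^+ b)%g.
Proof.
have -> : ((a + b)%R : nat) = (a + b)%N %% p by rewrite -val_Fp_nat // natrD !natr_Zp.
by rewrite expg_mod ?expgD //; apply: expg_p1 (class2_le2 hG) z.
Qed.

Definition twist (phi : gT -> hT) (z : 'I_n -> hT) x := (phi x * \prod_(j < n) z j ^+ dgC j x)%g.

Variables (phi : gT -> hT) (z : 'I_n -> hT).
Hypotheses (phiM : {morph phi : x y / (x * y)%g}) (zH : forall j, z j \in H').

Lemma twist_der x : (\prod_(j < n) z j ^+ dgC j x)%g \in H'.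
Proof. by apply: group_prod => j _; apply: groupX. Qed.

(** Digits are additive modulo [p], and the [z j] are central with [p]-th power 1, so the correction
    factor is a homomorphism into the centre. *)
Lemma twistM : {morph twist phi z : x y / (x * y)%g}.
Proof.
have cen a b : a \in H' -> commute a b by move=> h; apply: (der_central (class2_le2 hG)).
move=> x y; rewrite /twist phiM -!mulgA; congr (_ * _)%g.
rewrite [RHS]mulgA (cen _ (phi y) (twist_der x)) -mulgA; congr (_ * _)%g.
elim: (index_enum _) => [|j r IH]; first by rewrite !big_nil mulg1.
rewrite !big_cons IH (coord_additive p_pr C_coord) expg_Fp -!mulgA; congr (_ * _)%g.
rewrite !mulgA; congr (_ * _)%g; apply: cen; exact: groupX.
Qed.

Hypothesis phi_inj : injective phi.

Lemma der_preim x : phi x \in H' -> x \in G'.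
Proof.
have same : #|gT| = #|hT| by case: gG hG => _ _ _ _ + [_ _ _ _]; rewrite !cardsT => -> ->.
have [f [/isomP[_ fG] fE]] := inj_hom_isog phiM phi_inj same.
rewrite -[[set: hT]]fG -morphim_der // => /morphimP[y _ yG].
by rewrite fE => /phi_inj ->.
Qed.

(** For a kernel element, [phi] takes a value in the derived subgroup, so the element lies in the
    derived subgroup itself. There all digits vanish and the twist agrees with [phi]. *)
Lemma twist_inj : injective (twist phi z).
Proof.
suff ker x : twist phi z x = 1%g -> x = 1%g.
  move=> x y e; apply: (mulIg y^-1%g); rewrite mulgV; apply: ker.
  have t1 : twist phi z 1%g = 1%g by apply: (mulgI (twist phi z 1%g)); rewrite -twistM !mulg1.
  by apply: (mulIg (twist phi z y)); rewrite -twistM mulgKV mul1g.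
move=> tx.
have xG : x \in G'.
  apply: der_preim; rewrite -(mulgK (\prod_(j < n) z j ^+ dgC j x)%g (phi x)).
  by rewrite -/(twist phi z x) tx mul1g groupV twist_der.
have phi1 : phi 1%g = 1%g by apply: (mulgI (phi 1%g)); rewrite -phiM !mulg1.
apply: phi_inj; rewrite phi1 -tx /twist big1 ?mulg1 // => j _.
by move: xG; rewrite -(coord_ker C_coord) ?inE // => /eqP ->; rewrite dg0 expg0.
Qed.

Lemma twist_basis (b : 'I_n -> gT) j : (forall j : 'I_n, C (b j) = p ^ j) -> twist phi z (b j) = (phi (b j) * z j)%g.
Proof.
move=> bC; rewrite /twist; congr (_ * _)%g.
rewrite (eq_bigr (fun i => if i == j then z j else 1%g)) => [|i _]; last first.
  by rewrite bC dg_exp // (val_eqE i j); case: eqP => [->|_]; rewrite ?expg1.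
by rewrite -big_mkcond big_pred1_eq.
Qed.

End Twist.

(** Together with the derived subgroup [K] is everything, and the derived subgroup lies in the
    Frattini subgroup. *)
Lemma coord_gen (gT : finGroupType) p N n (C : gT -> nat) (b : 'I_n -> gT) (K : {group gT}) :
  class2_expp p N gT -> coord p [set: gT] n C -> (forall j : 'I_n, C (b j) = p ^ j) ->
  (forall j, b j \in K) -> K :=: [set: gT].
Proof.
move=> gG cC bC bK; have p_pr := class2_prime gG.
have pG : (p.-group [set: gT])%g by case: gG.
rewrite -(genGid K); apply: Phi_nongen; apply/eqP; rewrite eqEsubset subsetT /=.
apply/subsetP => x _; rewrite -(mulKVg (coord_word p C b x) x) groupM //.
  by apply/mem_gen/setUP; right; apply: group_prod => j _; apply: groupX.
apply/mem_gen/setUP; left; rewrite (Phi_joing pG); apply/mem_gen/setUP; left.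
by apply: coord_wordP.
Qed.

Lemma hom_eq_basis (gT hT : finGroupType) p N n (C : gT -> nat) (b : 'I_n -> gT) (f g : gT -> hT) :
  class2_expp p N gT -> coord p [set: gT] n C -> (forall j : 'I_n, C (b j) = p ^ j) ->
  {morph f : x y / (x * y)%g} -> {morph g : x y / (x * y)%g} ->
  (forall j, f (b j) = g (b j)) -> f =1 g.
Proof.
move=> gG cC bC fM gM fg.
have Kg : group_set [set x | f x == g x].
  apply/group_setP; split=> [|x y]; rewrite !inE; last by rewrite fM gM => /eqP -> /eqP ->.
  have h1 (h : gT -> hT) : {morph h : x y / (x * y)%g} -> h 1%g = 1%g.
    by move=> hM; apply: (mulgI (h 1%g)); rewrite -hM !mulg1.
  by rewrite !h1.
have : Group Kg :=: [set: gT] by apply: coord_gen gG cC bC _ => j; rewrite inE fg.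
by move=> E x; have := in_setT x; rewrite -E inE => /eqP.
Qed.

(** * Counting automorphisms *)

Section CountAut.
Variables (gT : finGroupType) (p N l : nat).
Hypotheses (gG : class2_expp p N gT) (N_eq : N = p ^ l).
Local Notation p_pr := (class2_prime gG).
Let p_prime : prime p. Proof. exact: p_pr. Qed.
Let cardG : #|gT| = N. Proof. by case: gG => _ _ _ _ <-; rewrite cardsT. Qed.
Variables (n n2 : nat) (C E : gT -> nat).
Hypotheses (C_coord : coord p [set: gT] n C) (E_coord : coord p [set: gT] n2 E).
Notation G' := [set: gT]^`(1)%g.
Notation candm k c := (cand p l E k (fun x => C x %% p ^ k) c).

Definition aut_fix k := [set a in Aut [set: gT] | [forall x, C (a x) %% p ^ k == C x %% p ^ k]].

Definition aut_hit k c := [set a in Aut [set: gT] | [forall x, candm k c (a x) == C x %% p ^ k.+1]].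

Lemma aut_hom (a : {perm gT}) : reflect {morph a : x y / (x * y)%g} (a \in Aut [set: gT]).
Proof.
apply: (iffP idP) => [/Aut_morphic/morphicP aM x y|aM]; first by apply: aM; rewrite inE.
rewrite inE; apply/andP; split; first by apply/subsetP => x; rewrite inE.
by apply/morphicP => x y _ _; apply: aM.
Qed.

Lemma aut_fixP k (a : {perm gT}) : reflect ({morph a : x y / (x * y)%g} /\ forall x, C (a x) %% p ^ k = C x %% p ^ k)
  (a \in aut_fix k).
Proof.
rewrite inE; apply: (iffP andP) => -[/aut_hom h1 h2]; split=> //; last by apply/forallP => x; rewrite h2.
by move=> x; apply/eqP/(forallP h2).
Qed.

Lemma aut_hitP k c (a : {perm gT}) : reflect ({morph a : x y / (x * y)%g} /\ forall x, candm k c (a x) = C x %% p ^ k.+1)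
  (a \in aut_hit k c).
Proof.
rewrite inE; apply: (iffP andP) => -[/aut_hom h1 h2]; split=> //; last by apply/forallP => x; rewrite h2.
by move=> x; apply/eqP/(forallP h2).
Qed.

Lemma aut0 : aut_fix 0 = Aut [set: gT].
Proof.
apply/setP => a; rewrite inE; case: (a \in Aut _) => //=.
by apply/forallP => x; rewrite expn0 !modn1.
Qed.

(** If one automorphism realises the candidate, those that do form a coset of the stabiliser
    [aut_fix k.+1]. *)
Lemma card_hit k c : #|aut_hit k c| = pinb p k.+1 C (candm k c) * #|aut_fix k.+1|.
Proof.
have [/pinbP[phi [phiM phi_inj phiE]]|no] := boolP (pinb _ _ _ _); last first.
  rewrite mul0n; apply: eq_card0 => a; apply/negP => /aut_hitP[aM ha].
  by case/negP: no; apply/pinbP; exists a; split=> //; apply: perm_inj.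
rewrite mul1n; pose a0 := perm phi_inj.
have a0M : {morph a0 : x y / (x * y)%g} by move=> x y; rewrite !permE.
have a0VM : {morph a0^-1%g : x y / (x * y)%g}.
  by move=> x y; apply: (@perm_inj _ a0); rewrite a0M !permKV.
rewrite -(card_rcoset (aut_fix k.+1) a0); apply: eq_card => a.
rewrite mem_rcoset; apply/aut_hitP/aut_fixP => -[aM ha]; split.
- by move=> x y; rewrite !permM aM a0VM.
- by move=> x; rewrite permM -phiE -(permE phi_inj) -/a0 permKV ha.
- move=> x y; apply: (@perm_inj _ a0^-1%g).
  by rewrite a0VM -!permM aM.
move=> x; have := ha x; rewrite permM => <-.
by rewrite -phiE -(permE phi_inj) -/a0 permKV.
Qed.

(** Each automorphism fixing the first [k] coordinates realises exactly one candidate, so the sets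
    [aut_hit k c] partition [aut_fix k]. *)
Lemma card_aut_fix k : #|aut_fix k| = num_images p l n2 C E k * #|aut_fix k.+1|.
Proof.
rewrite /num_images big_distrl /=; under eq_bigr do rewrite -card_hit.
have idm a : (C a %% p ^ k) %% p ^ k = C a %% p ^ k by rewrite modn_mod.
rewrite -sum1_card (eq_bigr (fun a : {perm gT} => \sum_(c < p ^ n2) (a \in aut_hit k c : nat))); last first.
  move=> a /aut_fixP[aM ha].
  have [c cn hc] := cand_exists gG gG N_eq C_coord E_coord (D := fun x => C x %% p ^ k) aM (@perm_inj _ a) ha.
  rewrite (bigD1 (Ordinal cn)) //= big1 => [|c' cc']; first by rewrite addn0; apply/esym/eqP; rewrite eqb1; apply/aut_hitP.
  apply/eqP; rewrite eqb0; apply: contra cc' => /aut_hitP[_ hc'].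
  apply/eqP/val_inj; apply: (cand_inj gG gG N_eq E_coord (k := k) (D := fun x => C x %% p ^ k)) => //= x.
  by rewrite -(permKV a x) hc hc'.
rewrite exchange_big /=; apply: eq_bigr => c _.
rewrite -sum1_card big_mkcond /= [RHS]big_mkcond /=; apply: eq_bigr => a _.
have [h|] := boolP (a \in aut_hit k c); last by case: ifP.
suff -> : a \in aut_fix k by [].
case/aut_hitP: h => aM ha; apply/aut_fixP; split=> // x.
have pk : 0 < p ^ k by rewrite expn_gt0 prime_gt0.
(* Reduction modulo [p ^ k] forgets the digit that the candidate adds. *)
have := congr1 (modn^~ (p ^ k)) (ha x); rewrite /cand /= addnC mulnC modnMDl modn_mod => ->.
by rewrite modn_dvdm // dvdn_exp2l.
Qed.

(** Such an automorphism is determined by the elements [(b j)^-1 * a (b j)] of the derived subgroup,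
    and these are arbitrary because the identity can be twisted by them. *)
Lemma card_aut_der : #|aut_fix n| = #|G'| ^ n.
Proof.
have [b bC] := coord_basis p_pr C_coord.
pose F (a : {perm gT}) := [ffun j : 'I_n => ((b j)^-1 * a (b j))%g].
have Cfix a : a \in aut_fix n -> forall x, C (a x) = C x.
  by move=> /aut_fixP[_ h] x; have := h x; rewrite !modn_small // coord_ltT.
have F_inj : {in aut_fix n &, injective F}.
  move=> a a' /aut_fixP[aM _] /aut_fixP[aM' _] /ffunP eF; apply/permP.
  apply: (hom_eq_basis gG C_coord bC aM aM') => j.
  by have := eF j; rewrite !ffunE => /mulgI.
rewrite -(card_in_imset F_inj) -[n in RHS]card_ord -card_ffun_on; apply: eq_card => z.
apply/imsetP/ffun_onP => [[a ha ->] j|zG].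
  by rewrite ffunE -(coord_eq p_pr C_coord) Cfix.
have iM : {morph id : x y / (x * y)%g >-> (x * y : gT)%g} by [].
have iI : injective (fun x : gT => x) by [].
have tI := twist_inj gG gG C_coord iM zG iI.
have tM := twistM gG gG C_coord iM zG.
exists (perm tI).
  apply/aut_fixP; split=> [x y|x]; first by rewrite !permE tM.
  rewrite permE; congr (_ %% _).
  by apply/eqP; rewrite eq_sym (coord_eq p_pr C_coord) mulKg; apply: twist_der.
apply/ffunP => j; rewrite ffunE permE (twist_basis gG) ?mulKg //.
Qed.

(** The last stabiliser has order [#|G'| ^ n]; one factor [#|G'|] goes to each stage, in accordance
    with the final loop of [count_prg]. *)
Lemma card_Aut : #|Aut [set: gT]| = \prod_(k < n) (num_images p l n2 C E k * (N %/ p ^ n)).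
Proof.
have -> : N %/ p ^ n = #|G'|.
  by rewrite -cardG -cardsT -(coord_card C_coord) mulKn // expn_gt0 prime_gt0.
rewrite big_split /= prod_nat_const card_ord -card_aut_der -aut0.
suff h m : #|aut_fix 0| = (\prod_(k < m) num_images p l n2 C E k) * #|aut_fix m| by apply: h.
elim: m => [|m IH]; first by rewrite big_ord0 mul1n.
by rewrite IH card_aut_fix big_ord_recr /= mulnA.
Qed.

End CountAut.

(** The form in which [extend_map] computes least elements: a sum in which only the smallest witness
    is not cancelled. *)
Definition least n (P : nat -> bool) := \sum_(i < n) i * (P i * (\sum_(j < i) P j == 0)).

Lemma leastP n (P : nat -> bool) : (exists2 i, i < n & P i) -> (least n P < n) && P (least n P).
Proof.
move=> [i0 i0n Pi0]; rewrite /least; have ex : exists i, P i by exists i0.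
case: (ex_minnP ex) => m Pm mmin.
have mn : m < n by apply: leq_ltn_trans (mmin _ Pi0) i0n.
rewrite (@sum_only _ (fun i => i * (P i * (\sum_(j < i) P j == 0))) m) //.
  rewrite Pm big1 ?eqxx ?muln1 ?mn ?Pm // => j _; apply/eqP; rewrite eqb0.
  by apply/negP => /mmin; rewrite leqNgt ltn_ord.
move=> j jn jm; case: (boolP (P j)) => [Pj|]; last by rewrite mul0n muln0.
have mj : m < j by rewrite ltn_neqAle eq_sym jm mmin.
by rewrite (bigD1 (Ordinal mj)) //= addn_eq0 Pm andFb !muln0.
Qed.

(** * Closing a partial map under multiplication by generators *)

Section Extend.
Variables (gT hT : finGroupType) (s : seq gT) (t : seq hT) (O : oracle) (p N l : nat).
Hypotheses (gG : class2_expp p N gT) (hG : class2_expp p N hT) (N_eq : N = p ^ l) (l_gt0 : 0 < l).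
Hypotheses (s_num : numbering s) (t_num : numbering t).
Local Notation p_pr := (class2_prime gG).
Let p_prime : prime p. Proof. exact: p_pr. Qed.
Let cardG : #|gT| = N. Proof. by case: gG => _ _ _ _ <-; rewrite cardsT. Qed.
Let cardH : #|hT| = N. Proof. by case: hG => _ _ _ _ <-; rewrite cardsT. Qed.
Variables (n1 n2 : nat) (C : gT -> nat) (E : hT -> nat).
Hypotheses (C_coord : coord p [set: gT] n1 C).
Notation B := (N ^ 50).
Let NB : N < B. Proof. exact: N_lt_B p_pr l_gt0 N_eq. Qed.
Let n1l : n1 <= l. Proof. exact: coord_dim gG N_eq _ _ _ C_coord cardG. Qed.
Notation static := (static s t p N l n1 n2 C E).
Notation ixs := (ix s).
Notation ixt := (ix t).

Section Closure.
Variables (b : 'I_n1 -> gT) (psi : gT -> hT).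
Hypotheses (bC : forall j : 'I_n1, C (b j) = p ^ j) (psiM : {morph psi : x y / (x * y)%g}).

Definition defined (m : memory) := [set x | m 24 (ixs x) != 0].

(** The program does not know [psi]; it only propagates values from the identity along the
    generators, and the invariant says that they agree with [psi] wherever defined. *)
Record partial_map (m : memory) : Prop := PartialMap {
  pm_static : static m;
  pm_n : m 14 0 = n1;
  pm_dom : forall j : 'I_n1, m 38 j = ixs (b j);
  pm_cod : forall j : 'I_n1, m 39 j = ixt (psi (b j));
  pm_val : forall x, m 24 (ixs x) != 0 -> m 24 (ixs x) = (ixt (psi x)).+1;
  pm_one : 1%g \in defined m }.

(** The elements that map [S] into itself by right multiplication form a subgroup. It contains the
    generators, and the orbit of [1] is the whole group. *)
Lemma defined_full (S : {set gT}) : 1%g \in S -> (forall x j, x \in S -> (x * b j)%g \in S) -> S = [set: gT].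
Proof.
move=> S1 Sb; have Kg : group_set [set y | [forall x in S, (x * y)%g \in S]].
  apply/group_setP; split=> [|y z]; rewrite ?inE.
    by apply/forall_inP => x; rewrite mulg1.
  move=> /forall_inP hy /forall_inP hz; apply/forall_inP => x /hy/hz.
  by rewrite mulgA.
have : Group Kg :=: [set: gT].
  by apply: (coord_gen gG C_coord bC) => j; rewrite inE; apply/forall_inP => x; apply: Sb.
move=> E'; apply/setP => x; rewrite [RHS]in_setT; have := in_setT x; rewrite -E' !inE => /forall_inP/(_ _ S1).
by rewrite mul1g.
Qed.

Notation inner := (PIf (RGet 24 (X 1)) (PSet 24
   (RGet 1 (RBin Add (RBin Mul (X 1) (cell 3)) (RGet 38 (X 0))))
   (RBin Add (K 1) (RGet 2 (RBin Add (RBin Mul (RBin Sub (RGet 24 (X 1)) (K 1)) (cell 3)) (RGet 39 (X 0)))))) PSkip).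

Lemma inner_ok (j : 'I_n1) x i m : partial_map m -> let m' := (run O B [:: val j; ixs x; i] inner m).1 in
  [/\ partial_map m', defined m \subset defined m' & x \in defined m -> (x * b j)%g \in defined m'].
Proof.
move=> pm; have [st mn mg mh mv mo] := pm; have [mb T1 T2 _ _ _ _] := st; have [mN _ _ _] := mb.
cbv zeta; set r := [:: _; _; _].
have E1 : run O B r inner m = if x \in defined m then
   (update m 24 (ixs (x * b j)%g) (ixt (psi (x * b j)%g)).+1, [::]) else (m, [::]).
  rewrite inE /=; case: ifP => // hx; rewrite mN mg -cardG T1; congr (update _ _ _ _, _).
  rewrite (mv _ hx) subn1 mh /= cardG -cardH T2 -psiM add1n modn_small // cardH.
  by apply: leq_ltn_trans NB; rewrite -cardH; apply: ix_lt.
rewrite E1; case: (boolP (x \in defined m)) => hx; last by split.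
set m' := update _ _ _ _; rewrite -[(m', [::]).1]/m'.
have sub : defined m \subset defined m'.
  by apply/subsetP => y; rewrite !inE /m' /update /=; case: ifP.
split=> //; last by move=> _; rewrite inE /m' updE.
split=> //.
- by apply: (static_ext st) => y hy k; rewrite /m' updN //; move: hy; rewrite !inE; lia.
- move=> y; rewrite /m' /update eqxx /=; case: (ixs y =P _) => [e _|_]; last exact: mv.
  by rewrite (ix_inj s_num e).
- exact: (subsetP sub).
Qed.

Lemma round_ok i m : partial_map m -> let m' := (run O B [:: i] (PFor (cell 3) (PFor (cell 14) inner)) m).1 in
  [/\ partial_map m', defined m \subset defined m' & forall x j, x \in defined m -> (x * b j)%g \in defined m'].
Proof.
move=> pm; pose I k m' := [/\ partial_map m', defined m \subset defined m' &
  forall x j, ixs x < k -> x \in defined m -> (x * b j)%g \in defined m'].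
have N3 m' r : partial_map m' -> reval m' r (cell 3) = N.
  by case=> -[[]].
suff : I (reval m [:: i] (cell 3)) (run O B [:: i] (PFor (cell 3) (PFor (cell 14) inner)) m).1.
  by rewrite N3 // => -[h1 h2 h3]; split=> // x j; apply: h3; rewrite -cardG ix_lt.
apply: run_for1; first by split.
move=> k m'; rewrite N3 // => kN [pm' sub hk].
pose I2 q m'' := [/\ partial_map m'', defined m' \subset defined m'' &
  forall j : 'I_n1, j < q -> el s k \in defined m' -> (el s k * b j)%g \in defined m''].
rewrite -cardG in kN.
suff : I2 (reval m' [:: k; i] (cell 14)) (run O B [:: k; i] (PFor (cell 14) inner) m').1.
  have -> : reval m' [:: k; i] (cell 14) = n1 by case: pm'.
  move=> [h1 h2 h3]; split=> //; first exact: subset_trans h2.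
  move=> x j; rewrite ltnS leq_eqVlt => /orP[/eqP xk|xk] xm; last by apply/(subsetP h2)/hk.
  have -> : x = el s k by rewrite -xk elK.
  by apply: h3 => //; rewrite -xk elK // (subsetP sub).
apply: run_for1; first by split.
move=> q m''; have -> : reval m' [:: k; i] (cell 14) = n1 by case: pm'.
move=> qn [pm'' sub' hq].
have := inner_ok (Ordinal qn) (el s k) i pm''; rewrite /= ixK // => -[g1 g2 g3].
split=> //; first exact: subset_trans g2.
move=> j; rewrite ltnS leq_eqVlt => /orP[/eqP jq|jq] hkm.
  have -> : j = Ordinal qn by apply: val_inj.
  exact/g3/(subsetP sub').
exact/(subsetP g2)/hq.
Qed.

(** A round that defines nothing new shows that the domain is closed, hence full. Otherwise the
    domain grows, so as many rounds as there are elements suffice. *)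
Lemma closure_ok m : partial_map m ->
  let m' := (run O B [::] (PFor (cell 3) (PFor (cell 3) (PFor (cell 14) inner))) m).1 in
  m' 3 0 = N /\ forall x, m' 24 (ixs x) = (ixt (psi x)).+1.
Proof.
move=> pm; pose I k m' := partial_map m' /\ (k < #|defined m'| \/ defined m' = [set: gT]).
have N3 m' r : partial_map m' -> reval m' r (cell 3) = N by case=> -[[]].
suff : I (reval m [::] (cell 3)) (run O B [::] (PFor (cell 3) (PFor (cell 3) (PFor (cell 14) inner))) m).1.
  rewrite N3 //; set m' := (run _ _ _ _ _).1 => -[pm' full]; split; first by have := N3 _ [::] pm'.
  have e : defined m' = [set: gT].
    by case: full => // h; have := max_card (mem (defined m')); rewrite cardG leqNgt h.
  by move=> x; apply: (pm_val pm'); have := in_setT x; rewrite -e inE.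
apply: run_for1; first by split=> //; left; rewrite card_gt0; apply/set0Pn; exists 1%g; case: pm.
move=> k m' _ [pm' full]; have [pm'' sub hb] := round_ok k pm'; split=> //.
set m2 := (run _ _ _ _ _).1 in pm'' sub hb *.
have [e|ne] := eqVneq (defined m2) (defined m').
  by right; apply: defined_full => [|x j]; [case: pm''|rewrite {1}e; apply: hb].
case: full => [h|h]; last by right; apply/eqP; rewrite eqEsubset subsetT -h.
left; apply: (leq_ltn_trans h); apply: proper_card.
by rewrite properEneq eq_sym ne.
Qed.

End Closure.
End Extend.

(** * From pinned coordinates to an isomorphism *)

Section ExtendMap.
Variables (gT hT : finGroupType) (s : seq gT) (t : seq hT) (O : oracle) (p N l : nat).
Hypotheses (gG : class2_expp p N gT) (hG : class2_expp p N hT) (N_eq : N = p ^ l) (l_gt0 : 0 < l).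
Hypotheses (s_num : numbering s) (t_num : numbering t).
Local Notation p_pr := (class2_prime gG).
Let p_prime : prime p. Proof. exact: p_pr. Qed.
Let cardG : #|gT| = N. Proof. by case: gG => _ _ _ _ <-; rewrite cardsT. Qed.
Let cardH : #|hT| = N. Proof. by case: hG => _ _ _ _ <-; rewrite cardsT. Qed.
Variables (n1 n2 : nat) (C : gT -> nat) (E D : hT -> nat).
Hypothesis C_coord : coord p [set: gT] n1 C.
Notation B := (N ^ 50).
Let NB : N < B. Proof. exact: N_lt_B p_pr l_gt0 N_eq. Qed.
Let n1l : n1 <= l. Proof. exact: coord_dim gG N_eq _ _ _ C_coord cardG. Qed.
Notation static := (static s t p N l n1 n2 C E).
Notation ixs := (ix s).
Notation ixt := (ix t).

(** Elements [c j] with the right pinned coordinates differ from [phi (b j)] by elements of the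
    derived subgroup, and [phi] can be twisted by these. So no choice of lifts can fail. *)
Lemma extend_to_basis (b : 'I_n1 -> gT) (c : 'I_n1 -> hT) : pinb p n1 C D ->
  (forall j : 'I_n1, C (b j) = p ^ j) -> (forall j : 'I_n1, D (c j) = p ^ j) ->
  exists psi, [/\ {morph psi : x y / (x * y)%g}, injective psi & forall j, psi (b j) = c j].
Proof.
move=> /pinbP[phi [phiM phi_inj phiD]] bC cD.
have phiC x : D (phi x) = C x by rewrite phiD modn_small // coord_ltT.
have [|phi' phiK phi'K] := inj_card_bij phi_inj; first by rewrite cardG cardH.
have phi'M x y : phi' (x * y)%g = (phi' x * phi' y)%g by apply: phi_inj; rewrite phiM !phi'K.
have phiG x : x \in [set: gT]^`(1)%g -> phi x \in [set: hT]^`(1)%g.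
  move=> xG; apply: (der_preim hG gG phi'M (can_inj phi'K)); by rewrite phiK.
pose z j := ((phi (b j))^-1 * c j)%g.
have zH j : z j \in [set: hT]^`(1)%g.
  rewrite -[z j]phi'K; apply: phiG.
  have phiV x : phi x^-1%g = (phi x)^-1%g.
    have phi1 : phi 1%g = 1%g by apply: (mulgI (phi 1%g)); rewrite -phiM !mulg1.
    by apply: (mulgI (phi x)); rewrite -phiM !mulgV.
  have -> : phi' (z j) = ((b j)^-1 * phi' (c j))%g.
    by apply: phi_inj; rewrite phi'K phiM phiV phi'K.
  by rewrite -(coord_eq p_pr C_coord) bC -phiC phi'K cD.
exists (twist p C phi z); split.
- exact: (twistM gG hG C_coord phiM zH).
- exact: (twist_inj gG hG C_coord phiM zH phi_inj).
- by move=> j; rewrite (twist_basis gG) ?mulKVg.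
Qed.

Lemma extend_map_ok m : static m -> m 14 0 = n1 -> m 12 0 = ixs 1%g -> m 22 0 = ixt 1%g ->
  (forall y, m 31 (ixt y) = D y) -> pinb p n1 C D ->
  exists psi, [/\ {morph psi : x y / (x * y)%g}, injective psi &
    forall x, (run O B [::] extend_map m).1 0 (ixs x) = ixt (psi x)].
Proof.
move=> st m14 m12 m22 m31 pin; have [mb T1 T2 mC mE w1 w2] := st; have [mN mP ml mpow] := mb.
rewrite /extend_map; set a1 := PFor _ (PSet 38 _ _); set a2 := PFor _ (PSet 39 _ _).
set a3 := PFor _ (PSet 24 _ _); set a4 := PSet 24 _ _; set a5 := PFor _ (PFor _ (PFor _ _)).
set a6 := PFor _ (PSet 0 _ _); set r := [::].
pose m1 := (run O B r a1 m).1; pose m2 := (run O B r a2 m1).1; pose m3 := (run O B r a3 m2).1.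
pose m4 := (run O B r a4 m3).1; pose m5 := (run O B r a5 m4).1.
have -> : (run O B r (a1 ;; a2 ;; a3 ;; a4 ;; a5 ;; a6) m).1 = (run O B r a6 m5).1 by [].
have p1 := prime_gt1 p_prime.
have pj (j : 'I_n1) : p ^ j < p ^ n1 by rewrite ltn_exp2l.
have mp (j : 'I_n1) : m 6 j = p ^ j by rewrite mpow //; have := ltn_ord j; lia.
have h38 (j : 'I_n1) : {g : gT | m1 38 j = ixs g & C g = p ^ j}.
  set w := least N (fun x => m 11 x == p ^ j + 1).
  have /andP[wN wP] : (w < N) && (m 11 w == p ^ j + 1).
    apply: (@leastP N (fun x => m 11 x == p ^ j + 1)).
    have [g _ gj] := coord_surj C_coord (pj j).
    by exists (ixs g); rewrite ?mC ?gj ?addn1 // -cardG ix_lt.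
  have wG : w < #|gT| by rewrite cardG.
  exists (el s w); last by have := mC (el s w); rewrite ixK // (eqP wP) addn1 => -[].
  rewrite ixK // /m1 run_fill // eqxx.
  have -> : reval m r (cell 14) = n1 by [].
  rewrite ltn_ord /= mN mp modn_small //; exact: ltn_trans wN NB.
have f1 x : x != 38 -> m1 x =1 m x by move=> h j; rewrite /m1 run_frame // inE.
have h39 (j : 'I_n1) : {g : hT | m2 39 j = ixt g & D g = p ^ j}.
  set w := least N (fun x => m 31 x == p ^ j).
  have /andP[wN wP] : (w < N) && (m 31 w == p ^ j).
    apply: (@leastP N (fun x => m 31 x == p ^ j)).
    have [g _ gj] := coord_surj C_coord (pj j).
    have /pinbP[phi [_ _ phiD]] := pin.
    exists (ixt (phi g)); first by rewrite -cardH ix_lt.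
    by rewrite m31 phiD modn_small ?gj.
  have wG : w < #|hT| by rewrite cardH.
  exists (el t w); last by rewrite -m31 ixK //; apply/eqP.
  rewrite ixK // /m2 run_fill // eqxx.
  have -> : reval m1 r (cell 14) = n1 by rewrite -m14 -f1.
  have -> : reval m1 (val j :: r) (RSum (cell 3) (X 0 * ((31 .{X 0} == 6 .{X 1}) *
      (RSum (X 0) (31 .{X 0} == 6 .{X 2}) == K 0))))%rex = reval m (val j :: r) (RSum (cell 3) (X 0 * ((31 .{X 0} == 6 .{X 1}) *
      (RSum (X 0) (31 .{X 0} == 6 .{X 2}) == K 0))))%rex.
    by apply: reval_reads => x hx; apply: f1; move: hx; rewrite !inE; lia.
  rewrite ltn_ord /= mN mp modn_small //; exact: ltn_trans wN NB.
pose b j := s2val (h38 j); pose c j := s2val (h39 j).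
have bm (j : 'I_n1) : m1 38 j = ixs (b j) by rewrite /b; case: (h38 j).
have bC (j : 'I_n1) : C (b j) = p ^ j by rewrite /b; case: (h38 j).
have cm (j : 'I_n1) : m2 39 j = ixt (c j) by rewrite /c; case: (h39 j).
have cD (j : 'I_n1) : D (c j) = p ^ j by rewrite /c; case: (h39 j).
have [psi [psiM psi_inj psib]] := extend_to_basis pin bC cD.
exists psi; split=> //.
have f4 x : x \notin [:: 24; 38; 39] -> m4 x =1 m x.
  by move=> hx j; rewrite /m4 /m3 /m2 /m1 !run_frame //; move: hx; rewrite !inE; lia.
have psi1 : psi 1%g = 1%g by apply: (mulgI (psi 1%g)); rewrite -psiM !mulg1.
have h24 x : m4 24 (ixs x) = if x == 1%g then (ixt 1%g).+1 else 0.
  have N3 m' : m' 3 0 = m 3 0 -> reval m' r (cell 3) = N by move=> h; rewrite -mN -h.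
  have e3 : m3 24 (ixs x) = 0.
    rewrite /m3 run_fill // eqxx N3; last by rewrite /m2 run_frame // f1.
    by rewrite -cardG ix_lt // mod0n.
  rewrite /m4 /= (_ : m3 12 0 = ixs 1%g); last by rewrite /m3 run_frame // /m2 run_frame // f1.
  rewrite (_ : m3 22 0 = ixt 1%g); last by rewrite /m3 run_frame // /m2 run_frame // f1.
  rewrite /update eqxx (inj_eq (ix_inj s_num)) /=; case: (x =P _) => _; last exact: e3.
  rewrite addn1 modn_small //; apply: leq_ltn_trans NB; rewrite -cardH; exact: ix_lt.
have pm : partial_map s t p N l n2 C E b psi m4.
  split.
  - by apply: (static_ext st) => x hx; apply: f4; move: hx; rewrite !inE; lia.
  - by rewrite f4.
  - by move=> j; rewrite -bm /m4 run_frame // /m3 run_frame // /m2 run_frame.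
  - by move=> j; rewrite psib -cm /m4 run_frame // /m3 run_frame.
  - by move=> x; rewrite h24; case: (x =P _) => // -> _; rewrite psi1.
  - by rewrite inE h24 eqxx.
have := closure_ok O gG hG N_eq l_gt0 s_num t_num C_coord bC psiM pm.
rewrite -/a5 -/m5 => -[m5N m5f] x.
rewrite run_fill // eqxx.
have -> : reval m5 r (cell 3) = N by [].
rewrite -cardG ix_lt //= m5f subn1 cardG modn_small //.
by rewrite (ltn_trans _ NB) // -cardH ix_lt.
Qed.

End ExtendMap.

(** * Complexity of the programs *)

Lemma class2_order p N (gT : finGroupType) : class2_expp p N gT -> exists2 l, 0 < l & N = p ^ l.
Proof.
move=> [p_pr pG nil2 _ cG].
have ntG : ([set: gT] :!=: 1)%g by rewrite -nil_class0 nil2.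
have [_ _ [r er]] := pgroup_pdiv pG ntG.
by exists r.+1; rewrite // -cG er.
Qed.

(** Only the fourth stage consults the oracle. *)
Lemma run_stages O B r a b c d e m : quiet a -> quiet b -> quiet c -> quiet e ->
  let v := run O B r d (run O B r (b ;; c) (run O B r a m).1).1 in
  (run O B r (a ;; b ;; c ;; d ;; e) m).1 = (run O B r e v.1).1 /\
  (run O B r (a ;; b ;; c ;; d ;; e) m).2 = v.2.
Proof.
move=> qa qb qc qe; rewrite !run_seq2.
by rewrite !(@run_quiet _ _ a, @run_quiet _ _ b, @run_quiet _ _ c, @run_quiet _ _ e) // cats0.
Qed.

Section SearchRun.
Variables (gT hT : finGroupType) (s : seq gT) (t : seq hT) (O : oracle) (p N l : nat).
Hypotheses (gG : class2_expp p N gT) (hG : class2_expp p N hT) (N_eq : N = p ^ l) (l_gt0 : 0 < l).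
Hypotheses (s_num : numbering s) (t_num : numbering t).
Local Notation p_pr := (class2_prime gG).
Let p_prime : prime p. Proof. exact: p_pr. Qed.
Let cardG : #|gT| = N. Proof. by case: gG => _ _ _ _ <-; rewrite cardsT. Qed.
Let cardH : #|hT| = N. Proof. by case: hG => _ _ _ _ <-; rewrite cardsT. Qed.
Notation B := (N ^ 50).

Lemma prologue_ok m : base N p l m -> tabl s m 1 -> tabl t m 2 ->
  let m' := (run O B [::] (coordinates 1 11 12 13 ;; coordinates 2 21 22 23) m).1 in
  exists n1 n2 C E, [/\ coord p [set: gT] n1 C, coord p [set: hT] n2 E, static s t p N l n1 n2 C E m',
    m' 12 0 = ix s 1%g & m' 22 0 = ix t 1%g].
Proof.
move=> mb T1 T2; set a1 := coordinates 1 _ _ _; set a2 := coordinates 2 _ _ _; cbv zeta.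
pose m1 := (run O B [::] a1 m).1.
rewrite (run_seq1 _ _ [::] a1) -/m1.
have GN : #|gT| = p ^ l by rewrite cardG.
have HN : #|hT| = p ^ l by rewrite cardH.
have bG : base #|gT| p l m by rewrite cardG.
have [n1 [C [C_coord mC mw me]]] := coordinates_ok (T := 1) (co := 11) (e := 12) (w := 13) O s_num p_pr l_gt0 GN
  (class2_le2 gG) isT isT isT isT isT isT isT bG T1.
rewrite cardG -/a1 -/m1 in mC mw me.
have f1 x : x \notin [:: 7; 8; 9; 10; 11; 12; 13] -> m1 x =1 m x.
  by move=> hx j; apply: run_frame; move: hx; rewrite !inE; lia.
have bH : base #|hT| p l m1.
  by rewrite cardH; apply: (base_ext mb) => x hx; apply: f1; move: hx; rewrite !inE; lia.
have T2' : tabl t m1 2 by apply: (tabl_ext T2); apply: f1.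
have [n2 [E [E_coord mE mv me']]] := coordinates_ok (T := 2) (co := 21) (e := 22) (w := 23) O t_num p_pr l_gt0 HN
  (class2_le2 hG) isT isT isT isT isT isT isT bH T2'.
rewrite cardH -/a2 in mE mv me'.
have f2 x : x \notin [:: 7; 8; 9; 10; 21; 22; 23] -> (run O B [::] a2 m1).1 x =1 m1 x.
  by move=> hx j; apply: run_frame; move: hx; rewrite !inE; lia.
exists n1, n2, C, E; split=> //; last by rewrite f2.
split=> //.
- by apply: (base_ext mb) => x hx j; rewrite f2 ?f1 //; move: hx; rewrite !inE; lia.
- by apply: (tabl_ext T1) => j; rewrite f2 ?f1.
- by apply: (tabl_ext T2) => j; rewrite f2 ?f1.
- by move=> x; rewrite f2.
- by rewrite f2.
Qed.

Hypothesis O_iso : iso_oracle p O.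

Lemma search_ok m : m 0 0 = N -> tabl s m 1 -> tabl t m 2 ->
  let u := run O B [::] search_prg m in
  (forall q, q \in u.2 -> valid_q p N q) /\
  (([set: gT] \isog [set: hT])%g -> exists psi : gT -> hT, [/\ {morph psi : x y / (x * y)%g}, injective psi &
    forall x, u.1 0 (ix s x) = ix t (psi x)]).
Proof.
move=> m0 T1 T2; rewrite /search_prg; set a1 := coordinates 1 _ _ _; set a2 := coordinates 2 _ _ _; cbv zeta.
pose m1 := (run O B [::] setup m).1; pose m2 := (run O B [::] (a1 ;; a2) m1).1.
pose v := run O B [::] (pin_all 33) m2.
have [-> ->] := @run_stages O B [::] setup a1 a2 (pin_all 33) extend_map m isT isT isT isT.
rewrite -/m1 -/m2 -/v.
have b1 : base N p l m1 by apply: setup_ok.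
have f1 x : x \notin [:: 3; 4; 5; 6] -> m1 x =1 m x.
  by move=> hx j; apply: run_frame; move: hx; rewrite !inE; lia.
have T1' : tabl s m1 1 by apply: (tabl_ext T1); apply: f1.
have T2' : tabl t m1 2 by apply: (tabl_ext T2); apply: f1.
have [n1 [n2 [C [E [C_coord E_coord st m12 m22]]]]] := prologue_ok b1 T1' T2'.
rewrite -/m2 in st m12 m22.
have [D [st' s' h14 [Dcov h31] [pin val]]] := pin_all_search gG hG N_eq l_gt0 s_num t_num O_iso C_coord E_coord st.
rewrite -/v in st' s' h14 h31 val; split=> // /pin Dpin.
by apply: (extend_map_ok O gG hG N_eq l_gt0 s_num t_num C_coord st') => //; rewrite s'.
Qed.

End SearchRun.

Section CountRun.
Variables (gT : finGroupType) (s : seq gT) (O : oracle) (p N l : nat).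
Hypotheses (gG : class2_expp p N gT) (N_eq : N = p ^ l) (l_gt0 : 0 < l).
Hypotheses (s_num : numbering s) (O_iso : iso_oracle p O).
Local Notation p_pr := (class2_prime gG).
Let cardG : #|gT| = N. Proof. by case: gG => _ _ _ _ <-; rewrite cardsT. Qed.
Notation B := (N ^ 50).

Lemma count_ok m : m 0 0 = N -> tabl s m 1 ->
  let u := run O B [::] count_prg m in
  (forall q, q \in u.2 -> valid_q p N q) /\
  u.1 14 0 <= N /\ \prod_(k < u.1 14 0) u.1 37 k = #|Aut [set: gT]|.
Proof.
move=> m0 T1; rewrite /count_prg; set a0 := PFor _ (PSet 2 _ _).
set a1 := coordinates 1 _ _ _; set a2 := coordinates 2 _ _ _; set a3 := PFor _ _; cbv zeta.
pose m1 := (run O B [::] setup m).1; pose m1' := (run O B [::] a0 m1).1; pose m2 := (run O B [::] (a1 ;; a2) m1').1.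
pose v := run O B [::] (pin_all 30) m2.
have [-> ->] := @run_stages O B [::] (setup ;; a0) a1 a2 (pin_all 30) a3 m isT isT isT isT.
rewrite (run_seq1 _ _ [::] setup) -/m1 -/m1' -/m2 -/v.
have NB : N < B := N_lt_B p_pr l_gt0 N_eq.
have b1 : base N p l m1 by apply: (setup_ok O p_pr).
have f1 x : x \notin [:: 3; 4; 5; 6] -> m1 x =1 m x.
  by move=> hx j; apply: run_frame; move: hx; rewrite !inE; lia.
have f1' x : x != 2 -> m1' x =1 m1 x by move=> hx j; apply: run_frame; rewrite inE.
have T1' : tabl s m1' 1 by apply: (tabl_ext T1) => j; rewrite f1' ?f1.
have T2' : tabl s m1' 2.
  move=> x y; rewrite -T1' /m1' run_fill // [in RHS]run_fill // eqxx.
  have -> : reval m1 [::] (RBin Mul (cell 3) (cell 3)) = N * N by rewrite -(baseN b1).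
  have -> : reval m1 [:: ix s x * #|gT| + ix s y] (RGet 1 (X 0)) = m1 1 (ix s x * #|gT| + ix s y) by [].
  have -> : ix s x * #|gT| + ix s y < N * N.
    have hx := ix_lt s_num x; have hy := ix_lt s_num y.
    have : (ix s x).+1 * #|gT| <= N * N by rewrite cardG leq_mul2r -cardG hx orbT.
    by rewrite mulSn; lia.
  rewrite /= f1 // T1 modn_small // (ltn_trans _ NB) // -cardG; exact: ix_lt.
have b1' : base N p l m1'.
  by apply: (base_ext b1) => x hx j; rewrite f1' //; move: hx; rewrite !inE; lia.
have [n1 [n2 [C [E [C_coord E_coord st m12 m22]]]]] := prologue_ok O gG gG N_eq l_gt0 s_num s_num b1' T1' T2'.
rewrite -/m2 in st.
have [st' h14 h37 val] := pin_all_count gG N_eq l_gt0 s_num O_iso C_coord E_coord st.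
rewrite -/v in st' h14 h37 val; split=> //.
have n1l : n1 <= l := coord_dim gG N_eq C_coord cardG.
have n2l : n2 <= l := coord_dim gG N_eq E_coord cardG.
have e14 : (run O B [::] a3 v.1).1 14 0 = n1 by rewrite run_frame.
rewrite e14; split; first by apply: leq_trans n1l _; apply: ltnW (l_lt_N p_pr N_eq).
rewrite (card_Aut gG N_eq C_coord E_coord); apply: eq_bigr => k _.
pose I i (m' : memory) := [/\ m' 3 0 = N, m' 13 0 = p ^ n1, m' 14 0 = n1 & forall j, j < n1 ->
  m' 37 j = num_images p l n2 C E j * (if j < i then N %/ p ^ n1 else 1)].
have [_ _ _ _ _ v13 _] := st'; have [vN _ _ _] := st_base st'.
have : I (reval v.1 [::] (cell 14)) (run O B [::] a3 v.1).1.
  apply: run_for1; first by split=> // j jn; rewrite h37 ?muln1.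
  move=> i m'; have -> : reval v.1 [::] (cell 14) = n1 by [].
  move=> iN [g1 g2 g3 g4]; split=> // j jn.
  rewrite /= g1 g2 /update eqxx /= g4 // ltnS (leq_eqVlt j).
  case: (j =P i) => [->|_]; last by rewrite g4.
  rewrite ltnn muln1 modn_small //.
  have h1 : num_images p l n2 C E i <= N.
    apply: leq_trans (_ : p ^ n2 <= N); last by rewrite N_eq leq_pexp2l ?(prime_gt0 p_pr).
    by rewrite -[X in _ <= X]card_ord -sum1_card; apply: leq_sum => c _; case: (pinb _ _ _ _).
  apply: leq_ltn_trans (leq_mul h1 (leq_div _ _)) _.
  by rewrite mulnn ltn_exp2l // (N_gt1 p_pr l_gt0 N_eq).
have -> : reval v.1 [::] (cell 14) = n1 by [].
by move=> [_ _ _ h]; rewrite h // ltn_ord.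
Qed.

End CountRun.

Lemma bits_lt n k : n < 2 ^ k.+1 -> bits n <= k.+1.
Proof.
have [->|n0] := posnP n; first by rewrite /bits trunc_log0.
move=> h; have := leq_ltn_trans (trunc_logP (ltnSn 1) n0) h.
by rewrite ltn_exp2l.
Qed.

Lemma bitsM a b : bits (a * b) <= bits a + bits b.
Proof.
rewrite {2}/bits addnS; apply: bits_lt; rewrite -addnS expnD /bits.
apply: leq_trans (_ : a.+1 * b.+1 <= _); first by rewrite mulnS mulSn; lia.
by apply: leq_mul; apply: trunc_log_ltn.
Qed.

(** The product may be superpolynomial, but its length is not. *)
Lemma bits_prod (F : nat -> nat) n b : (forall k, k < n -> F k <= b) -> bits (\prod_(k < n) F k) <= n * b.+1 + 1.
Proof.
elim: n => [|n IH] h; first by rewrite big_ord0.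
rewrite big_ord_recr /=; apply: leq_trans (bitsM _ _) _.
have h1 := leq_trans (bits_le (F n)) (h n (ltnSn n) : (F n).+1 <= b.+1).
have h2 := IH (fun k kn => h k (ltnW kn)).
by rewrite mulSn addnC -addnA leq_add.
Qed.

Lemma pb_expn k : pbound (fun X => X ^ k).
Proof.
exists 1, k => X; rewrite mul1n; case: k => [|k]; first by rewrite !expn0.
by rewrite leq_exp2r.
Qed.

(** The same [c] and [d] must serve for the running time and for the order of the queried groups,
    which is where [X ^ k] comes from. The successor is absorbed by [X.+1 <= 2 * X]. *)
Lemma pb_polynomial f k : pbound f -> exists c d, forall X, 0 < X -> f X <= c * X ^ d /\ X ^ k <= c * X ^ d.
Proof.
move=> [c [d h]]; exists (c * 2 ^ d + 1), (d + k) => X X0.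
have Xd : 0 < X ^ d by rewrite expn_gt0 X0.
have Xk : 0 < X ^ k by rewrite expn_gt0 X0.
rewrite expnD; split; last by rewrite mulnA leq_pmull // muln_gt0 addn1.
apply: leq_trans (h X) _; apply: leq_trans (_ : c * (2 ^ d * X ^ d) <= _).
  rewrite leq_mul2l -expnMn; apply/orP; right.
  by case: (d) => [|d']; rewrite ?expn0 // leq_exp2r // mul2n -addnn -addn1 leq_add2l.
by rewrite !mulnA; apply: leq_trans (leq_pmulr _ Xk); rewrite leq_mul2r leq_addr orbT.
Qed.

Fixpoint power_expr k := if k is k'.+1 then Bin Mul (power_expr k') (Get 0 (Cst 0)) else Cst 1.

Lemma eval_power m k : eval m (power_expr k) = m 0 0 ^ k.
Proof. by elim: k => //= k ->; rewrite expnSr. Qed.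

Lemma ecost_power k : exists2 f, pbound f & forall m, ecost m (power_expr k) <= f (m 0 0).
Proof.
elim: k => [|k [f pf hf]]; first by exists (fun=> 1) => //; apply: pb_const.
exists (fun X => f X + X ^ k + X + X + 20).
  apply: pb_add (pb_const _); apply: pb_add pb_id; apply: pb_add pb_id; exact: pb_add (pb_expn k).
move=> m /=; rewrite eval_power; have := hf m; have := bits_le (m 0 0 ^ k); have := bits_le (m 0 0).
by have := bits_le 0; lia.
Qed.

Definition prelude := Assign bnd (Cst 0) (power_expr 50).

(** The clamp is not part of the input; the machine computes it from the order of the group before
    the compiled program starts. *)
Lemma cc_prelude_exec c : wfp 0 c -> exists2 f, pbound f & forall O N M0,
  0 < N -> M0 0 0 = N -> bounded M0 (N ^ 50) ->
  exists M t, [/\ exec O (Then prelude (cc 0 c)) M0 M t (run O (N ^ 50) [::] c M0).2, t <= f N &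
    same_user M (run O (N ^ 50) [::] c M0).1].
Proof.
move=> wc; have [f pf hf] := cc_exec wc; have [g pg hg] := ecost_power 50.
exists (fun X => g X + X ^ 50 + 10 + f (X ^ 50)).
  by apply: pb_add (pb_comp pf (pb_expn 50)); apply: pb_add (pb_const _); apply: pb_add (pb_expn 50).
move=> O N M0 N0 M00 bM0; pose M1 := update M0 bnd 0 (N ^ 50).
have B0 : 0 < N ^ 50 by rewrite expn_gt0 N0.
have lk : linked 0 (N ^ 50) [::] M0 M1.
  by split=> [x xu i||//]; [rewrite /M1 updN // (usr_neq xu)|rewrite /M1 updE].
have [M [t [ex tf [lu _ _] _]]] := hf O _ M1 M0 [::] (N ^ 50) B0 (leqnn _) erefl lk bM0 isT.
pose T0 := ecost M0 (Cst 0) + ecost M0 (power_expr 50) + bits 0 + bits (N ^ 50).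
have e1 : exec O prelude M0 M1 T0 [::].
  have := ExecAssign O M0 bnd (Cst 0) (power_expr 50).
  by rewrite eval_power M00.
exists M, (T0 + t); split=> //.
  by have := ExecThen e1 ex.
apply: leq_add tf.
have := hg M0; rewrite M00 /T0; have := bits_le (N ^ 50); have := bits_le 0.
rewrite [ecost M0 (Cst 0)]/=.
by move: (N ^ 50) => w; move: (ecost _ _) (bits w) (bits 0) => *; lia.
Qed.

(* Outside the clamped language, because the product is not polynomially bounded. *)
Definition product_loop := Then (Assign 0 (Cst 0) (Cst 1)) (Then (Assign vr (Cst 0) (Cst 0))
  (Then (Assign lim (Cst 0) (Get 14 (Cst 0))) (While (Bin Lt (loop_var 0) (loop_lim 0))
    (Then (Assign 0 (Cst 0) (Bin Mul (Get 0 (Cst 0)) (Get 37 (loop_var 0)))) (Assign vr (Cst 0) (Bin Add (loop_var 0) (Cst 1))))))).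

(** At most [b] factors of at most [b + 1] bits each keep every partial product within
    [b * (b + 1) + 1] bits. *)
Lemma product_exec : exists2 f, pbound f & forall O M n b, M 14 0 = n -> n <= b ->
  (forall k, k < n -> M 37 k <= b) ->
  exists M' t, [/\ exec O product_loop M M' t [::], t <= f b & M' 0 0 = \prod_(k < n) M 37 k].
Proof.
pose z b := b * (b + 1) + b + 10; pose g b := 40 * z b.
have pz : pbound z.
  apply: pb_add (pb_const _); apply: pb_add pb_id; exact: pb_mul pb_id (pb_add pb_id (pb_const _)).
have pg : pbound g by apply: pb_mul (pb_const _) pz.
exists (fun b => 1 + b * (g b + 9 * (b + 2)) + 9 * (b + 2) + g b).
  have pc : pbound (fun b => 9 * (b + 2)) by apply: pb_mul (pb_const _) (pb_add pb_id (pb_const _)).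
  exact: (pb_add (pb_add (pb_add (pb_const 1) (pb_mul pb_id (pb_add pg pc))) pc) pg).
move=> O M n b M14 nb M37.
pose M1 := update M 0 0 1; pose M2 := update M1 vr 0 0; pose M3 := update M2 lim 0 n.
have e1 : exec O (Assign 0 (Cst 0) (Cst 1)) M M1 _ [::] := ExecAssign O M 0 (Cst 0) (Cst 1).
have e2 : exec O (Assign vr (Cst 0) (Cst 0)) M1 M2 _ [::] := ExecAssign O M1 vr (Cst 0) (Cst 0).
have e3 : exec O (Assign lim (Cst 0) (Get 14 (Cst 0))) M2 M3 (bits 0 + (bits 0 + bits 0 + bits n) + bits 0 + bits n) [::].
  by have := ExecAssign O M2 lim (Cst 0) (Get 14 (Cst 0)); rewrite /= /M3 -M14.
pose I i (m : memory) := m 0 0 = \prod_(k < i) M 37 k /\ m 37 =1 M 37.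
have b0 := bits_le 0; have b1 := bits_le 1; have bn := bits_le n.
have [||||M' [t [ex tb [M'0 _]]]] := @exec_count O I 0 n (Then (Assign 0 (Cst 0) (Bin Mul (Get 0 (Cst 0)) (Get 37 (loop_var 0)))) (Assign vr (Cst 0) (Bin Add (loop_var 0) (Cst 1))))
  (g b) (fun=> [::]) M3.
- move=> i m ilt [m0 m37] mv ml.
  pose m1 := update m 0 0 (\prod_(k < i.+1) M 37 k).
  have f1 := ExecAssign O m 0 (Cst 0) (Bin Mul (Get 0 (Cst 0)) (Get 37 (loop_var 0))).
  have E1 : eval m (Bin Mul (Get 0 (Cst 0)) (Get 37 (loop_var 0))) = \prod_(k < i.+1) M 37 k.
    by rewrite /= big_ord_recr /= mv m0 m37.
  rewrite E1 -/m1 in f1.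
  pose m2 := update m1 vr 0 i.+1.
  have m1v : m1 vr 0 = i by [].
  have f2 := ExecAssign O m1 vr (Cst 0) (Bin Add (loop_var 0) (Cst 1)).
  have E2 : eval m1 (Bin Add (loop_var 0) (Cst 1)) = i.+1 by rewrite /= m1v addn1.
  rewrite E2 -/m2 in f2.
  have f := ExecThen f1 f2.
  eexists; eexists; split; [exact: f| |by split| |].
  + rewrite /= mv m0 m37 m1v.
    have hP k : k <= n -> bits (\prod_(j < k) M 37 j) <= b * (b + 1) + 1.
      move=> kn; apply: leq_trans (bits_prod (b := b) _) _.
        by move=> j jk; apply: M37; apply: leq_trans jk kn.
      by rewrite [b + 1]addn1 leq_add2r leq_mul2r (leq_trans kn nb) orbT.
    have := hP _ ilt; have := hP _ (ltnW ilt); have := bits_le i; have := bits_le i.+1.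
    have := bits_le (M 37 i); have := M37 _ ilt.
    rewrite /g /z; move: (bits (\prod_(k < i.+1) _)) (bits (\prod_(k < i) _)) => u w.
    by move: (bits (M 37 i)) (bits i) (bits i.+1) (bits 0) (bits 1) b0 b1 (b * (b + 1)) => *; lia.
  + by [].
  + by [].
- by split; rewrite ?big_ord0.
- by [].
- by [].
exists M'; eexists; split; [| |exact: M'0].
  have e := ExecThen e1 (ExecThen e2 (ExecThen e3 ex)).
  have qe : flatten [seq (fun=> [::]) i | i <- iota 0 n] = [::] :> seq query by elim: (iota 0 n).
  by rewrite qe in e; exact: e.
have h : n * (g b + cond_cost 0 n) + cond_cost 0 n <= b * (g b + 9 * (b + 2)) + 9 * (b + 2).
  have c : cond_cost 0 n <= 9 * (b + 2) by rewrite /cond_cost; lia.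
  by rewrite leq_add // leq_mul // leq_add2l.
have h2 : 40 * (b + 10) <= g b.
  by rewrite /g /z; move: (b * (b + 1)) => *; lia.
have {h tb} := leq_trans tb h; move: h2 b0 b1 bn.
rewrite [ecost _ _]/= [ecost _ (Cst 1)]/= [ecost M1 _]/= ![eval _ _]/=.
move: (g b) (bits 0) (bits 1) (bits n) => G u w v; move: (b * _) => *; lia.
Qed.

Lemma valid_query_le p b b' q : b <= b' -> valid_query p b q -> valid_query p b' q.
Proof.
move=> bb [gT [hT [s [t [h1 h2 h3 [h4 h5]]]]]]; exists gT, hT, s, t; split=> //.
by split; [apply: leq_trans h4 bb|apply: leq_trans h5 bb].
Qed.

Lemma cayley_lt (gT : finGroupType) (s : seq gT) i : numbering s -> nth 0 (cayley s) i <= #|gT|.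
Proof.
move=> s_num; have [h|h] := ltnP i (size (cayley s)); last by rewrite nth_default.
have /allpairsP[[x y] [_ _ ->]] := mem_nth 0 h.
by rewrite ltnW // -(size_num s_num) index_mem mem_num.
Qed.

Lemma load_tabl (gT : finGroupType) (s : seq gT) (m : memory) a :
  numbering s -> (forall i, m a i = nth 0 (cayley s) i) -> tabl s m a.
Proof.
move=> s_num h x y; rewrite h -(size_num s_num) nth_cayley ?size_num // -?(size_num s_num) ?index_mem ?mem_num //.
by rewrite !nth_index ?mem_num.
Qed.

Theorem theorem1p5 :
  (exists (P : cmd) (c d : nat),
    forall (p N : nat) (gT hT : finGroupType) (s : seq gT) (t : seq hT)
           (O : seq nat -> seq nat -> bool),
      class2_expp p N gT -> class2_expp p N hT ->
      numbering s -> numbering t -> iso_oracle p O ->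
      exists (m : memory) (time : nat) (qs : seq (seq nat * seq nat)),
        [/\ exec O P (load [:: [:: N]; cayley s; cayley t]) m time qs,
            time <= c * N ^ d,
            (forall q, q \in qs -> valid_query p (c * N ^ d) q)
          & ([set: gT] \isog [set: hT])%g ->
            exists phi : {morphism [set: gT] >-> hT},
              isom [set: gT] [set: hT] phi /\
              mkseq (m 0) N = [seq index (phi x) t | x <- s]])
  /\
  (exists (P : cmd) (c d : nat),
    forall (p N : nat) (gT : finGroupType) (s : seq gT)
           (O : seq nat -> seq nat -> bool),
      class2_expp p N gT -> numbering s -> iso_oracle p O ->
      exists (m : memory) (time : nat) (qs : seq (seq nat * seq nat)),
        [/\ exec O P (load [:: [:: N]; cayley s]) m time qs,
            time <= c * N ^ d,
            (forall q, q \in qs -> valid_query p (c * N ^ d) q)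
          & m 0 0 = #|Aut [set: gT]|]).
Proof.
have cardN p N (gT : finGroupType) : class2_expp p N gT -> #|gT| = N.
  by move=> [_ _ _ _ <-]; rewrite cardsT.
split.
  have [f pf hf] := cc_prelude_exec wf_search.
  have [c [d cd]] := pb_polynomial 50 pf.
  exists (Then prelude (cc 0 search_prg)), c, d => p N gT hT s t O gG hG s_num t_num O_iso.
  have [l l_gt0 N_eq] := class2_order gG; have N0 : 0 < N by rewrite N_eq expn_gt0 prime_gt0 // (class2_prime gG).
  pose M0 := load [:: [:: N]; cayley s; cayley t].
  have NB : N <= N ^ 50 by rewrite -{1}(expn1 N) leq_pexp2l.
  have b0 : bounded M0 (N ^ 50).
    case=> [|[|[|x]]] i _; rewrite /M0 /load /=.
    - by case: i => [|i] //=; rewrite nth_nil.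
    - by rewrite (leq_trans (cayley_lt i s_num)) ?(cardN _ _ _ gG).
    - by rewrite (leq_trans (cayley_lt i t_num)) ?(cardN _ _ _ hG).
    - by rewrite !nth_nil.
  have T1 : tabl s M0 1 by apply: load_tabl.
  have T2 : tabl t M0 2 by apply: load_tabl.
  have [val iso] := search_ok gG hG N_eq l_gt0 s_num t_num O_iso (erefl _ : M0 0 0 = N) T1 T2.
  have [M [u [ex uf Mu]]] := hf O N M0 N0 erefl b0.
  have [c1 c2] := cd N N0.
  eexists; eexists; eexists; split; [exact: ex|exact: leq_trans uf c1| |].
    by move=> q /val; apply: valid_query_le.
  move=> /iso[psi [psiM psi_inj psiE]].
  have same : #|gT| = #|hT| by rewrite (cardN _ _ _ gG) (cardN _ _ _ hG).
  have [phi [phi_iso phiE]] := inj_hom_isog psiM psi_inj same; exists phi; split=> //.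
  apply: (@eq_from_nth _ 0); first by rewrite size_mkseq size_map size_num // (cardN _ _ _ gG).
  move=> i; rewrite size_mkseq => iN; rewrite nth_mkseq // Mu //.
  have iG : i < #|gT| by rewrite (cardN _ _ _ gG).
  rewrite (nth_map 1%g) ?size_num // -[in LHS](ixK s_num iG) psiE phiE.
  by [].
have [f pf hf] := cc_prelude_exec wf_count.
have [g pg hg] := product_exec.
(* The entries to be multiplied are bounded by the clamp, so the time of the final product is taken
   at [N ^ 50]. *)
have [c [d cd]] := pb_polynomial 50 (pb_add pf (pb_comp pg (pb_expn 50))).
exists (Then (Then prelude (cc 0 count_prg)) product_loop), c, d => p N gT s O gG s_num O_iso.
have [l l_gt0 N_eq] := class2_order gG; have N0 : 0 < N by rewrite N_eq expn_gt0 prime_gt0 // (class2_prime gG).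
pose M0 := load [:: [:: N]; cayley s].
have NB : N <= N ^ 50 by rewrite -{1}(expn1 N) leq_pexp2l.
have b0 : bounded M0 (N ^ 50).
  case=> [|[|x]] i _; rewrite /M0 /load /=.
  - by case: i => [|i] //=; rewrite nth_nil.
  - by rewrite (leq_trans (cayley_lt i s_num)) ?(cardN _ _ _ gG).
  - by rewrite !nth_nil.
have T1 : tabl s M0 1 by apply: load_tabl.
have [val [h14 prod]] := count_ok gG N_eq l_gt0 s_num O_iso (erefl _ : M0 0 0 = N) T1.
have [M [u [ex uf Mu]]] := hf O N M0 N0 erefl b0.
have [c1 c2] := cd N N0.
have B0 : 0 < N ^ 50 by rewrite expn_gt0 N0.
have rb := @run_bounded O (N ^ 50) count_prg [::] M0 B0 b0.
move: val h14 prod ex Mu rb; set R := run _ _ _ _ _ => val h14 prod ex Mu rb.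
have [||M' [v [ex' vg M'0]]] := hg O M (R.1 14 0) (N ^ 50) (Mu 14 isT 0).
- exact: leq_trans h14 NB.
- by move=> k _; rewrite Mu // rb.
eexists; eexists; eexists; split; [exact: ExecThen ex ex'| | |].
- exact: leq_trans (leq_add uf vg) c1.
- by move=> q; rewrite cats0 => /val; apply: valid_query_le.
by rewrite M'0 -prod; apply: eq_bigr => k _; rewrite Mu.
Qed.
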